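(* Let $\lambda\in\mathbb{C}$ and $|t|<1$. Then the multivariable hypergeometric function ${}^{(k)}E^{(r)}$ satisfies $$\sum_{n=0}^{\infty}\frac{(\lambda)_n}{n!}\,{}^{(k)}E^{(r)}\left(\alpha,\beta_{k+1},\dots,\beta_r;1-\lambda-n,\gamma_2,\dots,\gamma_r;x_1,\dots,x_r\right)t^n$$ $$=(1-t)^{-\lambda}\,{}^{(k)}E^{(r)}\left(\alpha,\beta_{k+1},\dots,\beta_r;1-\lambda,\gamma_2,\dots,\gamma_r;x_1(1-t),x_2,\dots,x_r\right).$$
   Context: The Pochhammer symbol is $(\lambda)_\nu=\Gamma(\lambda+\nu)/\Gamma(\lambda)$ for $\lambda\in\mathbb{C}\setminus\{0,-1,-2,\dots\}$; moreover $(\lambda)_0=1$ and $(\lambda)_n=\lambda(\lambda+1)\cdots(\lambda+n-1)$ for every positive integer $n$ and every $\lambda\in\mathbb{C}$. Let $r\ge 1$ and $0\le k\le r$ be integers and $\rho\ge 0$. The multivariable hypergeometric function ${}^{(k)}E^{(r)}$ (depending on $\rho$) with complex parameters $\alpha,\beta_{k+1},\dots,\beta_r,\gamma_1,\dots,\gamma_r$ and complex variables $x_1,\dots,x_r$ is $${}^{(k)}E^{(r)}(\alpha,\beta_{k+1},\dots,\beta_r;\gamma_1,\dots,\gamma_r;x_1,\dots,x_r):=\sum_{m_1,\dots,m_r=0}^{\infty}(\alpha)_{\rho(m_1+\dots+m_k)+m_{k+1}+\dots+m_r}\frac{(\beta_{k+1})_{m_{k+1}}\cdots(\beta_r)_{m_r}}{(\gamma_1)_{m_1}\cdots(\gamma_r)_{m_r}}\frac{x_1^{m_1}}{m_1!}\cdots\frac{x_r^{m_r}}{m_r!},$$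 where $\rho(\sqrt{|x_1|}+\dots+\sqrt{|x_k|})+|x_{k+1}|+\dots+|x_r|<1$. Identities are understood for parameters and variables for which the functions occurring in them are defined (Pochhammer symbols defined, denominators nonzero, arguments satisfying this condition, defining series convergent). Powers of $1-t$ are principal.
   Formalization: The series over n on the left is additionally assumed to converge at the given t; for |t|<1 alone it can diverge, e.g. r=k=1, ρ=2, α=1/3, λ=1/2, x=1/5, t=1/2, where all functions occurring are defined. *)

(* Defs.v *)
From HB Require Import structures.
From mathcomp Require Export all_boot all_order all_algebra finmap.
From mathcomp Require Export complex.
From mathcomp Require Export boolp classical_sets reals topology normedtype.
From mathcomp Require Export sequences exp trigo.
From mathcomp Require summability.

Set Implicit Arguments.
Unset Strict Implicit.
Unset Printing Implicit Defensive.

Export Order.TTheory GRing.Theory Num.Theory numFieldNormedType.Exports.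

#[global] Open Scope classical_set_scope.
#[global] Open Scope ring_scope.

(* R[i] carries the topology of its modulus, as every numClosedFieldType does *)
Section ComplexTopology.
Variable R : realType.
#[non_forgetful_inheritance]
HB.instance Definition _ := GRing.ComAlgebra.copy R[i] R[i]^o.
#[non_forgetful_inheritance]
HB.instance Definition _ := Vector.copy R[i] R[i]^o.
#[non_forgetful_inheritance]
HB.instance Definition _ := NormedModule.copy R[i] R[i]^o.
End ComplexTopology.

Section ComplexFunctions.
Variable R : realType.
Implicit Types z w : R[i].

Definition cexp z : R[i] :=
  Complex (expR (complex.Re z) * cos (complex.Im z))
          (expR (complex.Re z) * sin (complex.Im z)).

Definition cmod z : R := complex.Re `|z|.

(* principal argument, in ]-pi, pi] (for z != 0) *)
Definition carg z : R :=
  let a := acos (complex.Re z / cmod z) in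
  if complex.Im z < 0 then - a else a.

Definition clog z : R[i] := Complex (ln (cmod z)) (carg z).

(* principal power z ^ w (for z != 0) *)
Definition cpow z w : R[i] := cexp (w * clog z).

(* Euler-Gauss limit formula; meaningful off the poles 0, -1, -2, ... *)
Definition Gamma z : R[i] :=
  limn (fun n : nat =>
    n`!%:R * cpow n%:R z / \prod_(j < n.+1) (z + j%:R) : R[i]).

Definition nonpos_integer z : Prop := exists n : nat, z = - n%:R.

Definition rising (lambda : R[i]) (n : nat) : R[i] :=
  \prod_(j < n) (lambda + j%:R).

(* At a natural index the product is used, which makes sense for every lambda
   and agrees with the Gamma quotient when lambda is not a pole. *)
Definition pochhammer (lambda : R[i]) (nu : R) : R[i] :=
  if nu \is a Num.nat then rising lambda (Num.truncn nu)
  else Gamma (lambda + (nu%:C)%C) / Gamma lambda.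

Definition pochhammer_defined (lambda : R[i]) (nu : R) : Prop :=
  nu \is a Num.nat \/
  (~ nonpos_integer lambda /\ ~ nonpos_integer (lambda + (nu%:C)%C)).

End ComplexFunctions.

(* The index i : 'I_r stands for i + 1 in the 1-based numbering, so the first
   group 1, ..., k is i < k and the second group k+1, ..., r is k <= i.
   The values beta i for i < k are never used. *)
Section HypergeometricE.
Variables (R : realType) (r k : nat) (rho : R) (alpha : R[i]).
Variables (beta gamma x : 'I_r -> R[i]).

Definition E_index (m : {ffun 'I_r -> nat}) : R :=
  rho * (\sum_(i < r | (i < k)%N) m i)%:R
  + (\sum_(i < r | (k <= i)%N) m i)%:R.

Definition E_term (m : {ffun 'I_r -> nat}) : R[i] :=
  pochhammer alpha (E_index m)
  * ((\prod_(i < r | (k <= i)%N) rising (beta i) (m i))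
     / \prod_(i < r) rising (gamma i) (m i))
  * \prod_(i < r) (x i ^+ m i / (m i)`!%:R).

(* The multiple series is summed unconditionally: the limit of the finite
   partial sums along the finite sets of multi-indices directed by inclusion. *)
Definition hyperE : R[i] := summability.sum E_term.

(* An inequality between real elements of R[i]. *)
Definition E_domain : Prop :=
  (rho%:C)%C * (\sum_(i < r | (i < k)%N) sqrtC `|x i|)
  + \sum_(i < r | (k <= i)%N) `|x i| < 1.

Definition E_defined : Prop :=
  [/\ forall m, pochhammer_defined alpha (E_index m),
      forall i n, rising (gamma i) n != 0,
      E_domain
    & cvg (summability.partial_sum E_term @ summability.totally)].

End HypergeometricE.

(* Main.v *)
Require Import Defs.
From mathcomp Require Import ring lra.
From mathcomp Require Import derive realfun.
Set Implicit Arguments.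
Unset Strict Implicit.
Unset Printing Implicit Defensive.

(** Write [N] for the first entry of the multi-index [m], and [c m] for the term
of the series E at [x] whose first denominator parameter is [1 - lambda].
Reflecting the rising factorials ([rising_shift]) turns the [m]-th term of the
[n]-th summand on the left into [c m * (lambda - N)_n / n!].  Hence both sides
are the double sum over [m] and [n] of [c m * (lambda - N)_n * t ^ n / n!]:
summing over [n] first gives [c m * (1 - t) ^ (N - lambda)], by the binomial
series.

The difficulty is that this double sum need not converge absolutely.  The
number [(lambda - N)_n / n!] contains the binomial coefficient [C(N, n)], so
absolute convergence would ask for the series of E at [x_1 (1 + |t|)], which
may lie outside its domain.  The exchange is therefore an analytic
continuation ([sum_binom_coef_family]).  By the Vandermonde convolution the
left side at [s t], for real [s < 1], is the binomial series times the
expansion at [w = 1] of [g w], the sum of the [c m * w ^ N].  That expansion is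
compared with [g (1 - s t)] by composing finitely many small recentrings along
the segment from [1] to [1 - s t] ([recentred_comp], [recentred_segment]).
Then [s] tends to 1, with Abel's theorem on the left ([abel_limit]) and
dominated convergence on the right ([tannery]).

For this [g] must be analytic beyond the circle of radius 1: the sum of
[|c m| * q ^ N] has to be finite for some [q > 1].  Convergence of the given
series alone does not provide it, because a power series can be smooth on its
circle of convergence without being analytic there, and its Taylor series
at 1 could then converge to another function.  The bound comes from the growth
of the coefficients ([E_growth]).
- If [alpha] is not a pole, [|Gamma|] is, up to a constant, logarithmically
  convex on horizontal lines ([Gamma_convex]).  This bounds
  [(alpha)_(rho a + b)] for [rho <= 2] by a geometric mean of its values for
  [rho = 2] and [rho = 0] ([pochhammer_le]), where the multinomial theorem gives
  geometric decay exactly under the condition that defines the domain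
  ([monomial_interpolated]).
- For [rho > 2] the same convexity bounds the terms from below, so that the
  series diverges unless [x_1 = 0] ([E_divergent]).
- If [alpha] is a pole and [rho > 0], all indices are integers and the series
  terminates in [N].
The convexity is read off Gauss's limit for Gamma, which has to be shown to
exist and to be nonzero ([gauss_limit]).

The binomial series with principal powers ([has_sum_binomial]) follows from a
differential equation along the segment from 0 to [t]. *)

Local Notation Re := complex.Re.
Local Notation Im := complex.Im.
Local Notation "x %:C" := (x%:C)%C : ring_scope.

(** * The modulus of a complex number *)

Section Modulus.
Variable R : realType.
Implicit Types v z w : R[i].

Lemma normc_cmod z : `|z| = (cmod z)%:C.
Proof. by rewrite /cmod normc_def. Qed.

Lemma cmodE z : cmod z = Num.sqrt (Re z ^+ 2 + Im z ^+ 2).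
Proof. by rewrite /cmod normc_def. Qed.

Lemma cmod_ge0 z : 0 <= cmod z.
Proof. by rewrite cmodE sqrtr_ge0. Qed.

Lemma cmodM z w : cmod (z * w) = cmod z * cmod w.
Proof. by apply: complexI; rewrite -normc_cmod normrM !normc_cmod rmorphM. Qed.

Lemma cmodN z : cmod (- z) = cmod z.
Proof. by apply: complexI; rewrite -!normc_cmod normrN. Qed.

Lemma cmodD z w : cmod (z + w) <= cmod z + cmod w.
Proof. by rewrite -lecR rmorphD -!normc_cmod ler_normD. Qed.

Lemma cmodB z w : cmod (z - w) <= cmod z + cmod w.
Proof. by rewrite -(cmodN w) cmodD. Qed.

Lemma cmod_distC z w : cmod (z - w) = cmod (w - z).
Proof. by rewrite -cmodN opprB. Qed.

Lemma cmod_triangle v z w : cmod (z - w) <= cmod (z - v) + cmod (v - w).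
Proof. have -> : z - w = (z - v) + (v - w) by ring. exact: cmodD. Qed.

Lemma cmod0 : cmod (0 : R[i]) = 0.
Proof. by rewrite /cmod normr0. Qed.

Lemma cmod1 : cmod (1 : R[i]) = 1.
Proof. by rewrite /cmod normr1. Qed.

Lemma cmod_eq0 z : (cmod z == 0) = (z == 0).
Proof.
apply/eqP/eqP => [z0|->]; last exact: cmod0.
by apply/eqP; rewrite -normr_eq0 normc_cmod z0.
Qed.

Lemma cmod_gt0 z : (0 < cmod z) = (z != 0).
Proof. by rewrite lt_def cmod_ge0 andbT cmod_eq0. Qed.

Lemma cmodX z n : cmod (z ^+ n) = cmod z ^+ n.
Proof. by elim: n => [|n IH]; rewrite ?cmod1 // !exprS cmodM IH. Qed.

Lemma cmodV z : cmod z^-1 = (cmod z)^-1.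
Proof.
have [->|z0] := eqVneq z 0; first by rewrite invr0 cmod0 invr0.
have cz0 : cmod z != 0 by rewrite cmod_eq0.
by apply: (mulfI cz0); rewrite -cmodM !divff // cmod1.
Qed.

Lemma cmod_real (x : R) : cmod x%:C = `|x|.
Proof. by rewrite cmodE /= expr0n /= addr0 sqrtr_sqr. Qed.

Lemma cmod_nat n : cmod (n%:R : R[i]) = n%:R.
Proof. by rewrite /cmod normr_nat -(rmorph_nat (real_complex R)). Qed.

Lemma cmod_prod (I : Type) (r : seq I) (P : pred I) (F : I -> R[i]) :
  cmod (\prod_(i <- r | P i) F i) = \prod_(i <- r | P i) cmod (F i).
Proof. exact: (big_morph _ cmodM cmod1). Qed.

Lemma cmod_sum (I : Type) (r : seq I) (P : pred I) (F : I -> R[i]) :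
  cmod (\sum_(i <- r | P i) F i) <= \sum_(i <- r | P i) cmod (F i).
Proof.
elim/big_ind2 : _ => [|x1 x2 y1 y2 h1 h2|//]; first by rewrite cmod0.
exact: le_trans (cmodD _ _) (lerD h1 h2).
Qed.

Lemma normRe_le_cmod z : `|Re z| <= cmod z.
Proof. by rewrite -lecR -normc_cmod normc_ge_Re. Qed.

Lemma normIm_le_cmod z : `|Im z| <= cmod z.
Proof.
by rewrite cmodE -sqrtr_sqr ler_wsqrtr // lerDr sqr_ge0.
Qed.

Lemma cmod_le_ReIm z : cmod z <= `|Re z| + `|Im z|.
Proof.
rewrite {1}[z]complexE; apply: le_trans (cmodD _ _) _.
rewrite cmodM !cmod_real lerD2l.
by rewrite cmodE /= expr0n expr1n add0r sqrtr1 mul1r.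
Qed.

Lemma Re_sum (I : Type) (r : seq I) (P : pred I) (F : I -> R[i]) :
  Re (\sum_(i <- r | P i) F i) = \sum_(i <- r | P i) Re (F i).
Proof. by apply: (big_morph (@complex.Re R)) => // -[a b] [c d]. Qed.

Lemma Im_sum (I : Type) (r : seq I) (P : pred I) (F : I -> R[i]) :
  Im (\sum_(i <- r | P i) F i) = \sum_(i <- r | P i) Im (F i).
Proof. by apply: (big_morph (@complex.Im R)) => // -[a b] [c d]. Qed.

Lemma cmod_lt_all_eq0 z : (forall e : R, 0 < e -> cmod z < e) -> z = 0.
Proof.
move=> h; apply/eqP; rewrite -cmod_eq0 eq_le cmod_ge0 andbT leNgt.
by apply/negP => /h; rewrite ltxx.
Qed.

End Modulus.
(** * Unconditional sums *)

Lemma big_fset_inj (V : nmodType) (I J : choiceType) (h : J -> I) (w : I -> V) (A : {fset J}) :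
  injective h -> \sum_(i <- [fset h j | j in A]%fset) w i = \sum_(j <- A) w (h j).
Proof.
move=> hi; rewrite (perm_big _ (enum_imfset _ _)) ?big_map //=.
by move=> x y _ _; exact: hi.
Qed.

Section Sums.
Variable R : realType.
Local Notation C := R[i].

(** Convergence of the partial sums along the finite sets ordered by inclusion,
with real tolerances. *)
Definition has_sum (I : choiceType) (f : I -> C) (l : C) : Prop :=
  forall e : R, 0 < e -> exists A : {fset I}, forall B : {fset I},
    (A `<=` B)%fset -> cmod (l - \sum_(i <- B) f i) < e.

Definition bounded_sum (I : choiceType) (w : I -> R) : Prop :=
  exists M : R, forall A : {fset I}, \sum_(i <- A) w i <= M.

Definition abs_summable (I : choiceType) (f : I -> C) : Prop :=
  bounded_sum (fun i => cmod (f i)).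

Lemma has_sum_unique (I : choiceType) (f : I -> C) (l1 l2 : C) :
  has_sum f l1 -> has_sum f l2 -> l1 = l2.
Proof.
move=> h1 h2; apply/subr0_eq/cmod_lt_all_eq0 => e e0.
have [|A hA] := h1 (e / 2); first by lra.
have [|B hB] := h2 (e / 2); first by lra.
have := hA (A `|` B)%fset (fsubsetUl _ _); have := hB (A `|` B)%fset (fsubsetUr _ _).
set s := \sum_(_ <- _) _; have := cmod_triangle s l1 l2.
rewrite (cmod_distC s l2); lra.
Qed.

Lemma has_sum_ext (I : choiceType) (f g : I -> C) (l : C) :
  f =1 g -> has_sum f l -> has_sum g l.
Proof. by move=> /funext ->. Qed.

Lemma has_sum0 (I : choiceType) : has_sum (fun _ : I => 0) 0.
Proof.
move=> e e0; exists fset0 => B _; rewrite big1 // subr0 cmod0 //.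
Qed.

Lemma has_sumD (I : choiceType) (f g : I -> C) (l m : C) :
  has_sum f l -> has_sum g m -> has_sum (fun i => f i + g i) (l + m).
Proof.
move=> hf hg e e0.
have [|A hA] := hf (e / 2); first by lra.
have [|B hB] := hg (e / 2); first by lra.
exists (A `|` B)%fset => D; rewrite fsubUset => /andP[/hA h1 /hB h2].
rewrite big_split /= opprD addrACA.
apply: le_lt_trans (cmodD _ _) _; lra.
Qed.

Lemma has_sumZ (I : choiceType) (c : C) (f : I -> C) (l : C) :
  has_sum f l -> has_sum (fun i => c * f i) (c * l).
Proof.
move=> hf e e0; have c1 : 0 < cmod c + 1 by have := cmod_ge0 c; lra.
have [|A hA] := hf (e / (cmod c + 1)); first by rewrite divr_gt0.
exists A => B /hA h; rewrite -mulr_sumr -mulrBr cmodM.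
rewrite ltr_pdivlMr // in h.
have := cmod_ge0 (l - \sum_(i <- B) f i); have := cmod_ge0 c; nra.
Qed.

Lemma has_sum_big (I : choiceType) (J : Type) (r : seq J) (f : J -> I -> C)
    (l : J -> C) :
  (forall j, has_sum (f j) (l j)) ->
  has_sum (fun i => \sum_(j <- r) f j i) (\sum_(j <- r) l j).
Proof.
move=> h; elim: r => [|j r IH].
  rewrite big_nil; apply: has_sum_ext (has_sum0 I) => i /=; by rewrite big_nil.
rewrite big_cons; apply: has_sum_ext (has_sumD (h j) IH) => i /=.
by rewrite big_cons.
Qed.

Lemma bounded_sum_le (I : choiceType) (v w : I -> R) :
  (forall i, v i <= w i) -> bounded_sum w -> bounded_sum v.
Proof.
move=> vw [M hM]; exists M => A; apply: le_trans (hM A).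
by apply: ler_sum.
Qed.

Lemma bounded_sumZ (I : choiceType) (c : R) (w : I -> R) :
  0 <= c -> bounded_sum w -> bounded_sum (fun i => c * w i).
Proof.
move=> c0 [M hM]; exists (c * M) => A; rewrite -mulr_sumr.
exact: ler_wpM2l.
Qed.

Lemma big_fset_disjU (I : choiceType) (f : I -> C) (A B : {fset I}) :
  [disjoint A & B]%fset ->
  \sum_(i <- (A `|` B)%fset) f i = \sum_(i <- A) f i + \sum_(i <- B) f i.
Proof.
move=> AB; rewrite (big_fsetID _ (mem A)) /=; congr (_ + _).
  apply: eq_fbigl => x; rewrite !inE /= andbC.
  by case: (x \in A).
apply: eq_fbigl => x; rewrite !inE /= andbC.
by case: (boolP (x \in A)) => //= xA; rewrite (negbTE (fdisjointP AB _ xA)).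
Qed.

Lemma big_fset_subset (I : choiceType) (w : I -> R) (A B : {fset I}) :
  (forall i, 0 <= w i) -> (A `<=` B)%fset -> \sum_(i <- A) w i <= \sum_(i <- B) w i.
Proof.
move=> w0 AB; rewrite [X in _ <= X](big_fsetID _ (mem A)) /=.
have -> : [fset x | x in B & x \in A]%fset = A.
  apply/fsetP => x; rewrite !inE /= andbC; case: (boolP (x \in A)) => //=.
  by move/(fsubsetP AB).
by rewrite lerDl sumr_ge0.
Qed.

(** The sum is the supremum of the finite partial sums. *)
Lemma abs_summable_real (I : choiceType) (w : I -> R) :
  (forall i, 0 <= w i) -> bounded_sum w ->
  exists l : R, has_sum (fun i => (w i)%:C) l%:C.
Proof.
move=> w0 [M hM].
pose S := [set x : R | exists A : {fset I}, x = \sum_(i <- A) w i].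
have supS : has_sup S.
  split; first by exists 0; exists fset0; rewrite big_nil.
  by exists M => _ [A ->].
exists (sup S) => e e0; have [_ [A ->] hA] := sup_adherent e0 supS.
exists A => B AB; rewrite -rmorph_sum -rmorphB cmod_real.
have h1 := big_fset_subset w0 AB.
have h2 : \sum_(i <- B) w i <= sup S by apply: (ub_le_sup supS.2); exists B.
rewrite ger0_norm; lra.
Qed.

(** The positive and negative parts of the real and imaginary parts are
dominated by the modulus, and each of them has a supremum as its sum. *)
Lemma abs_summable_has_sum (I : choiceType) (f : I -> C) :
  abs_summable f -> exists l : C, has_sum f l.
Proof.
move=> hf.
have part (g : I -> R) : (forall i, `|g i| <= cmod (f i)) ->
    exists l : C, has_sum (fun i => (g i)%:C) l.
  move=> hg.
  have pos (u : R) : `|u| = 1 ->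
      exists l : R, has_sum (fun i => ((`|g i| + u * g i) / 2)%:C) l%:C.
    move=> u1; have hgu i : `|u * g i| = `|g i| by rewrite normrM u1 mul1r.
    apply: abs_summable_real => [i|].
      have := hgu i; have := ler_norm (- (u * g i)); rewrite normrN; lra.
    apply: bounded_sum_le hf => i.
    have := hg i; have := hgu i; have := ler_norm (u * g i); lra.
  have [|l1 h1] := pos 1; first exact: normr1.
  have [|l2 h2] := pos (- 1); first by rewrite normrN1.
  exists (l1%:C + (- 1) * l2%:C).
  apply: has_sum_ext (has_sumD h1 (has_sumZ (- 1) h2)) => i.
  by rewrite mulN1r -rmorphB; congr (_%:C); lra.
have [i|l1 h1] := part (fun i => Re (f i)); first exact: normRe_le_cmod.
have [i|l2 h2] := part (fun i => Im (f i)); first exact: normIm_le_cmod.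
exists (l1 + 'i%C * l2).
by apply: has_sum_ext (has_sumD h1 (has_sumZ 'i%C h2)) => i; rewrite -complexE.
Qed.

(** Finite sums past a suitable finite set are bounded; applied to the indices
where the real part has a given sign, and likewise for the imaginary part,
this bounds the sums of moduli. *)
Lemma has_sum_abs_summable (I : choiceType) (f : I -> C) (l : C) :
  has_sum f l -> abs_summable f.
Proof.
move=> hf; have [A hA] := hf 1 ltr01.
pose S := \sum_(i <- A) cmod (f i).
(* Such a sum is a difference of two partial sums within 1 of l. *)
have tail (B : {fset I}) : [disjoint A & B]%fset ->
    cmod (\sum_(i <- B) f i) <= 2.
  move=> AB; have h1 := hA _ (fsubset_refl A).
  have h2 := hA _ (fsubsetUl A B); rewrite big_fset_disjU // in h2.
  have := cmodB (l - \sum_(i <- A) f i)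
    (l - (\sum_(i <- A) f i + \sum_(i <- B) f i)).
  rewrite opprD opprK [- l + _]addrC addrACA.
  set a := \sum_(i <- A) _ in h1 h2 *; set b := \sum_(i <- B) _ in h2 *.
  rewrite (_ : l + (a + b) + (- a - l) = b); last by ring.
  lra.
(* g is the real or the imaginary part. *)
have ReIm (g : C -> R) (B : {fset I}) : [disjoint A & B]%fset ->
    (forall D : {fset I}, g (\sum_(i <- D) f i) = \sum_(i <- D) g (f i)) ->
    (forall z, `|g z| <= cmod z) ->
    \sum_(i <- B) `|g (f i)| <= 4.
  move=> AB gs gl.
  rewrite (big_fsetID _ (fun i => 0 <= g (f i))) /=.
  set P := [fset _ | _ in _ & _]%fset; set N := [fset _ | _ in _ & _]%fset.
  have hP : [disjoint A & P]%fset by apply: fdisjointWr AB; exact: fset_sub.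
  have hN : [disjoint A & N]%fset by apply: fdisjointWr AB; exact: fset_sub.
  have -> : \sum_(i <- P) `|g (f i)| = g (\sum_(i <- P) f i).
    rewrite gs; apply: eq_big_seq => i; rewrite !inE /= => /andP[_].
    by move=> /ger0_norm.
  have -> : \sum_(i <- N) `|g (f i)| = - g (\sum_(i <- N) f i).
    rewrite gs -sumrN; apply: eq_big_seq => i; rewrite !inE /= => /andP[_].
    by rewrite -ltNge => /ltr0_norm.
  have := gl (\sum_(i <- P) f i); have := gl (\sum_(i <- N) f i).
  have := tail _ hP; have := tail _ hN.
  have := ler_norm (g (\sum_(i <- P) f i)).
  have := ler_norm (- g (\sum_(i <- N) f i)); rewrite normrN; lra.
exists (S + 8) => B.
have -> : 8 = 4 + 4 :> R by ring.
rewrite (big_fsetID _ (mem A)) /=; apply: lerD.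
  by apply: big_fset_subset => [i|]; [exact: cmod_ge0|apply/fsubsetP => x; rewrite !inE /= => /andP[]].
set D := [fset _ | _ in _ & _]%fset.
have AD : [disjoint A & D]%fset.
  by apply/fdisjointP => x xA; rewrite !inE /= xA andbF.
apply: le_trans (lerD (ReIm _ D AD _ (@normRe_le_cmod R)) (ReIm _ D AD _ (@normIm_le_cmod R))).
- by rewrite -big_split; apply: ler_sum => i _; exact: cmod_le_ReIm.
- by move=> E; rewrite Re_sum.
- by move=> E; rewrite Im_sum.
Qed.
End Sums.
(** * Double sums *)

Section Limits.
Variable R : realType.
Local Notation C := R[i].

Lemma big_fsetM (V : nmodType) (I J : choiceType) (f : I * J -> V) (A : {fset I})
    (B : {fset J}) :
  \sum_(p <- (A `*` B)%fset) f p = \sum_(i <- A) \sum_(j <- B) f (i, j).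
Proof.
rewrite -big_allpairs; apply: perm_big; apply: uniq_perm.
- exact: fset_uniq.
- by apply: allpairs_uniq => //= -[a b] [c d].
- move=> [i j]; rewrite in_fsetM /=; apply/andP/allpairsP => [[iA jB]|].
    by exists (i, j).
  by move=> [[i' j'] /= [iA jB [-> ->]]].
Qed.

(** Rows indexed by a finite set are summed simultaneously, so a finite sum of
row sums is a limit of sums of [f] over finite rectangles. *)
Lemma has_sum_fubini (I J : choiceType) (f : I * J -> C) (g : I -> C) (l : C) :
  has_sum f l -> (forall i, has_sum (fun j => f (i, j)) (g i)) -> has_sum g l.
Proof.
move=> hf hg e e0; have [|A hA] := hf (e / 2); first by lra.
exists [fset p.1 | p in A]%fset => B AB.
have [|D hD] := has_sum_big (enum_fset B) hg (e := e / 2); first by lra.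
pose E := (D `|` [fset p.2 | p in A])%fset.
have h1 := hD E (fsubsetUl _ _).
have h2 : cmod (l - \sum_(p <- (B `*` E)%fset) f p) < e / 2.
  apply: hA; apply/fsubsetP => p pA; rewrite in_fsetM; apply/andP; split.
    by apply: (fsubsetP AB); apply/imfsetP; exists p.
  by apply: (fsubsetP (fsubsetUr _ _)); apply/imfsetP; exists p.
rewrite big_fsetM exchange_big /= in h2.
have := cmod_triangle (\sum_(j <- E) \sum_(i <- B) f (i, j)) l (\sum_(i <- B) g i).
rewrite [X in _ <= _ + X]cmod_distC => h3; lra.
Qed.

(** Since [h (g i) = i] is only asked on the support, this covers bijections as
well as shifts of a series. *)
Lemma has_sum_reindex (I J : choiceType) (h : J -> I) (g : I -> J)
    (f : I -> C) (l : C) :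
  cancel h g -> (forall i, f i != 0 -> h (g i) = i) ->
  has_sum (f \o h) l -> has_sum f l.
Proof.
move=> hK hf hs e e0; have [B hB] := hs e e0.
exists [fset h j | j in B]%fset => D BD.
pose E := [fset j in [fset g i | i in D] | h j \in D]%fset.
have EP j : (j \in E) = (h j \in D).
  rewrite !inE /=; case: (boolP (h j \in D)) => [hD|]; rewrite ?andbF // andbT.
  by apply/imfsetP; exists (h j) => //; rewrite hK.
have -> : \sum_(i <- D) f i = \sum_(j <- E) (f \o h) j.
  rewrite [LHS](big_fsetID _ (fun i => h (g i) == i)) /=.
  rewrite [X in _ + X]big1_seq ?addr0; last first.
    move=> i; rewrite !inE /= => /andP[_ /eqP hgi].
    by apply/eqP/negPn/negP => /hf.
  rewrite -(big_fset_inj f E (can_inj hK)); apply: eq_fbigl => i.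
  rewrite !inE /=; apply/andP/imfsetP => [[iD /eqP gi]|[j /= jE ->]].
    by exists (g i) => //=; rewrite EP gi.
  by rewrite hK -EP.
apply: hB; apply/fsubsetP => j jB; rewrite EP; apply: (fsubsetP BD).
by apply/imfsetP; exists j.
Qed.

Lemma has_sum_exchange (I J : choiceType) (f : I -> J -> C) (g : I -> C)
    (h : J -> C) (l : C) :
  abs_summable (fun p : I * J => f p.1 p.2) ->
  (forall i, has_sum (f i) (g i)) -> (forall j, has_sum (f^~ j) (h j)) ->
  has_sum g l -> has_sum h l.
Proof.
move=> hf hg hh hl; have [l' hl'] := abs_summable_has_sum hf.
have -> : l = l' by apply: has_sum_unique hl _; exact: has_sum_fubini hl' hg.
pose sw (K L : choiceType) (p : K * L) := (p.2, p.1).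
apply: (@has_sum_fubini _ _ (fun p : J * I => f p.2 p.1)) => //.
by apply: (@has_sum_reindex _ _ (sw I J) (sw J I)) => [[]|[]|].
Qed.

Lemma abs_summable_iter (I J : choiceType) (f : I -> J -> C) (w : I -> R) :
  (forall i (B : {fset J}), \sum_(j <- B) cmod (f i j) <= w i) ->
  bounded_sum w -> abs_summable (fun p : I * J => f p.1 p.2).
Proof.
move=> fw [M hM]; exists M => A.
pose A1 := [fset p.1 | p in A]%fset; pose A2 := [fset p.2 | p in A]%fset.
apply: le_trans (hM A1); apply: (@le_trans _ _
  (\sum_(p <- (A1 `*` A2)%fset) cmod (f p.1 p.2))).
  apply: big_fset_subset => [p|]; first exact: cmod_ge0.
  apply/fsubsetP => p pA; rewrite in_fsetM.
  by apply/andP; split; apply/imfsetP; exists p.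
by rewrite big_fsetM; apply: ler_sum => i _; exact: fw.
Qed.
End Limits.
(** * Limits of sequences, limits at 1 from the left, dominated convergence *)

Section Sequences.
Variable R : realType.
Local Notation C := R[i].

Lemma big_fset_iota (V : nmodType) (f : nat -> V) (n : nat) :
  \sum_(i <- [fset i in iota 0 n]%fset) f i = \sum_(i < n) f i.
Proof.
rewrite -(big_mkord xpredT f) /index_iota subn0; apply: perm_big.
apply: uniq_perm; [exact: fset_uniq|exact: iota_uniq|].
by move=> i; rewrite !inE.
Qed.

Lemma fset_sub_iota (A : {fset nat}) :
  exists N, forall n, (N <= n)%N -> (A `<=` [fset i in iota 0 n])%fset.
Proof.
exists (\max_(i <- A) i).+1 => n Nn; apply/fsubsetP => i iA.
rewrite !inE /= mem_iota add0n; apply: leq_trans Nn; rewrite ltnS.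
by rewrite (big_rem i) //= leq_max leqnn.
Qed.

Lemma bounded_sum_nat (w : nat -> R) (M : R) :
  (forall i, 0 <= w i) -> (forall n, \sum_(i < n) w i <= M) -> bounded_sum w.
Proof.
move=> w0 hM; exists M => A; have [N hN] := fset_sub_iota A.
apply: le_trans (hM N); rewrite -big_fset_iota.
by apply: big_fset_subset => //; exact: hN.
Qed.

Definition seq_lim (u : nat -> C) (l : C) : Prop :=
  forall e : R, 0 < e -> exists N, forall n, (N <= n)%N -> cmod (l - u n) < e.

Lemma complex_posP (e : C) : 0 < e -> 0 < Re e /\ e = (Re e)%:C.
Proof. by case: e => a b; rewrite ltcE /= => /andP[/eqP -> ->]. Qed.

Lemma seq_limP (u : nat -> C) (l : C) : seq_lim u l <-> (u @ \oo --> l).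
Proof.
split=> [h|/cvgrPdist_lt h].
  apply/cvgrPdist_lt => e /complex_posP[e0 ->]; have [N hN] := h _ e0.
  by exists N => // n /= Nn; rewrite normc_cmod ltcR hN.
move=> e e0; have [|N _ hN] := h e%:C; first by rewrite ltcR.
by exists N => n Nn; have := hN n Nn; rewrite /= normc_cmod ltcR.
Qed.

Lemma has_sumP (I : choiceType) (f : I -> C) (l : C) :
  has_sum f l <-> (summability.partial_sum f @ summability.totally --> l).
Proof.
have FF := @summability.totally_filter I.
have E B : summability.partial_sum f B = \sum_(i <- B) f i.
  by rewrite /summability.partial_sum big_seq_fsetE.
split=> [h|/cvgrPdist_lt h].
  apply/cvgrPdist_lt => e /complex_posP[e0 ->]; have [A hA] := h _ e0.
  by exists A => // B /= AB; rewrite E normc_cmod ltcR hA.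
move=> e e0; have [|A _ hA] := h e%:C; first by rewrite ltcR.
by exists A => B AB; have := hA B AB; rewrite /= E normc_cmod ltcR.
Qed.

Lemma has_sum_summability (I : choiceType) (f : I -> C) :
  cvg (summability.partial_sum f @ summability.totally) ->
  has_sum f (summability.sum f).
Proof. by move=> h; apply/has_sumP. Qed.

Lemma seq_lim_limn (u : nat -> C) (l : C) : seq_lim u l -> limn u = l.
Proof. by move=> /seq_limP /cvg_lim -> //; exact: norm_hausdorff. Qed.

Lemma seq_lim_unique (u : nat -> C) (l m : C) :
  seq_lim u l -> seq_lim u m -> l = m.
Proof. by move=> /seq_lim_limn <- /seq_lim_limn <-. Qed.

Lemma cvgn_seq_lim (u : nat -> C) : cvgn u -> seq_lim u (limn u).
Proof. by move=> h; apply/seq_limP. Qed.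

Lemma has_sum_seq_lim (f : nat -> C) (l : C) :
  has_sum f l -> seq_lim (fun n => \sum_(i < n) f i) l.
Proof.
move=> h e e0; have [A hA] := h e e0; have [N hN] := fset_sub_iota A.
by exists N => n Nn; rewrite -big_fset_iota; apply: hA; exact: hN.
Qed.

Lemma seq_lim_bounded (u : nat -> C) (l : C) :
  seq_lim u l -> exists K : R, 0 < K /\ forall n, cmod (u n) <= K.
Proof.
move=> /(_ 1 ltr01)[N hN].
exists (\sum_(i < N) cmod (u i) + cmod l + 1); split.
  have := cmod_ge0 l.
  have : 0 <= \sum_(i < N) cmod (u i) by apply: sumr_ge0 => i _; exact: cmod_ge0.
  lra.
move=> n; have S0 : 0 <= \sum_(i < N) cmod (u i).
  by apply: sumr_ge0 => i _; exact: cmod_ge0.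
have [Nn|nN] := leqP N n.
  have := hN n Nn; have := cmodB l (l - u n); rewrite opprB addrC subrK; lra.
have := cmod_ge0 l; rewrite (bigD1 (Ordinal nN)) //=.
have : 0 <= \sum_(i < N | i != Ordinal nN) cmod (u i).
  by apply: sumr_ge0 => i _; exact: cmod_ge0.
lra.
Qed.

Definition lim1 (phi : R -> C) (l : C) : Prop :=
  forall e : R, 0 < e -> exists2 d : R, 0 <= d < 1 &
    forall s, d < s < 1 -> cmod (l - phi s) < e.

Lemma lim1_unique (phi : R -> C) (l m : C) : lim1 phi l -> lim1 phi m -> l = m.
Proof.
move=> h1 h2; apply/subr0_eq/cmod_lt_all_eq0 => e e0.
have [|d hd h] := h1 (e / 2); first by lra.
have [|d' hd' h'] := h2 (e / 2); first by lra.
pose s := (Num.max d d' + 1) / 2.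
have [sd sd'] : d < s < 1 /\ d' < s < 1.
  by rewrite /s; case: (leP d d'); lra.
have := h s sd; have := h' s sd'.
have := cmod_triangle (phi s) l m; rewrite (cmod_distC (phi s) m); lra.
Qed.

Lemma lim1_ext (phi psi : R -> C) (l : C) :
  (forall s, 0 < s < 1 -> phi s = psi s) -> lim1 phi l -> lim1 psi l.
Proof.
move=> E h e e0; have [d hd hs] := h e e0; exists d => // s sd.
by rewrite -E ?hs //; lra.
Qed.

Lemma lim1_cst (l : C) : lim1 (fun=> l) l.
Proof. by move=> e e0; exists 0 => [|s _]; rewrite ?lexx ?ltr01 // subrr cmod0. Qed.

Lemma lim1D (phi psi : R -> C) (l m : C) :
  lim1 phi l -> lim1 psi m -> lim1 (fun s => phi s + psi s) (l + m).
Proof.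
move=> h1 h2 e e0.
have [|d hd h] := h1 (e / 2); first by lra.
have [|d' hd' h'] := h2 (e / 2); first by lra.
exists (Num.max d d'); first by case: (leP d d'); lra.
move=> s hs; have : d < s < 1 /\ d' < s < 1.
  by move: hs; case: (leP d d'); lra.
move=> [/h a /h' b]; rewrite opprD addrACA.
by apply: le_lt_trans (cmodD _ _) _; lra.
Qed.

(** Quantitative continuity of the product, shared by limits of sequences and
limits at 1. *)
Lemma cmod_mul_close (l m : C) (e : R) : 0 < e -> exists2 e' : R, 0 < e' &
  forall x y, cmod (l - x) < e' -> cmod (m - y) < e' -> cmod (l * m - x * y) < e.
Proof.
move=> e0; pose K := cmod l + cmod m + 1.
have K0 : 1 <= K by rewrite /K; have := cmod_ge0 l; have := cmod_ge0 m; lra.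
pose e' := Num.min 1 (e / (2 * K)).
have e'0 : 0 < e' by rewrite lt_min ltr01 divr_gt0 //; lra.
have e'1 : e' <= 1 by rewrite ge_min lexx.
have e'2 : e' * (2 * K) <= e.
  by rewrite -ler_pdivlMr ?ge_min ?lexx ?orbT //; lra.
exists e' => // x y a b.
have -> : l * m - x * y = (l - x) * m + (m - y) * l - (l - x) * (m - y) by ring.
apply: le_lt_trans (cmodB _ _) _.
apply: (@le_lt_trans _ _ (cmod (l - x) * cmod m + cmod (m - y) * cmod l
   + cmod (l - x) * cmod (m - y))).
  by rewrite -!cmodM lerD2r cmodD.
move: a b (cmod_ge0 (l - x)) (cmod_ge0 (m - y)) (cmod_ge0 l) (cmod_ge0 m).
move: K0 e'2; rewrite /K.
move: (cmod _) (cmod (m - _)) (cmod l) (cmod m) => {}x {}y L M.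
nra.
Qed.

Lemma lim1M (phi psi : R -> C) (l m : C) :
  lim1 phi l -> lim1 psi m -> lim1 (fun s => phi s * psi s) (l * m).
Proof.
move=> h1 h2 e e0; have [e' e'0 he'] := cmod_mul_close l m e0.
have [d hd h] := h1 _ e'0; have [d' hd' h'] := h2 _ e'0.
exists (Num.max d d'); first by case: (leP d d'); lra.
move=> s hs; have : d < s < 1 /\ d' < s < 1.
  by move: hs; case: (leP d d'); lra.
by move=> [/h a /h' b]; exact: he'.
Qed.

Lemma lim1_sum (I : Type) (r : seq I) (phi : R -> I -> C) (l : I -> C) :
  (forall i, lim1 (phi^~ i) (l i)) ->
  lim1 (fun s => \sum_(i <- r) phi s i) (\sum_(i <- r) l i).
Proof.
move=> h; elim: r => [|i r IH].
  by rewrite big_nil; apply: lim1_ext (lim1_cst 0) => s _; rewrite big_nil.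
rewrite big_cons; apply: lim1_ext (lim1D (h i) IH) => s _.
by rewrite big_cons.
Qed.

Lemma lim1X (phi : R -> C) (l : C) (n : nat) :
  lim1 phi l -> lim1 (fun s => phi s ^+ n) (l ^+ n).
Proof.
move=> h; elim: n => [|n IH]; first exact: lim1_cst.
by rewrite exprS; apply: lim1_ext (lim1M h IH) => s _; rewrite exprS.
Qed.

Lemma lim1_id : lim1 (fun s => s%:C) 1.
Proof.
move=> e e0; exists (Num.max 0 (1 - e)).
  by rewrite le_max lexx gt_max ltr01 /=; lra.
move=> s; rewrite gt_max => /andP[/andP[s0 se] s1].
by rewrite -(rmorph1 (real_complex R)) -rmorphB cmod_real ger0_norm; lra.
Qed.

(** The finite set depends on the dominating family [w] only, so it serves all
the dominated families at once. *)
Lemma has_sum_near (I : choiceType) (w : I -> R) (e : R) :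
  (forall i, 0 <= w i) -> bounded_sum w -> 0 < e ->
  exists A : {fset I}, forall (f : I -> C) (l : C),
    (forall i, cmod (f i) <= w i) -> has_sum f l ->
    cmod (l - \sum_(i <- A) f i) <= e.
Proof.
move=> w0 hw e0; have [L hL] := abs_summable_real w0 hw.
have [|A hA] := hL (e / 4); first by lra.
exists A => f l fw hf; have [|B hB] := hf (e / 4); first by lra.
have AAB := fsubsetUl A B; have BAB := fsubsetUr A B.
have h1 := hB _ BAB; have h2 := hA _ AAB; have h3 := hA _ (fsubset_refl A).
have AB : [disjoint A & B `\` A]%fset.
  by apply/fdisjointP => x xA; rewrite !inE xA.
have UE : (A `|` B = A `|` (B `\` A))%fset.
  by apply/fsetP => x; rewrite !inE; case: (x \in A).
rewrite UE big_fset_disjU // in h1; rewrite UE big_fset_disjU // in h2.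
have h4 : cmod (\sum_(i <- (B `\` A)%fset) f i) <= e / 2.
  apply: le_trans (cmod_sum _ _ _) _.
  apply: (@le_trans _ _ (\sum_(i <- (B `\` A)%fset) w i)); first exact: ler_sum.
  have D0 : 0 <= \sum_(i <- (B `\` A)%fset) w i by apply: sumr_ge0.
  rewrite -!rmorph_sum in h2 h3.
  rewrite -rmorphD -rmorphB cmod_real in h2; rewrite -rmorphB cmod_real in h3.
  have := ler_norm (- (L - (\sum_(i <- A) w i + \sum_(i <- (B `\` A)%fset) w i))).
  have := ler_norm (L - \sum_(i <- A) w i); rewrite normrN; lra.
have := cmodD (l - (\sum_(i <- A) f i + \sum_(i <- (B `\` A)%fset) f i))
  (\sum_(i <- (B `\` A)%fset) f i).
rewrite opprD addrA subrK; rewrite opprD addrA in h1; lra.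
Qed.

(** Up to an error that is uniform in [s], the sums run over one finite set. *)
Lemma tannery (I : choiceType) (w : I -> R) (f : R -> I -> C) (f1 : I -> C)
    (F : R -> C) (F1 : C) :
  bounded_sum w ->
  (forall s i, 0 < s < 1 -> cmod (f s i) <= w i) ->
  (forall i, cmod (f1 i) <= w i) ->
  (forall i, lim1 (f^~ i) (f1 i)) ->
  (forall s, 0 < s < 1 -> has_sum (f s) (F s)) -> has_sum f1 F1 -> lim1 F F1.
Proof.
move=> hw fw f1w hl hF hF1 e e0.
have w0 i : 0 <= w i by apply: le_trans (f1w i); exact: cmod_ge0.
have [|A hA] := has_sum_near w0 hw (e := e / 4); first by lra.
have [|d hd h] := lim1_sum (enum_fset A) hl (e := e / 4); first by lra.
exists d => // s sd; have s01 : 0 < s < 1 by lra.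
have h1 := hA _ _ f1w hF1; have h2 := hA _ _ (fun i => fw s i s01) (hF s s01).
have h3 := h s sd.
have := cmod_triangle (\sum_(i <- A) f1 i) F1 (F s).
have := cmod_triangle (\sum_(i <- A) f s i) (\sum_(i <- A) f1 i) (F s).
rewrite (cmod_distC (\sum_(i <- A) f s i) (F s)); lra.
Qed.

End Sequences.
(** * Geometric bounds *)

Section PowerSeries.
Variable R : realType.
Local Notation C := R[i].

Lemma ler_sum_ord_widen (w : nat -> R) (n m : nat) :
  (forall i, 0 <= w i) -> (n <= m)%N -> \sum_(i < n) w i <= \sum_(i < m) w i.
Proof.
move=> w0 nm; rewrite -!(big_mkord xpredT w) [leRHS](big_cat_nat (n := n)) //=.
by rewrite lerDl; apply: sumr_ge0.
Qed.

Lemma geometric_sum (x : R) (n : nat) :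
  (1 - x) * \sum_(i < n) x ^+ i = 1 - x ^+ n.
Proof. by rewrite -[LHS]opprK -mulNr opprB -subrX1 opprB. Qed.

Lemma geometric_sum_le (x : R) (n : nat) : 0 <= x < 1 ->
  \sum_(i < n) x ^+ i <= (1 - x)^-1.
Proof.
move=> /andP[x0 x1]; have d : 0 < 1 - x by lra.
rewrite -[leRHS]mul1r ler_pdivlMr // mulrC geometric_sum.
by rewrite lerBlDr lerDl exprn_ge0.
Qed.

Lemma geometric_bounded_sum (x K : R) (w : nat -> R) : 0 <= x < 1 ->
  (forall n, 0 <= w n <= K * x ^+ n) -> bounded_sum w.
Proof.
move=> x01 hw; have K0 : 0 <= K by have := hw 0%N; rewrite expr0; lra.
apply: (@bounded_sum_nat _ _ (K * (1 - x)^-1)) => [n|n].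
  by have /andP[] := hw n.
apply: (@le_trans _ _ (K * \sum_(i < n) x ^+ i)).
  by rewrite mulr_sumr; apply: ler_sum => i _; have /andP[] := hw i.
by rewrite ler_wpM2l // geometric_sum_le.
Qed.

Lemma has_sum_fin (f : nat -> C) (N : nat) :
  (forall n, (N <= n)%N -> f n = 0) -> has_sum f (\sum_(i < N) f i).
Proof.
move=> f0 e e0; exists [fset i in iota 0 N]%fset => B AB.
suff -> : \sum_(i <- B) f i = \sum_(i < N) f i by rewrite subrr cmod0.
rewrite -big_fset_iota (big_fsetID _ (mem [fset i in iota 0 N]%fset)) /=.
rewrite [X in _ + X]big1_seq ?addr0.
  apply: eq_fbigl => i; rewrite !inE /= andbC.
  case: (boolP (i \in iota 0 N)) => //= iN.
  by apply: (fsubsetP AB); rewrite inE.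
by move=> i; rewrite !inE /= mem_iota add0n -leqNgt => /andP[_ /f0].
Qed.

Lemma abs_summable_term (I : choiceType) (f : I -> C) :
  abs_summable f -> exists M : R, 0 < M /\ forall i, cmod (f i) <= M.
Proof.
move=> [M hM]; exists (Num.max 1 M); split; first by rewrite lt_max ltr01.
move=> i; have := hM [fset i]%fset; rewrite big_seq_fset1 => h.
by rewrite le_max h orbT.
Qed.

(** * Abel's limit theorem *)

Lemma summation_by_parts (D : nat -> C) (s : C) (n : nat) :
  \sum_(i < n) (D i.+1 - D i) * s ^+ i =
  D n * s ^+ n - D 0%N + (1 - s) * \sum_(i < n) D i.+1 * s ^+ i.
Proof.
elim: n => [|n IH]; first by rewrite !big_ord0; ring.
by rewrite !big_ord_recr /= IH exprS; ring.
Qed.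

Lemma seq_lim_abs_summable (u : nat -> C) (U : C) (z : C) :
  seq_lim (fun n => \sum_(i < n) u i) U -> cmod z < 1 ->
  abs_summable (fun n => u n * z ^+ n).
Proof.
move=> hU z1; have [K [K0 hK]] := seq_lim_bounded hU.
apply: (@geometric_bounded_sum (cmod z) (K + K)); first by rewrite cmod_ge0.
move=> n; rewrite cmod_ge0 cmodM cmodX ler_wpM2r ?exprn_ge0 ?cmod_ge0 //=.
have -> : u n = \sum_(i < n.+1) u i - \sum_(i < n) u i.
  by rewrite big_ord_recr /=; ring.
by apply: le_trans (cmodB _ _) _; apply: lerD.
Qed.

(** Summation by parts writes [P s - U] as [(1 - s)] times the series of the
[D n.+1 * s ^ n], where [D n] is the error of the [n]-th partial sum.  Its first
terms are killed by the factor [1 - s], and the others carry a small [D]. *)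
Lemma abel_limit (u : nat -> C) (U : C) (P : R -> C) :
  seq_lim (fun n => \sum_(i < n) u i) U ->
  (forall s, 0 < s < 1 -> has_sum (fun n => u n * s%:C ^+ n) (P s)) ->
  lim1 P U.
Proof.
move=> hU hP e e0; pose D n := \sum_(i < n) u i - U.
have [|N hN] := hU (e / 4); first by lra.
have DN n : (N <= n)%N -> cmod (D n) < e / 4.
  by move=> /hN; rewrite cmod_distC.
pose K := \sum_(i < N) cmod (D i.+1).
have K0 : 0 <= K by apply: sumr_ge0 => i _; exact: cmod_ge0.
exists (1 - Num.min 1 (e / (4 * (K + 1)))).
  have m0 : 0 < Num.min 1 (e / (4 * (K + 1))).
    by rewrite lt_min ltr01 divr_gt0 //; lra.
  have : Num.min 1 (e / (4 * (K + 1))) <= 1 by rewrite ge_min lexx.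
  lra.
move=> s /andP[s0 s1].
have m1 : Num.min 1 (e / (4 * (K + 1))) <= 1 by rewrite ge_min lexx.
have sK : (1 - s) * (4 * (K + 1)) <= e.
  rewrite -ler_pdivlMr; last by lra.
  have : Num.min 1 (e / (4 * (K + 1))) <= e / (4 * (K + 1)).
    by rewrite ge_min lexx orbT.
  lra.
have s01 : 0 < s < 1 by lra.
have [|N' hN'] := has_sum_seq_lim (hP s s01) (e := e / 4); first by lra.
pose n := maxn N N'.
have h1 := hN' n (leq_maxr _ _); have h2 := DN n (leq_maxl _ _).
have E : \sum_(i < n) u i * s%:C ^+ i - U =
    D n * s%:C ^+ n + (1 - s%:C) * \sum_(i < n) D i.+1 * s%:C ^+ i.
  have -> : \sum_(i < n) u i * s%:C ^+ i =
      \sum_(i < n) (D i.+1 - D i) * s%:C ^+ i.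
    by apply: eq_bigr => i _; rewrite /D big_ord_recr /=; congr (_ * _); ring.
  by rewrite summation_by_parts /D big_ord0; ring.
have h3 : cmod (\sum_(i < n) u i * s%:C ^+ i - U) <= 3 * (e / 4).
  rewrite E; apply: le_trans (cmodD _ _) _; rewrite !cmodM cmodX cmod_real.
  have -> : cmod (1 - s%:C) = 1 - s.
    by rewrite -(rmorph1 (real_complex R)) -rmorphB cmod_real ger0_norm; lra.
  rewrite ger0_norm; last by lra.
  have h4 : cmod (D n) * s ^+ n <= e / 4.
    apply: (@le_trans _ _ (cmod (D n))); last exact: ltW.
    by rewrite ler_piMr ?cmod_ge0 // exprn_ile1; lra.
  have h5 : cmod (\sum_(i < n) D i.+1 * s%:C ^+ i) <=
      K + e / 4 * \sum_(i < n) s ^+ i.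
    apply: le_trans (cmod_sum _ _ _) _.
    pose w i := if (i < N)%N then cmod (D i.+1) else 0.
    have w0 i : 0 <= w i by rewrite /w; case: ifP => // _; exact: cmod_ge0.
    have wK : \sum_(i < n) w i <= K.
      have [nN|Nn] := leqP n N.
        apply: le_trans (ler_sum_ord_widen w0 nN) _.
        by apply: ler_sum => i _; rewrite /w ltn_ord.
      rewrite -(big_mkord xpredT w) (big_cat_nat (n := N)) //=; last exact: ltnW.
      rewrite [X in _ + X]big_nat_cond [X in _ + X]big1 ?addr0; last first.
        by move=> i; rewrite andbT => /andP[Ni _]; rewrite /w ltnNge Ni.
      by rewrite big_mkord; apply: ler_sum => i _; rewrite /w ltn_ord.
    apply: le_trans _ (lerD wK (lexx _)); rewrite mulr_sumr -big_split /=.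
    apply: ler_sum => i _; rewrite cmodM cmodX cmod_real ger0_norm; last by lra.
    have si : 0 <= s ^+ i <= 1 by rewrite exprn_ge0 ?exprn_ile1; lra.
    rewrite /w; case: ltnP => iN.
      have := cmod_ge0 (D i.+1); nra.
    have := DN i.+1 (leqW iN); nra.
  have h6 : (1 - s) * (K + e / 4 * \sum_(i < n) s ^+ i) <= e / 2.
    rewrite mulrDr mulrCA geometric_sum.
    have : 0 <= s ^+ n by rewrite exprn_ge0; lra.
    nra.
  have h7 : (1 - s) * cmod (\sum_(i < n) D i.+1 * s%:C ^+ i) <=
      (1 - s) * (K + e / 4 * \sum_(i < n) s ^+ i).
    by rewrite ler_wpM2l //; lra.
  lra.
have := cmod_triangle (\sum_(i < n) u i * s%:C ^+ i) U (P s).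
rewrite [cmod (U - \sum_(i < n) _)]cmod_distC
  [cmod (\sum_(i < n) _ - P s)]cmod_distC; lra.
Qed.

(** * Products of series *)

(** The two orders of summation over the triangle [k <= n]. *)
Lemma has_sum_cauchy (a b : nat -> C) (A B : C) :
  abs_summable a -> abs_summable b -> has_sum a A -> has_sum b B ->
  has_sum (fun n => \sum_(k < n.+1) a (n - k)%N * b k) (A * B).
Proof.
move=> [Ma ha] hb hA hB.
pose f k n := if (k <= n)%N then a (n - k)%N * b k else 0.
apply: (@has_sum_exchange _ _ _ f (fun k => A * b k)).
- apply: (@abs_summable_iter _ _ _ f (fun k => Ma * cmod (b k))); last first.
    apply: bounded_sumZ => //; have := ha fset0; rewrite big_seq_fset0; exact.
  move=> k D; rewrite /f.
  pose D' := [fset (n - k)%N | n in [fset n in D | (k <= n)%N]]%fset.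
  apply: (@le_trans _ _ (\sum_(j <- D') cmod (a j) * cmod (b k))); last first.
    by rewrite -mulr_suml ler_wpM2r ?cmod_ge0.
  rewrite (big_fsetID _ (fun n => (k <= n)%N)) /=.
  rewrite [X in _ + X]big1_seq ?addr0; last first.
    by move=> n; rewrite !inE /= => /andP[_ /negbTE ->]; rewrite cmod0.
  rewrite le_eqVlt; apply/orP; left; apply/eqP.
  rewrite /D' [RHS](perm_big _ (enum_imfset _ _)) ?big_map /=; last first.
    move=> x y; rewrite !inE /= => /andP[_ kx] /andP[_ ky] /eqP.
    by rewrite eqn_sub2rE // => /eqP.
  apply: eq_big_seq => n; rewrite !inE /= => /andP[_ ->].
  by rewrite cmodM.
- move=> k; apply: (@has_sum_reindex _ _ _ (addn^~ k) (subn^~ k)).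
  + by move=> n; rewrite addnK.
  + by move=> n; rewrite /f; case: leqP => [/subnK|]; rewrite ?eqxx.
  rewrite mulrC; apply: has_sum_ext (has_sumZ (b k) hA) => n.
  by rewrite /f /= leq_addl addnK mulrC.
- move=> n; rewrite (eq_bigr (fun k : 'I_n.+1 => f k n)); last first.
    by move=> k _; rewrite /f -ltnS ltn_ord.
  by apply: (@has_sum_fin (f^~ n)) => k nk; rewrite /f leqNgt nk.
- exact: has_sumZ.
Qed.

(** * Recentring a power series *)

Lemma bin_recentre (d k j : nat) :
  ('C(k + d, k + j) * 'C(k + j, k) = 'C(k + d, k) * 'C(d, j))%N.
Proof.
have [jd|dj] := leqP j d; last first.
  by rewrite (bin_small dj) (@bin_small (k + d)) ?muln0 // ltn_add2l.
have p1 : (0 < k`! * j`! * (d - j)`!)%N by rewrite !muln_gt0 !fact_gt0.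
apply/eqP; rewrite -(eqn_pmul2r p1); apply/eqP.
have h1 := bin_fact (leq_add (leqnn k) jd); rewrite subnDl in h1.
have h2 := bin_fact (leq_addr j k); rewrite addKn in h2.
have h3 := bin_fact (leq_addr d k); rewrite addKn in h3.
have h4 := bin_fact jd.
transitivity (k + d)`!.
  rewrite -h1 -h2; ring.
rewrite -h3 -h4; ring.
Qed.

(** Expanding at [w] and then at [w + h] is expanding at [w + h]. *)
Lemma recentre_monomial (F : comNzRingType) (w h : F) (d k : nat) :
  \sum_(n < d.+1) 'C(d, n)%:R * w ^+ (d - n) * ('C(n, k)%:R * h ^+ (n - k)) =
  'C(d, k)%:R * (w + h) ^+ (d - k).
Proof.
have [kd|dk] := leqP k d; last first.
  rewrite bin_small // mul0r big1 // => n _.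
  by rewrite [in X in _ * (X * _)]bin_small ?mul0r ?mulr0 // (leq_ltn_trans _ dk) // -ltnS.
rewrite -(subnKC kd); move: (d - k)%N => {kd}d; rewrite -addnS big_split_ord /=.
rewrite [X in X + _]big1 ?add0r; last first.
  by move=> n _; rewrite [in X in _ * (X * _)]bin_small // mul0r mulr0.
rewrite addKn exprDn mulr_sumr; apply: eq_bigr => j _.
rewrite subnDl addKn -[in RHS]mulr_natr.
have := congr1 (fun m => m%:R : F) (bin_recentre d k j); rewrite !natrM => E.
have -> : forall a b c e : F, a * b * (c * e) = (a * c) * (b * e).
  by move=> a b c e; ring.
by rewrite E; ring.
Qed.

(** A single term of the binomial theorem: binomial weights cost only a slightly
larger radius. *)
Lemma binomial_term_le (x y : R) (d k : nat) : 0 <= x -> 0 < y ->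
  'C(d, k)%:R * x ^+ (d - k) <= (x + y) ^+ d / y ^+ k.
Proof.
move=> x0 y0; have yk : 0 < y ^+ k by rewrite exprn_gt0.
have [kd|dk] := leqP k d; last first.
  rewrite bin_small // mul0r divr_ge0 ?(ltW yk) //.
  by apply: exprn_ge0; lra.
rewrite ler_pdivlMr // exprDn (bigD1 (Ordinal (kd : (k < d.+1)%N))) //=.
rewrite [leLHS](_ : _ = x ^+ (d - k) * y ^+ k *+ 'C(d, k)); last first.
  by rewrite -mulr_natr; ring.
rewrite lerDl; apply: sumr_ge0 => i _; rewrite mulrn_wge0 //.
by rewrite mulr_ge0 ?exprn_ge0 // ltW.
Qed.

(** [b] lists the Taylor coefficients at [w] of the sum of the [c i * z ^ deg i].
The arbitrary index type lets a multiple series count as a power series in one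
of its variables. *)
Definition recentred (I : choiceType) (c : I -> C) (deg : I -> nat) (w : C)
    (b : nat -> C) : Prop :=
  forall k, has_sum
    (fun i => c i * ('C(deg i, k)%:R * w ^+ (deg i - k))) (b k).

Lemma recentred_unique (I : choiceType) (c : I -> C) (deg : I -> nat) (w : C)
    (b b' : nat -> C) :
  recentred c deg w b -> recentred c deg w b' -> b = b'.
Proof. by move=> h h'; apply/funext => k; apply: has_sum_unique (h k) (h' k). Qed.

Lemma recentred_bound (I : choiceType) (c : I -> C) (deg : I -> nat)
    (x r : R) (k : nat) :
  0 <= x < r -> bounded_sum (fun i => cmod (c i) * r ^+ deg i) ->
  bounded_sum (fun i => cmod (c i) * ('C(deg i, k)%:R * x ^+ (deg i - k))).
Proof.
move=> xr hc; pose y := r - x; have y0 : 0 < y by rewrite /y; lra.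
have yk : 0 <= (y ^+ k)^-1 by rewrite invr_ge0 exprn_ge0 // ltW.
apply: bounded_sum_le (bounded_sumZ yk hc) => i.
rewrite [leRHS]mulrCA ler_wpM2l ?cmod_ge0 // [leRHS]mulrC.
have -> : r = x + y by rewrite /y; ring.
by apply: binomial_term_le => //; lra.
Qed.

Lemma recentred_exists (I : choiceType) (c : I -> C) (deg : I -> nat)
    (w : C) (r : R) :
  cmod w < r -> bounded_sum (fun i => cmod (c i) * r ^+ deg i) ->
  exists b, recentred c deg w b.
Proof.
move=> wr hc; suff /choice[b hb] : forall k, exists b, has_sum
    (fun i => c i * ('C(deg i, k)%:R * w ^+ (deg i - k))) b by exists b.
move=> k.
apply: abs_summable_has_sum; rewrite /abs_summable.
have := @recentred_bound _ c deg (cmod w) r k; rewrite cmod_ge0 wr => /(_ isT hc).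
by apply: bounded_sum_le => i; rewrite !cmodM cmod_nat cmodX.
Qed.

(** When the family converges absolutely at a radius above [|w| + |h|], the
double series of the two successive expansions may be summed in either
order. *)
Lemma recentred_comp (I : choiceType) (c : I -> C) (deg : I -> nat)
    (w h : C) (r : R) (b d : nat -> C) :
  cmod w + cmod h < r -> bounded_sum (fun i => cmod (c i) * r ^+ deg i) ->
  recentred c deg w b -> recentred c deg (w + h) d -> recentred b id h d.
Proof.
move=> whr hc hb hd k; pose f i n :=
  c i * ('C(deg i, n)%:R * w ^+ (deg i - n) * ('C(n, k)%:R * h ^+ (n - k))).
have f0 i n : (deg i < n)%N -> f i n = 0.
  by move=> din; rewrite /f bin_small // !mul0r mulr0.
apply: (@has_sum_exchange _ _ _ f); last exact: hd.
- apply: (@abs_summable_iter _ _ _ f (fun i => cmod (c i) *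
     ('C(deg i, k)%:R * (cmod w + cmod h) ^+ (deg i - k)))); last first.
    apply: recentred_bound hc; rewrite whr andbT.
    by have := cmod_ge0 w; have := cmod_ge0 h; lra.
  move=> i B; rewrite -recentre_monomial mulr_sumr.
  have [N hN] := fset_sub_iota B.
  apply: (@le_trans _ _ (\sum_(n < maxn N (deg i).+1) cmod (f i n))).
    rewrite -(@big_fset_iota R (fun n => cmod (f i n))).
    apply: big_fset_subset => [n|]; first exact: cmod_ge0.
    by apply: hN; exact: leq_maxl.
  rewrite -(big_mkord xpredT (fun n => cmod (f i n))).
  rewrite (big_cat_nat (n := (deg i).+1)) ?leq_maxr //=.
  rewrite [X in _ + X]big_nat_cond [X in _ + X]big1 ?addr0; last first.
    by move=> n; rewrite andbT => /andP[/f0 -> _]; rewrite cmod0.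
  by rewrite big_mkord; apply: ler_sum => n _; rewrite /f !cmodM !cmodX !cmod_nat.
- move=> i /=; rewrite -recentre_monomial mulr_sumr.
  by apply: (@has_sum_fin (f i)) => n /f0.
- move=> n; rewrite mulrC.
  by apply: has_sum_ext (has_sumZ ('C(n, k)%:R * h ^+ (n - k)) (hb n)) => i; rewrite /f; ring.
Qed.

End PowerSeries.
Section Continuation.
Variable R : realType.
Local Notation C := R[i].

(** * Binomial coefficients (lambda)_n / n! *)

(** The coefficients of the binomial series of [(1 - z) ^ (- l)]. *)
Definition binom_coef (l : C) (n : nat) : C := rising l n / n`!%:R.

Lemma factC_neq0 n : n`!%:R != 0 :> C.
Proof. by rewrite pnatr_eq0 -lt0n fact_gt0. Qed.

Lemma natSC_neq0 n : n.+1%:R != 0 :> C.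
Proof. by rewrite pnatr_eq0. Qed.

Lemma rising0 (l : C) : rising l 0 = 1.
Proof. by rewrite /rising big_ord0. Qed.

Lemma risingS (l : C) n : rising l n.+1 = rising l n * (l + n%:R).
Proof. by rewrite /rising big_ord_recr. Qed.

Lemma binom_coef0 (l : C) : binom_coef l 0 = 1.
Proof. by rewrite /binom_coef rising0 divr1. Qed.

Lemma binom_coefS (l : C) n :
  n.+1%:R * binom_coef l n.+1 = (l + n%:R) * binom_coef l n.
Proof.
rewrite /binom_coef risingS factS natrM; field.
by rewrite factC_neq0 nat1r natSC_neq0.
Qed.

(** Induction through [(n + 1) a_(n+1) = (l + n) a_n], after splitting the factor
[n + 1] as [(n + 1 - k) + k]. *)
Lemma vandermonde (l m : C) n :
  binom_coef (l + m) n = \sum_(k < n.+1) binom_coef l (n - k) * binom_coef m k.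
Proof.
elim: n => [|n IH]; first by rewrite big_ord1 !binom_coef0 mulr1.
apply: (mulfI (natSC_neq0 n)); rewrite binom_coefS {}IH.
pose S := \sum_(k < n.+2) binom_coef l (n.+1 - k) * binom_coef m k.
have -> : n.+1%:R * S = 
    \sum_(k < n.+2) (n.+1 - k)%:R * binom_coef l (n.+1 - k) * binom_coef m k +
    \sum_(k < n.+2) binom_coef l (n.+1 - k) * (k%:R * binom_coef m k).
  rewrite mulr_sumr -big_split /=; apply: eq_bigr => k _.
  have {1}-> : n.+1%:R = (n.+1 - k)%:R + k%:R :> C.
    by rewrite -natrD subnK // -ltnS ltn_ord.
  ring.
rewrite [X in _ = X + _]big_ord_recr /= subnn !mul0r addr0 [X in _ = _ + X]big_ord_recl /=.
rewrite mul0r mulr0 add0r mulr_sumr -big_split /=; apply: eq_bigr => k _.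
have kn : (k <= n)%N by rewrite -ltnS.
rewrite subSn // binom_coefS /bump /= add1n subSS binom_coefS.
rewrite -{1}(subnK kn) natrD; ring.
Qed.

Lemma risingN (N k : nat) :
  rising (- N%:R : C) k = (-1) ^+ k * ('C(N, k) * k`!)%N%:R.
Proof.
elim: k => [|k IH]; first by rewrite rising0 bin0 mul1r.
rewrite risingS {}IH exprS.
have -> : ('C(N, k.+1) * k.+1`! = (N - k) * ('C(N, k) * k`!))%N.
  by rewrite factS mulnA [('C(_, _) * _)%N]mulnC mul_bin_left mulnA.
have [kN|Nk] := leqP k N; first by rewrite (natrM _ (N - k)) natrB //; ring.
by rewrite bin_small // mul0n mulr0 mul0r muln0 mulr0.
Qed.

Lemma binom_coefN (N k : nat) :
  binom_coef (- N%:R) k = (-1) ^+ k * 'C(N, k)%:R.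
Proof. by rewrite /binom_coef risingN natrM mulrA mulfK // factC_neq0. Qed.

(** * Continuation along a segment *)

(** The expansion [b] at 1 is continued along the segment from 1 to [1 + z], which
stays in the disc of radius [q] around 0 and, seen from 1, in the disc of radius
[r].  Each small step is a recentring both of [b] and of the family. *)
Lemma recentred_segment (I : choiceType) (c : I -> C) (deg : I -> nat)
    (z : C) (q r : R) (b : nat -> C) :
  1 < q -> bounded_sum (fun i => cmod (c i) * q ^+ deg i) ->
  recentred c deg 1 b -> cmod (1 + z) < q ->
  bounded_sum (fun n => cmod (b n) * r ^+ n) -> cmod z < r ->
  exists d, recentred b id z d /\ recentred c deg (1 + z) d.
Proof.
move=> q1 hc hb zq hr zr.
(* Every point of the segment is at distance at least e from both circles. *)
pose e := Num.min (r - cmod z) (Num.min (q - 1) (q - cmod (1 + z))).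
have e0 : 0 < e by rewrite !lt_min; lra.
have [M Me] : exists M : nat, cmod z < M.+1%:R * e.
  have h : 0 <= cmod z / e by rewrite divr_ge0 ?cmod_ge0 // ltW.
  exists (Num.truncn (cmod z / e)); rewrite -ltr_pdivrMr //.
  exact: truncnS_gt.
have er : e <= r - cmod z by rewrite ge_min lexx.
have eq1 : e <= q - 1 by rewrite !ge_min lexx orbT.
have eqz : e <= q - cmod (1 + z) by rewrite !ge_min lexx !orbT.
have M0 : (0 : R) < M.+1%:R by rewrite ltr0n.
pose h : C := z / M.+1%:R.
have he : cmod h < e.
  by rewrite /h cmodM cmodV cmod_nat ltr_pdivrMr // mulrC.
pose s (j : nat) : R := j%:R / M.+1%:R.
have sE j : (s j)%:C = j%:R / M.+1%:R.
  by rewrite rmorphM /= rmorphV ?unitfE ?lt0r_neq0 // !rmorph_nat.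
have bz j : (j <= M.+1)%N -> cmod ((s j)%:C * z) <= cmod z /\
    cmod (1 + (s j)%:C * z) <= q - e.
  move=> jM; have sj : 0 <= s j <= 1.
    by rewrite divr_ge0 ?ler0n //= ler_pdivrMr // mul1r ler_nat.
  rewrite cmodM cmod_real ger0_norm; last by case/andP: sj.
  split; first by have := cmod_ge0 z; nra.
  have -> : 1 + (s j)%:C * z = (1 - s j)%:C + (s j)%:C * (1 + z).
    by rewrite rmorphB rmorph1; ring.
  apply: le_trans (cmodD _ _) _; rewrite cmodM !cmod_real !ger0_norm; [|lra|lra].
  nra.
have step j : (j <= M.+1)%N -> exists d, recentred b id ((s j)%:C * z) d /\
    recentred c deg (1 + (s j)%:C * z) d.
  elim: j => [|j IH] jM.
    exists b; rewrite /s mul0r mul0r addr0; split=> // k.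
    pose f n := b n * ('C(n, k)%:R * 0 ^+ (n - k)).
    have -> : b k = \sum_(n < k.+1) f n.
      rewrite big_ord_recr /= big1 ?add0r; last first.
        by move=> n _; rewrite /f bin_small // mul0r mulr0.
      by rewrite /f binn subnn !mulr1.
    apply: (@has_sum_fin R f) => n kn.
    by rewrite /f expr0n subn_eq0 leqNgt kn mulr0 mulr0.
  have [d [d1 d2]] := IH (ltnW jM).
  have [z1 z2] := bz j (ltnW jM); have [z3 z4] := bz j.+1 jM.
  have sS : (s j.+1)%:C * z = (s j)%:C * z + h.
    by rewrite !sE /h -natr1; field; rewrite nat1r natSC_neq0.
  have [b' hb'] : exists b', recentred b id ((s j.+1)%:C * z) b'.
    by apply: recentred_exists hr; lra.
  have [c' hc'] : exists c', recentred c deg (1 + (s j.+1)%:C * z) c'.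
    by apply: recentred_exists hc; lra.
  exists b'; split=> //; rewrite sS in hb'; rewrite sS addrA in hc' *.
  have h1 : recentred d id h b' by apply: recentred_comp hr d1 hb'; lra.
  have h2 : recentred d id h c' by apply: recentred_comp hc d2 hc'; lra.
  by rewrite (recentred_unique h1 h2).
have [d] := step M.+1 (leqnn _).
by rewrite /s divff ?mul1r ?gt_eqF //; exists d.
Qed.

(** * Growth of rising factorials *)

Definition tsum (I : choiceType) (f : I -> C) : C :=
  xget 0 [set l | has_sum f l].

Lemma tsumP (I : choiceType) (f : I -> C) : abs_summable f -> has_sum f (tsum f).
Proof.
by move=> /abs_summable_has_sum [l hl]; rewrite /tsum; case: xgetP => [x _ //|/(_ l)].
Qed.

(** From the index [J] on, [u / v] decreases. *)
Lemma ratio_bound (u v : nat -> R) (J : nat) :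
  (forall n, 0 <= u n) -> (forall n, 0 < v n) ->
  (forall n, (J <= n)%N -> u n.+1 * v n <= u n * v n.+1) ->
  exists2 B : R, 0 < B & forall n, u n <= B * v n.
Proof.
move=> u0 v0 h; pose B := \sum_(i < J.+1) u i / v i + 1.
have uv i : 0 <= u i / v i by rewrite divr_ge0 // ltW.
have B0 : 0 < B.
  by have : 0 <= \sum_(i < J.+1) u i / v i by [apply: sumr_ge0]; rewrite /B; lra.
exists B => // n.
have small m : (m < J.+1)%N -> u m <= B * v m.
  move=> mJ; rewrite -ler_pdivrMr // /B (bigD1 (Ordinal mJ)) //= -addrA lerDl.
  by apply: addr_ge0 => //; apply: sumr_ge0.
have [nJ|Jn] := ltnP n J.+1; first exact: small.
elim: n Jn => // n IH Jn.
have un : u n <= B * v n.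
  by move: Jn; rewrite ltnS leq_eqVlt => /predU1P[<-|/IH //]; exact: small.
have := h n Jn; have := v0 n; have := v0 n.+1 => v1 vn hn.
rewrite -(ler_pM2r vn); apply: le_trans hn _.
by rewrite mulrAC ler_wpM2r // ltW.
Qed.

Lemma archimedean_mul (x y : R) : 0 < y ->
  exists J : nat, forall n, (J <= n)%N -> x <= n%:R * y.
Proof.
move=> y0; exists (Num.truncn (`|x| / y)).+1 => n Jn.
rewrite -ler_pdivrMr //; apply: (@le_trans _ _ (`|x| / y)).
  by rewrite ler_wpM2r ?ler_norm // invr_ge0 ltW.
by apply: le_trans (ltW (truncnS_gt _)) _; rewrite ler_nat.
Qed.

Lemma fact_gt0R n : 0 < n`!%:R :> R.
Proof. by rewrite ltr0n fact_gt0. Qed.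

Lemma rising_le (a : C) (K : R) : 1 < K -> exists2 B : R, 0 < B &
  forall n, cmod (rising a n) <= B * (K ^+ n * n`!%:R).
Proof.
move=> K1; have [|J hJ] := @archimedean_mul (cmod a) (K - 1); first by lra.
apply: (@ratio_bound (fun n => cmod (rising a n)) _ J) => [n|n|n Jn].
- exact: cmod_ge0.
- by rewrite mulr_gt0 ?exprn_gt0 ?fact_gt0R //; lra.
have h : cmod (a + n%:R) <= K * n.+1%:R.
  apply: le_trans (cmodD _ _) _; rewrite cmod_nat -natr1.
  have := hJ n Jn; lra.
rewrite risingS cmodM factS exprSr natrM -mulrA ler_wpM2l ?cmod_ge0 //.
have := exprn_gt0 n (lt_trans ltr01 K1); have := fact_gt0R n => f0 k0.
have := mulr_gt0 k0 f0; nra.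
Qed.

Lemma rising_ge (a : C) (K : R) : 1 < K -> (forall n, rising a n != 0) ->
  exists2 B : R, 0 < B &
  forall n, n`!%:R <= B * (K ^+ n * cmod (rising a n)).
Proof.
move=> K1 a0.
have [|J hJ] := @archimedean_mul (1 + K * cmod a) (K - 1); first by lra.
apply: (@ratio_bound (fun n => n`!%:R) _ J) => [n|n|n Jn].
- exact: ler0n.
- by rewrite mulr_gt0 ?exprn_gt0 ?cmod_gt0 //; lra.
have h : n.+1%:R <= K * cmod (a + n%:R).
  have : n%:R - cmod a <= cmod (a + n%:R).
    by have := cmodB (a + n%:R) a; rewrite addrAC subrr add0r cmod_nat; lra.
  have := hJ n Jn; rewrite -natr1; nra.
rewrite risingS cmodM factS exprSr natrM.
have := exprn_gt0 n (lt_trans ltr01 K1); have := fact_gt0R n => f0 k0.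
have r0 : 0 < cmod (rising a n) by rewrite cmod_gt0.
have := mulr_gt0 (mulr_gt0 k0 f0) r0; nra.
Qed.

Lemma binom_coef_bound (l : C) (x : R) : 0 <= x < 1 ->
  bounded_sum (fun n => cmod (binom_coef l n) * x ^+ n).
Proof.
(* K > 1 and K x < 1. *)
move=> x01; pose K := 2 / (1 + x).
have x1 : 0 < 1 + x by lra.
have K1 : 1 < K by rewrite /K ltr_pdivlMr; lra.
have Kx : 0 <= K * x < 1.
  by rewrite /K mulrAC divr_ge0 ?ltr_pdivrMr /=; lra.
have [B B0 hB] := @rising_le l K K1.
apply: (@geometric_bounded_sum _ (K * x) B) => // n.
have x0 : 0 <= x ^+ n by rewrite exprn_ge0; lra.
rewrite mulr_ge0 ?cmod_ge0 //= exprMn mulrA ler_wpM2r //.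
by rewrite /binom_coef cmodM cmodV cmod_nat ler_pdivrMr ?fact_gt0R // -mulrA.
Qed.

(** * Exchanging the sums by continuation *)

Lemma convex_cmod (t : C) (s q : R) : 0 <= s <= 1 -> 1 <= q -> cmod (1 - t) <= q ->
  cmod (1 - s%:C * t) <= q.
Proof.
move=> s01 q1 tq.
have -> : 1 - s%:C * t = (1 - s)%:C + s%:C * (1 - t).
  by rewrite rmorphB rmorph1; ring.
apply: le_trans (cmodD _ _) _; rewrite cmodM !cmod_real !ger0_norm; [nra|lra|lra].
Qed.

(** With [deg] constantly 0 this is the product of two series.  In general [l] is
lowered by [deg i], which multiplies the binomial series by [(1 - t) ^ deg i];
for large [deg i] this factor has large Taylor coefficients, and the family
[c i * binom_coef (l - deg i) n * t ^ n] need not be absolutely summable.  The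
convergence of the series of the [e n * t ^ n] is what allows the continuation
up to [t]. *)
Theorem sum_binom_coef_family (I : choiceType) (c : I -> C) (deg : I -> nat)
    (l t : C) (q : R) (e : nat -> C) (U F G : C) :
  cmod t < 1 -> 1 < q -> cmod (1 - t) <= q ->
  bounded_sum (fun i => cmod (c i) * q ^+ deg i) ->
  (forall n, has_sum (fun i => c i * binom_coef (l - (deg i)%:R) n) (e n)) ->
  seq_lim (fun n => \sum_(i < n) e i * t ^+ i) U ->
  has_sum (fun n => binom_coef l n * t ^+ n) F ->
  has_sum (fun i => c i * (1 - t) ^+ deg i) G ->
  U = F * G.
Proof.
move=> t1 q1 tq hc he hU hF hG.
have [|b hb] := @recentred_exists R I c deg 1 q _ hc; first by rewrite cmod1.
(* b is the expansion at 1, hence e the product of two power series. *)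
have eE n : e n = \sum_(k < n.+1) binom_coef l (n - k) * ((-1) ^+ k * b k).
  apply: has_sum_unique (he n) _.
  rewrite (eq_bigr (fun k : 'I_n.+1 => (binom_coef l (n - k) * (-1) ^+ k) * b k));
    last by move=> k _; rewrite mulrA.
  have h (k : 'I_n.+1) := has_sumZ (binom_coef l (n - k) * (-1) ^+ k) (hb k).
  apply: has_sum_ext (has_sum_big _ h) => i.
  rewrite vandermonde mulr_sumr; apply: eq_bigr => k _.
  by rewrite binom_coefN expr1n; ring.
(* Dividing by the binomial series transfers the convergence of e to b. *)
have bE n : (-1) ^+ n * b n = \sum_(k < n.+1) binom_coef (- l) (n - k) * e k.
  apply: has_sum_unique (has_sumZ ((-1) ^+ n) (hb n)) _.
  have h (k : 'I_n.+1) := has_sumZ (binom_coef (- l) (n - k)) (he k).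
  apply: has_sum_ext (has_sum_big _ h) => i.
  rewrite expr1n mulr1 mulrCA -binom_coefN.
  have -> : binom_coef (- (deg i)%:R) n = \sum_(k < n.+1)
      binom_coef (- l) (n - k) * binom_coef (l - (deg i)%:R) k.
    by rewrite -vandermonde addKr.
  by rewrite mulr_sumr; apply: eq_bigr => k _; ring.
have st1 (s : R) : 0 <= s < 1 -> cmod (s%:C * t) < 1.
  by move=> s01; rewrite cmodM cmod_real ger0_norm; have := cmod_ge0 t; nra.
have binS (m : C) (s : R) : 0 <= s < 1 ->
    abs_summable (fun n => binom_coef m n * (s%:C * t) ^+ n).
  move=> s01; apply: bounded_sum_le (@binom_coef_bound m (cmod (s%:C * t)) _) => [n|].
    by rewrite cmodM cmodX.
  by rewrite cmod_ge0 st1.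
have eS (s : R) : 0 <= s < 1 -> abs_summable (fun n => e n * (s%:C * t) ^+ n).
  move=> s01; have := @seq_lim_abs_summable R (fun n => e n * t ^+ n) U s%:C hU.
  rewrite cmod_real ger0_norm; last by lra.
  move=> /(_ (proj2 (andP s01))); congr abs_summable; apply/funext => n.
  by rewrite exprMn; ring.
have bS (s : R) : 0 <= s < 1 -> abs_summable (fun n => b n * (- (s%:C * t)) ^+ n).
  move=> s01; have h1 := binS (- l) s s01; have h2 := eS s s01.
  have := has_sum_abs_summable (has_sum_cauchy h1 h2 (tsumP h1) (tsumP h2)).
  congr abs_summable; apply/funext => n.
  rewrite exprNn mulrA [b n * _]mulrC bE mulr_suml; apply: eq_bigr => k _.
  have kn : (k <= n)%N by rewrite -ltnS.
  have -> : (s%:C * t) ^+ n = (s%:C * t) ^+ (n - k) * (s%:C * t) ^+ k.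
    by rewrite -exprD subnK.
  by ring.
pose z s : C := - (s%:C * t).
have bc (s : R) : 0 <= s < 1 -> exists d : C,
    has_sum (fun n => b n * z s ^+ n) d /\ has_sum (fun i => c i * (1 + z s) ^+ deg i) d.
  move=> s01; have [t0|t0] := eqVneq t 0.
    exists (b 0%N); rewrite /z t0 mulr0 oppr0 addr0; split; last first.
      by apply: has_sum_ext (hb 0%N) => i; rewrite bin0 mul1r subn0.
    have -> : b 0%N = \sum_(n < 1) b n * 0 ^+ n by rewrite big_ord1 mulr1.
    apply: (@has_sum_fin R (fun n => b n * 0 ^+ n)) => -[//|n] _.
    by rewrite expr0n mulr0.
  have ct0 : 0 < cmod t by rewrite cmod_gt0.
  (* A radius strictly between s |t| and |t|. *)
  pose s' := (1 + s) / 2; have s'01 : 0 <= s' < 1 by rewrite /s'; lra.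
  have ss' : s < s' by rewrite /s'; lra.
  have [|||d [d1 d2]] := @recentred_segment _ c deg (z s) q (s' * cmod t) b q1 hc hb.
  - have -> : 1 + z s = (1 - s)%:C + s%:C * (1 - t).
      by rewrite /z rmorphB rmorph1; ring.
    apply: le_lt_trans (cmodD _ _) _; rewrite cmodM !cmod_real !ger0_norm; [nra|lra|lra].
  - apply: bounded_sum_le (bS s' s'01) => n.
    by rewrite cmodM cmodX cmodN cmodM cmod_real ger0_norm //; lra.
  - by rewrite cmodN cmodM cmod_real ger0_norm ?ltr_pM2r //; lra.
  exists (d 0%N); split.
    by apply: has_sum_ext (d1 0%N) => n; rewrite bin0 mul1r subn0.
  by apply: has_sum_ext (d2 0%N) => n; rewrite bin0 mul1r subn0.
have /choice[Gs hGs] : forall s, exists d : C, 0 <= s < 1 ->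
    has_sum (fun n => b n * z s ^+ n) d /\ has_sum (fun i => c i * (1 + z s) ^+ deg i) d.
  move=> s; have [s01|s01] := pselect (0 <= s < 1); last by exists 0.
  by have [d hd] := bc s s01; exists d.
pose Fs s := tsum (fun n => binom_coef l n * (s%:C * t) ^+ n).
have lim_st : lim1 (fun s => s%:C * t) t.
  by rewrite -[X in lim1 _ X]mul1r; apply: lim1M (lim1_cst t); exact: lim1_id.
have h1 : lim1 (fun s => Fs s * Gs s) U.
  apply: (@abel_limit R (fun n => e n * t ^+ n)) hU _ => s s01.
  have s01' : 0 <= s < 1 by lra.
  have [g1 g2] := hGs s s01'.
  have := has_sum_cauchy (binS l s s01') (bS s s01') (tsumP (binS l s s01')) g1.
  apply: has_sum_ext => n; rewrite eE !mulr_suml; apply: eq_bigr => k _.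
  have kn : (k <= n)%N by rewrite -ltnS.
  rewrite [(- (s%:C * t)) ^+ k]exprNn -[RHS]mulrA.
  have -> : t ^+ n * s%:C ^+ n = (s%:C * t) ^+ (n - k) * (s%:C * t) ^+ k.
    by rewrite -exprD subnK // exprMn mulrC.
  by ring.
have h2 : lim1 Fs F.
  apply: (@tannery _ _ _ (fun s n => binom_coef l n * (s%:C * t) ^+ n)) hF.
  - by apply: (@binom_coef_bound l (cmod t)); rewrite cmod_ge0.
  - move=> s n s01; rewrite cmodM cmodX ler_wpM2l ?cmod_ge0 //.
    rewrite cmodM cmod_real ger0_norm; last by lra.
    by apply: lerXn2r; rewrite ?nnegrE ?mulr_ge0 ?cmod_ge0 //; have := cmod_ge0 t; nra.
  - by move=> n; rewrite cmodM cmodX.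
  - by move=> n; apply: lim1M; [exact: lim1_cst|exact: lim1X].
  - by move=> s s01; apply/tsumP/binS; lra.
have h3 : lim1 Gs G.
  apply: (@tannery _ _ _ (fun s i => c i * (1 + z s) ^+ deg i)) hG.
  - exact: hc.
  - move=> s i s01; rewrite cmodM cmodX ler_wpM2l ?cmod_ge0 //.
    by apply: lerXn2r; rewrite ?nnegrE ?cmod_ge0 //; [lra|apply: convex_cmod; lra].
  - move=> i; rewrite cmodM cmodX ler_wpM2l ?cmod_ge0 //.
    by apply: lerXn2r; rewrite ?nnegrE ?cmod_ge0 //; lra.
  - move=> i; apply: lim1M; first exact: lim1_cst.
    apply: lim1X; apply: lim1D; first exact: lim1_cst.
    rewrite /z -mulN1r; apply: lim1_ext (lim1M (lim1_cst (-1)) lim_st) => s _.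
    by rewrite mulN1r.
  - by move=> s s01; apply: (hGs s _).2; lra.
exact: lim1_unique h1 (lim1M h2 h3).
Qed.
End Continuation.
(** * The binomial series *)

Section Binomial.
Variable R : realType.
Local Notation C := R[i].

Lemma der_eq (f : R -> R) (x a b : R) : a = b -> is_derive x 1 f a -> is_derive x 1 f b.
Proof. by move=> ->. Qed.

Lemma derD (f g : R -> R) (x a b : R) : is_derive x 1 f a -> is_derive x 1 g b ->
  is_derive x 1 (fun y => f y + g y) (a + b).
Proof. by move=> h1 h2; exact: is_deriveD. Qed.

Lemma derM (f g : R -> R) (x a b : R) : is_derive x 1 f a -> is_derive x 1 g b ->
  is_derive x 1 (fun y => f y * g y) (a * g x + f x * b).
Proof.
move=> h1 h2; have := is_deriveM h1 h2; apply: der_eq.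
by rewrite /GRing.scale /=; ring.
Qed.

Lemma derC (f g : R -> R) (x a b : R) : is_derive (g x) 1 f a ->
  is_derive x 1 g b -> is_derive x 1 (fun y => f (g y)) (a * b).
Proof. by move=> h1 h2; exact: is_derive1_comp. Qed.

Lemma der_cst (c x : R) : is_derive x 1 (fun=> c) 0.
Proof. exact: is_derive_cst. Qed.

Lemma der_id (x : R) : is_derive x 1 (fun y : R => y) 1.
Proof. exact: is_derive_id. Qed.

Lemma derV (g : R -> R) (x b : R) : g x != 0 -> is_derive x 1 g b ->
  is_derive x 1 (fun y => (g y)^-1) (- b / g x ^+ 2).
Proof.
move=> g0 h; have := is_deriveV g0 h; apply: der_eq.
by rewrite /GRing.scale /= mulNr; ring.
Qed.

Lemma der0_cst01 (f : R -> R) : (forall x : R, 0 <= x <= 1 -> is_derive x 1 f 0) ->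
  f 1 = f 0.
Proof.
move=> h; have [c _] : exists2 c : R, c \in `]0, 1[%R & f 1 - f 0 = 0 * (1 - 0).
  apply: (@MVT R f (fun=> 0) 0 1 ltr01).
    by move=> x; rewrite in_itv /= => /andP[x0 x1]; apply: h; rewrite !ltW.
  apply: derivable_within_continuous => x; rewrite in_itv /= => xI.
  by have [] := h x xI.
by rewrite mul0r => /subr0_eq.
Qed.

(** The sum [F_l z] of the binomial series, which is to be identified with the
principal power [(1 - z) ^ (- l)]. *)
Definition binom_sum (l z : C) : C := tsum (fun n => binom_coef l n * z ^+ n).

Lemma abs_summable_binom (l z : C) : cmod z < 1 ->
  abs_summable (fun n => binom_coef l n * z ^+ n).
Proof.
move=> z1; apply: bounded_sum_le (@binom_coef_bound R l (cmod z) _) => [n|].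
  by rewrite cmodM cmodX.
by rewrite cmod_ge0.
Qed.

Lemma binom_sumP (l z : C) : cmod z < 1 ->
  has_sum (fun n => binom_coef l n * z ^+ n) (binom_sum l z).
Proof. by move=> /abs_summable_binom -/(_ l) /tsumP. Qed.

Lemma binom_sumD (l m z : C) : cmod z < 1 -> binom_sum (l + m) z = binom_sum l z * binom_sum m z.
Proof.
move=> z1; apply: has_sum_unique (binom_sumP _ z1) _.
have := has_sum_cauchy (abs_summable_binom l z1) (abs_summable_binom m z1)
  (binom_sumP l z1) (binom_sumP m z1).
apply: has_sum_ext => n; rewrite vandermonde mulr_suml; apply: eq_bigr => k _.
have kn : (k <= n)%N by rewrite -ltnS.
have -> : z ^+ n = z ^+ (n - k) * z ^+ k by rewrite -exprD subnK.
by ring.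
Qed.

Lemma binom_sumN1 (z : C) : cmod z < 1 -> binom_sum (- 1) z = 1 - z.
Proof.
move=> z1; apply: has_sum_unique (binom_sumP _ z1) _.
have bE k : binom_coef (- 1 : C) k = (-1) ^+ k * 'C(1, k)%:R.
  by rewrite -binom_coefN.
have -> : 1 - z = \sum_(n < 2) binom_coef (- 1) n * z ^+ n.
  by rewrite big_ord_recl big_ord1 /= !bE; rewrite bin0 bin1; ring.
apply: has_sum_fin => n n2.
by rewrite bE bin_small // mulr0 mul0r.
Qed.

Lemma binom_sumS (l z : C) : cmod z < 1 -> binom_sum (l + 1) z * (1 - z) = binom_sum l z.
Proof. by move=> z1; rewrite -binom_sumN1 // -binom_sumD // addrK. Qed.

Lemma binom_sum0 (l : C) : binom_sum l 0 = 1.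
Proof.
apply: has_sum_unique (binom_sumP _ _) _; first by rewrite cmod0.
have -> : 1 = \sum_(n < 1) binom_coef l n * 0 ^+ n.
  by rewrite big_ord1 binom_coef0 mul1r.
by apply: has_sum_fin => -[//|n] _; rewrite expr0n mulr0.
Qed.

Lemma seq_lim_Re (u : nat -> C) (l : C) : seq_lim u l ->
  (fun n => Re (u n)) @ \oo --> Re l.
Proof.
move=> h; apply/cvgrPdist_lt => e e0; have [N hN] := h e e0.
exists N => // n /= Nn; apply: le_lt_trans (hN n Nn).
by rewrite -raddfB; exact: normRe_le_cmod.
Qed.

(** The coefficients of the real power series in [x] for the real part of
[w * F_l (x t)]. *)
Definition re_coef (w l t : C) (n : nat) : R := Re (w * (binom_coef l n * t ^+ n)).

Lemma re_coef_cvg (w l t : C) (x : R) : `|x| * cmod t < 1 ->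
  pseries (re_coef w l t) x @ \oo --> Re (w * binom_sum l (x%:C * t)).
Proof.
move=> xt; have := @binom_sumP l (x%:C * t); rewrite cmodM cmod_real => /(_ xt).
move=> /(has_sumZ w) /has_sum_seq_lim /seq_lim_Re; apply: cvg_trans.
apply: near_eq_cvg; apply: nearW => n /=.
rewrite /pseries /series /= big_mkord Re_sum; apply: eq_bigr => k _.
rewrite /re_coef exprMn.
have -> : w * (binom_coef l k * (x%:C ^+ k * t ^+ k)) =
    w * (binom_coef l k * t ^+ k) * x%:C ^+ k by ring.
by rewrite -rmorphXn /=; case: (w * _) => a b /=; ring.
Qed.

Lemma re_coef_diffs (w l t : C) :
  pseries_diffs (re_coef w l t) = re_coef (w * l * t) (l + 1) t.
Proof.
apply/funext => n; rewrite /pseries_diffs /re_coef.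
have E : n.+1%:R * binom_coef l n.+1 = l * binom_coef (l + 1) n.
  rewrite binom_coefS /binom_coef !mulrA; congr (_ / _).
  elim: n => [|n IH]; first by rewrite !rising0 !mulr1 addr0.
  by rewrite [in RHS]risingS mulrA -IH risingS -natr1; ring.
have -> : w * l * t * (binom_coef (l + 1) n * t ^+ n) =
    n.+1%:R%:C * (w * (binom_coef l n.+1 * t ^+ n.+1)).
  rewrite rmorph_nat exprS.
  transitivity (w * t * t ^+ n * (l * binom_coef (l + 1) n)); first by ring.
  by rewrite -E; ring.
by case: (w * _) => a b /=; ring.
Qed.

(** Termwise differentiation, through [(n + 1) a_(n+1) = l b_n], where [a] and [b]
are the binomial coefficients for [l] and for [l + 1]. *)
Lemma is_derive_re_coef (w l t : C) (x : R) : cmod t < 1 -> 0 <= x <= 1 ->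
  is_derive x 1 (fun y => limn (pseries (re_coef w l t) y))
    (Re (w * l * t * binom_sum (l + 1) (x%:C * t))).
Proof.
(* K > 1 and K |t| < 1. *)
move=> t1 x01; pose K := 2 / (1 + cmod t).
have ct := cmod_ge0 t.
have K1 : 1 < K by rewrite /K ltr_pdivlMr; lra.
have Kt : `|K| * cmod t < 1.
  rewrite ger0_norm; last by lra.
  by rewrite /K mulrAC ltr_pdivrMr; lra.
have xK : `|x| < `|K| by rewrite !ger0_norm; lra.
have xt : `|x| * cmod t < 1 by apply: le_lt_trans Kt; rewrite ler_wpM2r // ltW.
have := @pseries_snd_diffs R (re_coef w l t) K x.
rewrite !re_coef_diffs => h; apply: der_eq (h _ _ _ xK).
- by apply: cvg_lim => //; exact: re_coef_cvg.
- by apply: cvgP; exact: re_coef_cvg.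
- by apply: cvgP; exact: re_coef_cvg.
- by apply: cvgP; exact: re_coef_cvg.
Qed.

Lemma cexpD (z w : C) : cexp (z + w) = cexp z * cexp w.
Proof.
case: z w => [a b] [c d]; rewrite /cexp /= expRD sinD cosD.
by apply/eqP; rewrite eq_complex /=; apply/andP; split; apply/eqP; ring.
Qed.

Lemma cexp0 : cexp (0 : C) = 1.
Proof. by rewrite /cexp /= expR0 sin0 cos0 mulr1 mulr0. Qed.

(** On the right half plane the principal argument is an arctangent, which is
differentiable across the real axis. *)
Lemma carg_half_plane (a b : R) : 0 < a -> carg (Complex a b) = atan (b / a).
Proof.
move=> a0; rewrite /carg cmodE /=; set r := Num.sqrt _.
have pi0 : 0 < pi :> R := pi_gt0 R.
have hlo := atan_gtNpi2 (b / a); have hhi := atan_ltpi2 (b / a).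
have rE : r = a * Num.sqrt (1 + (b / a) ^+ 2).
  rewrite /r (_ : a ^+ 2 + b ^+ 2 = a ^+ 2 * (1 + (b / a) ^+ 2)).
    by rewrite sqrtrM ?sqr_ge0 // sqrtr_sqr ger0_norm // ltW.
  by field; rewrite gt_eqF.
have s0 : 0 < Num.sqrt (1 + (b / a) ^+ 2).
  by rewrite sqrtr_gt0; have := sqr_ge0 (b / a); lra.
have -> : a / r = cos (atan (b / a)).
  by rewrite cos_atan rE; field; rewrite !gt_eqF.
case: ltP => b0.
  have x0 : atan (b / a) <= 0.
    by rewrite -atan0 le_atan // ler_pdivrMr // mul0r ltW.
  by rewrite cosKN ?opprK //; lra.
have x0 : 0 <= atan (b / a) by rewrite -{1}atan0 le_atan // divr_ge0 // ltW.
by rewrite cosK // in_itv /=; lra.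
Qed.

(** The product of [F_l (x t)] and of [exp (l log (1 - x t))] has derivative 0 in
the real variable [x], because the derivative of [F_l] is [l F_(l+1)] and
[(1 - z) F_(l+1) z = F_l z]; its value at [x = 0] is 1. *)
Theorem binom_sum_cpow (l t : C) : cmod t < 1 -> binom_sum l t = cpow (1 - t) (- l).
Proof.
move=> t1; pose T1 := Re t; pose T2 := Im t; pose L1 := Re l; pose L2 := Im l.
have T1lt : `|T1| < 1 by apply: le_lt_trans t1; exact: normRe_le_cmod.
(* 1 - x t is d x - i e x, with squared modulus D x and logarithm A x + i B x;
   W1 + i W2 is l times this logarithm, and f1 + i f2 is F_l (x t). *)
pose d (x : R) : R := 1 + x * - T1; pose e (x : R) : R := x * T2.
pose D (x : R) : R := d x * d x + e x * e x.
pose A (x : R) : R := ln (D x) * 2^-1.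
pose B (x : R) : R := atan (- e x * (d x)^-1).
pose W1 (x : R) : R := L1 * A x + (- L2) * B x.
pose W2 (x : R) : R := L1 * B x + L2 * A x.
pose f1 (x : R) : R := limn (pseries (re_coef 1 l t) x).
pose f2 (x : R) : R := limn (pseries (re_coef (- 'i%C) l t) x).
have d_gt0 (x : R) : 0 <= x <= 1 -> 0 < d x.
  move=> x01; have := ler_norm T1; have := normr_ge0 T1 => T0 TT.
  have : x * T1 <= `|T1| by nra.
  rewrite /d; lra.
have D_gt0 (x : R) : 0 <= x <= 1 -> 0 < D x.
  by move=> /d_gt0 d0; rewrite /D; have := mulr_gt0 d0 d0; have := sqr_ge0 (e x); rewrite expr2; lra.
have xt (x : R) : 0 <= x <= 1 -> `|x| * cmod t < 1.
  by move=> x01; rewrite ger0_norm; have := cmod_ge0 t; [nra|lra].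
have fE (x : R) : 0 <= x <= 1 -> Complex (f1 x) (f2 x) = binom_sum l (x%:C * t).
  move=> x01; have g w : limn (pseries (re_coef w l t) x) = Re (w * binom_sum l (x%:C * t)).
    by apply: cvg_lim => //; apply: re_coef_cvg; exact: xt.
  rewrite /f1 /f2 !g mul1r.
  by case: (binom_sum _ _) => a b /=; congr Complex; ring.
have dd (x : R) : is_derive x 1 d (- T1).
  apply: der_eq (derD (der_cst 1 x) (derM (der_id x) (der_cst (- T1) x))); ring.
have de (x : R) : is_derive x 1 e T2.
  by apply: der_eq (derM (der_id x) (der_cst T2 x)); ring.
have dA (x : R) : 0 <= x <= 1 -> is_derive x 1 A ((- T1 * d x + T2 * e x) / D x).
  move=> x01; have D0 := D_gt0 x x01.
  have h := derD (derM (dd x) (dd x)) (derM (de x) (de x)).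
  apply: der_eq (derM (derC (is_derive1_ln D0) h) (der_cst (2^-1) x)).
  by field; rewrite gt_eqF.
have dB (x : R) : 0 <= x <= 1 -> is_derive x 1 B (- (T2 * d x + e x * T1) / D x).
  move=> x01; have D0 := D_gt0 x x01; have d0 := d_gt0 x x01.
  have dn0 : d x != 0 by rewrite gt_eqF.
  have he := derM (der_cst (-1) x) (de x).
  have hn : is_derive x 1 (fun y => - e y) (- T2).
    by have := is_deriveN (de x).
  have h := derM hn (derV dn0 (dd x)).
  apply: der_eq (derC (is_derive1_atan _) h).
  rewrite /D; move: D0 dn0; rewrite /D.
  move: (d x) (e x) => u v D0 u0; field; rewrite u0 /=.
  by rewrite !gt_eqF.
pose w1 (x : R) : R :=
  L1 * ((- T1 * d x + T2 * e x) / D x) - L2 * (- (T2 * d x + e x * T1) / D x).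
pose w2 (x : R) : R :=
  L1 * (- (T2 * d x + e x * T1) / D x) + L2 * ((- T1 * d x + T2 * e x) / D x).
have dW1 (x : R) : 0 <= x <= 1 -> is_derive x 1 W1
    (w1 x).
  move=> x01; rewrite /w1 /w2; apply: der_eq (derD (derM (der_cst L1 x) (dA x x01))
    (derM (der_cst (- L2) x) (dB x x01))); ring.
have dW2 (x : R) : 0 <= x <= 1 -> is_derive x 1 W2
    (w2 x).
  move=> x01; rewrite /w1 /w2; apply: der_eq (derD (derM (der_cst L1 x) (dB x x01))
    (derM (der_cst L2 x) (dA x x01))); ring.
(* The real and imaginary parts of (F_l)' + (W1 + i W2)' F_l = 0. *)
have key (x : R) : 0 <= x <= 1 -> exists a b, [/\ is_derive x 1 f1 a, is_derive x 1 f2 b,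
    a + (w1 x) * f1 x -
    (w2 x) * f2 x = 0 &
    b + (w1 x) * f2 x +
    (w2 x) * f1 x = 0].
  move=> x01; have := @binom_sumS l (x%:C * t); rewrite cmodM cmod_real => /(_ (xt x x01)).
  rewrite -fE //; set Q := binom_sum _ _ => QE.
  have D0 : D x != 0 by rewrite gt_eqF // D_gt0.
  pose q1 := Re Q; pose q2 := Im Q.
  have e1 : f1 x = q1 * d x + q2 * e x.
    rewrite -[f1 x]/(Re (Complex (f1 x) (f2 x))) -QE /q1 /q2 /d /e /T1 /T2.
    by case: (Q) (t) => a b [u v] /=; ring.
  have e2 : f2 x = q2 * d x - q1 * e x.
    rewrite -[f2 x]/(Im (Complex (f1 x) (f2 x))) -QE /q1 /q2 /d /e /T1 /T2.
    by case: (Q) (t) => a b [u v] /=; ring.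
  have r1 : Re (1 * l * t * Q) =
      L1 * (T1 * q1 - T2 * q2) - L2 * (T1 * q2 + T2 * q1).
    rewrite /L1 /L2 /T1 /T2 /q1 /q2.
    by case: (l) (t) (Q) => a b [u v] [g h] /=; ring.
  have r2 : Re (- 'i%C * l * t * Q) =
      L1 * (T1 * q2 + T2 * q1) + L2 * (T1 * q1 - T2 * q2).
    rewrite /L1 /L2 /T1 /T2 /q1 /q2.
    by case: (l) (t) (Q) => a b [u v] [g h] /=; ring.
  exists (Re (1 * l * t * Q)), (Re (- 'i%C * l * t * Q)).
  split; [exact: is_derive_re_coef|exact: is_derive_re_coef| |].
  - rewrite r1 e1 e2; move: D0; rewrite /w1 /w2 /D.
    by move: (d x) (e x) => u v D0; field.
  - rewrite r2 e1 e2; move: D0; rewrite /w1 /w2 /D.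
    by move: (d x) (e x) => u v D0; field.
have hz (x : R) : 0 <= x <= 1 ->
    is_derive x 1 (fun y => expR (W1 y) * (f1 y * cos (W2 y) + -1 * (f2 y * sin (W2 y)))) 0
    /\ is_derive x 1 (fun y => expR (W1 y) * (f1 y * sin (W2 y) + f2 y * cos (W2 y))) 0.
  move=> x01; have [a [b [da db Z1 Z2]]] := key x x01.
  have dE := derC (is_derive_expR (W1 x)) (dW1 x x01).
  have ds := derC (is_derive_sin (W2 x)) (dW2 x x01).
  have dc := derC (is_derive_cos (W2 x)) (dW2 x x01).
  split.
    apply: der_eq (derM dE (derD (derM da dc) (derM (der_cst (-1) x) (derM db ds)))).
    have -> : a = w2 x * f2 x - w1 x * f1 x by lra.
    have -> : b = - w1 x * f2 x - w2 x * f1 x by lra.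
    ring.
  apply: der_eq (derM dE (derD (derM da ds) (derM db dc))).
  have -> : a = w2 x * f2 x - w1 x * f1 x by lra.
  have -> : b = - w1 x * f2 x - w2 x * f1 x by lra.
  ring.
have h1 := der0_cst01 (fun x hx => (hz x hx).1).
have h2 := der0_cst01 (fun x hx => (hz x hx).2).
have I0 : 0 <= (0 : R) <= 1 by rewrite lexx ler01.
have I1 : 0 <= (1 : R) <= 1 by rewrite lexx ler01.
have A0 : A 0 = 0 by rewrite /A /D /d /e !mul0r !addr0 mul1r ln1 mul0r.
have B0 : B 0 = 0 by rewrite /B /e mul0r oppr0 mul0r atan0.
have W10 : W1 0 = 0 by rewrite /W1 A0 B0; ring.
have W20 : W2 0 = 0 by rewrite /W2 A0 B0; ring.
have F0 : Complex (f1 0) (f2 0) = 1.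
  by rewrite (fE 0 I0) rmorph0 mul0r binom_sum0.
have F1 : Complex (f1 1) (f2 1) = binom_sum l t.
  by rewrite (fE 1 I1) rmorph1 mul1r.
have f10 : f1 0 = 1 by rewrite -[f1 0]/(Re (Complex (f1 0) (f2 0))) F0.
have f20 : f2 0 = 0 by rewrite -[f2 0]/(Im (Complex (f1 0) (f2 0))) F0.
rewrite W10 W20 expR0 f10 f20 cos0 sin0 in h1 h2.
have tE : 1 - t = Complex (d 1) (- e 1).
  by rewrite /d /e /T1 /T2; case: (t) => a b; apply/eqP; rewrite eq_complex /=;
    apply/andP; split; apply/eqP; ring.
have d10 := d_gt0 1 I1; have D10 := D_gt0 1 I1.
have clogE : clog (1 - t) = Complex (A 1) (B 1).
  rewrite /clog tE carg_half_plane // cmodE /=; congr Complex.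
  have s0 : 0 < Num.sqrt (D 1) by rewrite sqrtr_gt0.
  have -> : d 1 ^+ 2 + (- e 1) ^+ 2 = D 1 by rewrite /D; ring.
  by rewrite /A -[in RHS](sqr_sqrtr (ltW D10)) lnXn //; field.
have cE : binom_sum l t * cexp (l * clog (1 - t)) = 1.
  rewrite -F1 clogE.
  have -> : l * Complex (A 1) (B 1) = Complex (W1 1) (W2 1).
    rewrite /W1 /W2 /L1 /L2; case: (l) => a b; apply/eqP; rewrite eq_complex /=.
    by apply/andP; split; apply/eqP; ring.
  rewrite /cexp /=; apply/eqP; rewrite eq_complex /=.
  apply/andP; split; apply/eqP; first by transitivity (1 * 1 + -1 * (0 * 0) : R);
    [rewrite -[RHS](mul1r) -h1; ring|ring].
  by transitivity (1 * (1 * 0 + 0 * 1) : R); [rewrite -h2; ring|ring].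
rewrite /cpow mulNr; move: (l * _) cE => w cE.
by rewrite -[RHS]mul1r -cE -mulrA -cexpD subrr cexp0 mulr1.
Qed.

Corollary has_sum_binomial (l t : C) : cmod t < 1 ->
  has_sum (fun n => binom_coef l n * t ^+ n) (cpow (1 - t) (- l)).
Proof. by move=> t1; rewrite -binom_sum_cpow //; exact: binom_sumP. Qed.
End Binomial.
(** * Estimates for the exponential *)

Section Gauss.
Variable R : realType.
Local Notation C := R[i].

Lemma mean_value_le (f df : R -> R) (b M : R) :
  (forall x : R, is_derive x 1 f (df x)) ->
  (forall c, `|c| <= `|b| -> `|df c| <= M) -> `|f b - f 0| <= M * `|b|.
Proof.
move=> hf hM.
have cf (i : interval R) : {within [set` i], continuous f}.
  by apply: derivable_within_continuous => x _; have [] := hf x.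
have [b0|b0] := leP 0 b.
  have [c] := MVT_segment b0 (fun x _ => hf x) (cf _).
  rewrite in_itv /= => /andP[c0 cb] ->; rewrite subr0 normrM ler_wpM2r //.
  by apply: hM; rewrite !ger0_norm.
have [c] := MVT_segment (ltW b0) (fun x _ => hf x) (cf _).
rewrite in_itv /= => /andP[bc c0]; rewrite -normrN opprB => ->.
rewrite sub0r normrM normrN ler_wpM2r //.
by apply: hM; rewrite !ler0_norm ?lerN2 // ltW.
Qed.

Lemma norm_sin_le (b : R) : `|sin b| <= `|b|.
Proof.
have := @mean_value_le sin cos b 1 (@is_derive_sin R) (fun c _ => cos_max c).
by rewrite sin0 subr0 mul1r.
Qed.

Lemma cos_sub1_le (b : R) : `|cos b - 1| <= b ^+ 2.
Proof.
have := @mean_value_le cos (fun x => - sin x) b `|b| (@is_derive_cos R).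
rewrite cos0 -normrM -expr2 (ger0_norm (sqr_ge0 b)); apply=> c cb.
by rewrite normrN; exact: le_trans (norm_sin_le c) cb.
Qed.

Lemma sin_sub_le (b : R) : `|b| <= 1 -> `|sin b - b| <= b ^+ 2.
Proof.
move=> b1; have d (x : R) : is_derive x 1 (fun y : R => sin y + -1 * y) (cos x - 1).
  by apply: der_eq (derD (is_derive_sin x) (derM (der_cst (-1) x) (der_id x))); ring.
have := @mean_value_le _ _ b (b ^+ 2) d; rewrite sin0 mulr0 addr0 subr0 mulN1r.
move=> h; apply: le_trans (h _) _ => [c cb|].
  apply: le_trans (cos_sub1_le c) _; rewrite -[c ^+ 2]real_normK ?num_real //.
  by rewrite -[b ^+ 2]real_normK ?num_real // lerXn2r ?nnegrE.
by rewrite ler_piMr // sqr_ge0.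
Qed.

Lemma expR_sub_le (a : R) : `|a| <= 1 / 2 -> 0 <= expR a - 1 - a <= 2 * a ^+ 2.
Proof.
move=> a2; have a2' : - (1 / 2) <= a <= 1 / 2 by rewrite -ler_norml.
have h1 := expR_ge1Dx a; have h2 := expR_ge1Dx (- a).
have h3 := expRxMexpNx_1 a; have p := expR_gt0 a.
apply/andP; split; first lra.
have h4 : expR a * (1 - a) <= 1 by rewrite -[leRHS]h3 ler_wpM2l // ltW.
have a1 : 0 < 1 - a by lra.
suff : expR a <= 1 + a + 2 * a ^+ 2 by lra.
rewrite -(ler_pM2r a1); apply: le_trans h4 _.
have -> : (1 + a + 2 * a ^+ 2) * (1 - a) = 1 + a ^+ 2 * (1 - 2 * a) by ring.
by rewrite lerDl mulr_ge0 ?sqr_ge0 //; lra.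
Qed.

Lemma cexp_sub_le (w : C) : cmod w <= 1 / 2 ->
  cmod (cexp w - 1 - w) <= 9 * cmod w ^+ 2.
Proof.
move=> w2; have ha := normRe_le_cmod w; have hb := normIm_le_cmod w.
apply: le_trans (cmod_le_ReIm _) _.
move: w2 ha hb; case: w => a b /= ; set r := cmod _ => w2 ha hb.
have h1 := @expR_sub_le a (le_trans ha w2).
have h2 := cos_sub1_le b; have h3 : `|sin b - b| <= b ^+ 2.
  by apply: sin_sub_le; lra.
have h4 := norm_sin_le b.
have ra : a ^+ 2 <= r ^+ 2.
  by rewrite -[a ^+ 2]real_normK ?num_real // lerXn2r // nnegrE ?cmod_ge0.
have rb : b ^+ 2 <= r ^+ 2.
  by rewrite -[b ^+ 2]real_normK ?num_real // lerXn2r // nnegrE ?cmod_ge0.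
have ea : expR a <= 2.
  have := ler_norm a; have : a ^+ 2 <= 1 / 4; last by lra.
    apply: le_trans ra _; have : 0 <= r by exact: cmod_ge0.
    by move: w2; nra.
have e0 := expR_gt0 a.
have -> : expR a * cos b - 1 - a = (expR a - 1 - a) + expR a * (cos b - 1) by ring.
have -> : expR a * sin b - 0 - b = (expR a - 1) * sin b + (sin b - b) by ring.
have h5 : `|expR a - 1 - a + expR a * (cos b - 1)| <= 4 * r ^+ 2.
  apply: le_trans (ler_normD _ _) _; rewrite normrM (ger0_norm (ltW e0)).
  rewrite (ger0_norm (proj1 (andP h1))); have := normr_ge0 (cos b - 1); nra.
have h6 : `|expR a - 1| <= 2 * r.
  have r0 : 0 <= r by exact: cmod_ge0.
  have : `|expR a - 1| <= `|expR a - 1 - a| + `|a|.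
    by have := ler_normD (expR a - 1 - a) a; rewrite subrK.
  rewrite (ger0_norm (proj1 (andP h1))); nra.
have h7 : `|(expR a - 1) * sin b + (sin b - b)| <= 3 * r ^+ 2.
  apply: le_trans (ler_normD _ _) _; rewrite normrM.
  have : `|expR a - 1| * `|sin b| <= 2 * r * r.
    by apply: ler_pM => //; lra.
  rewrite expr2; lra.
have := sqr_ge0 r; lra.
Qed.

(** * Infinite products with quadratically small factors *)

(** Once [K / N <= 1 / 4], the sequence stays within half of [|u N|] of [u N]: its
increments are summable, and its limit is nonzero. *)
Lemma telescoping_limit (u : nat -> C) (K : R) (N0 : nat) :
  0 <= K -> (forall n, (N0 <= n)%N -> u n != 0) ->
  (forall n, (N0 <= n)%N ->
    cmod (u n.+1 - u n) <= K * (n%:R^-1 - n.+1%:R^-1) * cmod (u n)) ->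
  exists2 l : C, l != 0 & seq_lim u l.
Proof.
move=> K0 un0 hu.
have [J hJ] := @archimedean_mul R (4 * (K + 1)) 1 ltr01.
pose N := maxn 1 (maxn N0 J).
have N0N : (N0 <= N)%N by rewrite /N !leq_max leqnn orbT.
have N1 : (0 < N)%N by rewrite /N leq_max ltnS.
have NK : 4 * (K + 1) <= N%:R.
  by have := hJ N; rewrite mulr1; apply; rewrite /N !leq_max leqnn !orbT.
have Npos : 0 < N%:R :> R by rewrite ltr0n.
have KN : K * N%:R^-1 <= 1 / 4.
  rewrite -ler_pdivlMr ?invr_gt0 // invrK; lra.
pose a := cmod (u N).
have a0 : 0 < a by rewrite cmod_gt0 un0.
have inv0 k : 0 <= k%:R^-1 :> R by rewrite invr_ge0 ler0n.
have key k : cmod (u (N + k)%N - u N) <= 2 * a * K * (N%:R^-1 - (N + k)%N%:R^-1).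
  elim: k => [|k IH]; first by rewrite addn0 !subrr cmod0 mulr0.
  have hk := hu (N + k)%N (leq_trans N0N (leq_addr _ _)).
  have uk : cmod (u (N + k)%N) <= 2 * a.
    have := cmodD (u (N + k)%N - u N) (u N); rewrite subrK -/a => h.
    apply: le_trans h _; apply: le_trans (lerD IH (lexx _)) _.
    have : K * (N%:R^-1 - (N + k)%:R^-1) <= 1 / 4.
      by apply: le_trans KN; rewrite ler_wpM2l // gerBl.
    nra.
  have := cmod_triangle (u (N + k)%N) (u (N + k.+1)%N) (u N); rewrite addnS => h.
  apply: le_trans h _.
  have dk : 0 <= (N + k)%:R^-1 - (N + k).+1%:R^-1 :> R.
    by rewrite subr_ge0 lef_pV2 ?posrE ?ltr0n ?ler_nat // ltn_addr.
  have : cmod (u (N + k).+1 - u (N + k)%N) <=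
      K * ((N + k)%:R^-1 - (N + k).+1%:R^-1) * (2 * a).
    by apply: le_trans hk _; rewrite ler_wpM2l // mulr_ge0.
  have -> : 2 * a * K * (N%:R^-1 - (N + k).+1%:R^-1) =
      K * ((N + k)%:R^-1 - (N + k).+1%:R^-1) * (2 * a) +
      2 * a * K * (N%:R^-1 - (N + k)%:R^-1) by ring.
  by move=> h1; apply: lerD.
have step k : cmod (u (N + k).+1 - u (N + k)%N) <=
    2 * a * K * ((N + k)%:R^-1 - (N + k).+1%:R^-1).
  have hk := hu (N + k)%N (leq_trans N0N (leq_addr _ _)).
  have dk : 0 <= (N + k)%:R^-1 - (N + k).+1%:R^-1 :> R.
    by rewrite subr_ge0 lef_pV2 ?posrE ?ltr0n ?ler_nat // ltn_addr.
  have uk : cmod (u (N + k)%N) <= 2 * a.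
    have := cmodD (u (N + k)%N - u N) (u N); rewrite subrK -/a => h.
    apply: le_trans h _; apply: le_trans (lerD (key k) (lexx _)) _.
    have : K * (N%:R^-1 - (N + k)%:R^-1) <= 1 / 4.
      by apply: le_trans KN; rewrite ler_wpM2l // gerBl.
    nra.
  apply: le_trans hk _.
  have -> : 2 * a * K * ((N + k)%:R^-1 - (N + k).+1%:R^-1) =
    K * ((N + k)%:R^-1 - (N + k).+1%:R^-1) * (2 * a) by ring.
  by rewrite ler_wpM2l // mulr_ge0.
pose d k := u (N + k).+1 - u (N + k)%N.
have tel k : \sum_(i < k) d i = u (N + k)%N - u N.
  elim: k => [|k IH]; first by rewrite big_ord0 addn0 subrr.
  by rewrite big_ord_recr /= IH /d addnS; ring.
have telR k : \sum_(i < k) ((N + i)%:R^-1 - (N + i).+1%:R^-1) =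
    N%:R^-1 - (N + k)%:R^-1 :> R.
  elim: k => [|k IH]; first by rewrite big_ord0 addn0 subrr.
  by rewrite big_ord_recr /= IH addnS; ring.
have aK0 : 0 <= 2 * a * K by rewrite !mulr_ge0 // ltW.
have [s hs] : exists s, has_sum d s.
  apply: abs_summable_has_sum.
  apply: (@bounded_sum_nat _ _ (2 * a * K * N%:R^-1)) => [k|k]; first exact: cmod_ge0.
  apply: (@le_trans _ _ (2 * a * K * (N%:R^-1 - (N + k)%:R^-1))).
    by rewrite -telR mulr_sumr; apply: ler_sum => i _; exact: step.
  by rewrite ler_wpM2l // gerBl.
have hl : seq_lim u (s + u N).
  move=> e e0; have [M hM] := has_sum_seq_lim hs e0.
  exists (N + M)%N => n Mn; have Nn := leq_trans (leq_addr M N) Mn.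
  have := hM (n - N)%N; rewrite leq_subRL // => /(_ Mn).
  by rewrite tel subnKC // opprB addrA.
exists (s + u N) => //; apply/eqP => l0.
have [|M hM] := hl (a / 4); first by lra.
have := hM (N + M)%N (leq_addl _ _); rewrite l0 sub0r cmodN => h1.
have h2 := key M; have := cmodB (u (N + M)%N) (u (N + M)%N - u N).
rewrite opprB addrC subrK -/a.
have : K * (N%:R^-1 - (N + M)%:R^-1) <= 1 / 4.
  by apply: le_trans KN; rewrite ler_wpM2l // gerBl.
nra.
Qed.
End Gauss.
(** * Gauss's limit for the Gamma function *)

Section GammaFunction.
Variable R : realType.
Local Notation C := R[i].

(** Gauss's approximants of Gamma. *)
Definition gauss (z : C) (n : nat) : C :=
  n`!%:R * cpow n%:R z / rising z n.+1.

Lemma cmod_cexp (w : C) : cmod (cexp w) = expR (Re w).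
Proof.
rewrite cmodE /cexp /=; set E := expR _.
have -> : (E * cos (Im w)) ^+ 2 + (E * sin (Im w)) ^+ 2 = E ^+ 2.
  by rewrite !exprMn -mulrDr cos2Dsin2 mulr1.
by rewrite sqrtr_sqr ger0_norm // expR_ge0.
Qed.

Lemma cexp_neq0 (w : C) : cexp w != 0.
Proof. by rewrite -cmod_gt0 cmod_cexp expR_gt0. Qed.

Lemma cpow_nat (n : nat) (z : C) : (0 < n)%N ->
  cpow n%:R z = cexp (z * (ln n%:R)%:C).
Proof.
move=> n0; rewrite /cpow /clog; congr (cexp (_ * _)).
have -> : (n%:R : C) = Complex n%:R 0 by rewrite complexr0 rmorph_nat.
rewrite carg_half_plane ?ltr0n // mul0r atan0.
by rewrite complexr0 cmod_real ger0_norm ?ler0n.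
Qed.

Lemma nonpole_neq0 (z : C) (n : nat) : ~ nonpos_integer z -> z + n%:R != 0.
Proof.
move=> h; apply/eqP => zn; apply: h; exists n.
by apply/eqP; rewrite -subr_eq0 opprK zn.
Qed.

Lemma rising_neq0 (z : C) (n : nat) : ~ nonpos_integer z -> rising z n != 0.
Proof.
move=> h; elim: n => [|n IH]; first by rewrite rising0 oner_eq0.
by rewrite risingS mulf_neq0 // nonpole_neq0.
Qed.

Lemma nonpole_addn (z : C) (n : nat) :
  ~ nonpos_integer z -> ~ nonpos_integer (z + n%:R).
Proof.
move=> h [m zm]; apply: h; exists (m + n)%N.
by rewrite natrD opprD -zm addrK.
Qed.

Lemma gauss_neq0 (z : C) (n : nat) : (0 < n)%N -> ~ nonpos_integer z ->
  gauss z n != 0.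
Proof.
move=> n0 h; rewrite /gauss cpow_nat // !mulf_neq0 ?cexp_neq0 ?factC_neq0 //.
by rewrite invr_eq0 rising_neq0.
Qed.

Lemma gaussS (z : C) (n : nat) : (0 < n)%N -> ~ nonpos_integer z ->
  gauss z n.+1 * (z + n.+1%:R) =
  gauss z n * (n.+1%:R * cexp (z * (ln n.+1%:R - ln n%:R)%:C)).
Proof.
move=> n0 h; rewrite /gauss !cpow_nat //.
have -> : z * (ln n.+1%:R)%:C = z * (ln n%:R)%:C + z * (ln n.+1%:R - ln n%:R)%:C.
  by rewrite rmorphB; ring.
rewrite cexpD (risingS z n.+1) factS natrM.
have h1 := rising_neq0 n.+1 h; have h2 := nonpole_neq0 n.+1 h.
move: (rising z n.+1) (z + n.+1%:R) h1 h2 => r w h1 h2.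
by field; rewrite h1.
Qed.

Lemma ln_step (n : nat) : (0 < n)%N ->
  n.+1%:R^-1 <= ln (n.+1%:R : R) - ln (n%:R : R) <= n%:R^-1.
Proof.
move=> n0; have n0R : 0 < n%:R :> R by rewrite ltr0n.
have n1R : 0 < n.+1%:R :> R by rewrite ltr0n.
have i0 : 0 < n%:R^-1 :> R by rewrite invr_gt0.
have i1 : 0 < n.+1%:R^-1 :> R by rewrite invr_gt0.
have i2 : n.+1%:R^-1 < 1 :> R by rewrite invf_lt1 // ltr1n ltnS.
have E1 : n.+1%:R / n%:R = 1 + n%:R^-1 :> R by rewrite -natr1; field; rewrite gt_eqF.
have E2 : n%:R / n.+1%:R = 1 + - n.+1%:R^-1 :> R.
  by rewrite -[X in X / _](addrK 1) natr1; field; rewrite nat1r gt_eqF.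
apply/andP; split; last first.
  by rewrite -ln_div ?posrE // E1 le_ln1Dx //; lra.
have : ln (1 + - n.+1%:R^-1) <= - n.+1%:R^-1 :> R by rewrite le_ln1Dx // ltrN2.
by rewrite -E2 ln_div ?posrE // => h; rewrite -lerN2 opprB.
Qed.

(** The ratio of two successive approximants is [1 + O(1 / n ^ 2)]. *)
Theorem gauss_limit (z : C) : ~ nonpos_integer z ->
  exists2 l : C, l != 0 & seq_lim (gauss z) l.
Proof.
move=> h; pose Z := cmod z; have Z0 : 0 <= Z by exact: cmod_ge0.
have [J hJ] := @archimedean_mul R (2 * Z) 1 ltr01.
apply: (@telescoping_limit R (gauss z) (36 * Z ^+ 2 + 2 * Z) (maxn 1 J)).
- by have := sqr_ge0 Z; lra.
- by move=> n; rewrite geq_max => /andP[n1 _]; exact: gauss_neq0.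
move=> n; rewrite geq_max => /andP[n1 Jn].
have nZ : 2 * Z <= n%:R by rewrite -[leRHS]mulr1 hJ.
have n0R : 1 <= n%:R :> R by rewrite ler1n.
(* As real numbers, N is n + 1 and m is n; d is the increment of the logarithm. *)
pose N : R := n.+1%:R; have NE : N = n%:R + 1 by rewrite /N -natr1.
pose d := ln N - ln n%:R; have /andP[d1 d2] := ln_step n1.
rewrite -/N -/d in d1 d2.
pose m : R := n%:R; rewrite -/m in nZ n0R NE d2.
have d0 : 0 < d by apply: lt_le_trans d1; rewrite invr_gt0 NE; lra.
have dm : d * m <= 1 by rewrite -ler_pdivlMr ?mul1r //; lra.
have dN : 1 <= d * N by rewrite -ler_pdivrMr ?mul1r // NE; lra.
have zN0 : z + n.+1%:R != 0 := nonpole_neq0 n.+1 h.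
have E : (gauss z n.+1 - gauss z n) * (z + n.+1%:R) =
  gauss z n * (N%:C * (cexp (z * d%:C) - 1 - z * d%:C) + z * (d * N - 1)%:C).
  rewrite mulrBl gaussS // -/d.
  have -> : (d * N - 1)%:C = d%:C * N%:C - 1 by rewrite (rmorphB _ (d * N)) rmorphM.
  have -> : n.+1%:R = N%:C :> C by rewrite /N rmorph_nat.
  move: (d%:C) => dC; ring.
have zN : N / 2 <= cmod (z + n.+1%:R).
  have := cmodB (z + n.+1%:R) z; rewrite addrAC subrr add0r cmod_nat -/N -/Z; lra.
have cz : cmod (z * d%:C) = Z * d.
  by rewrite cmodM cmod_real ger0_norm // ltW.
have Zd : Z * d <= 1 / 2.
  have : 2 * Z * d <= m * d by rewrite ler_wpM2r // ltW.
  lra.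
have ce := cexp_sub_le (w := z * d%:C); rewrite cz in ce.
have num : cmod (N%:C * (cexp (z * d%:C) - 1 - z * d%:C) + z * (d * N - 1)%:C) <=
    N * (9 * (Z * d) ^+ 2) + Z * (d * N - 1).
  apply: le_trans (cmodD _ _) _; rewrite !cmodM !cmod_real -/Z.
  rewrite (ger0_norm (_ : 0 <= N)); last by rewrite NE; lra.
  rewrite (ger0_norm (_ : 0 <= d * N - 1)); last by lra.
  rewrite lerD2r ler_wpM2l ?ce // NE; lra.
have Npos : 0 < N / 2 by rewrite NE; lra.
have g0 := cmod_ge0 (gauss z n).
have main : cmod (gauss z n.+1 - gauss z n) * (N / 2) <=
    cmod (gauss z n) * (N * (9 * (Z * d) ^+ 2) + Z * (d * N - 1)).
  apply: (@le_trans _ _ (cmod ((gauss z n.+1 - gauss z n) * (z + n.+1%:R)))).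
    by rewrite cmodM ler_wpM2l // cmod_ge0.
  by rewrite E cmodM ler_wpM2l.
rewrite -(ler_pM2r Npos); apply: le_trans main _.
rewrite mulrC mulrAC ler_wpM2r //.
have -> : (36 * Z ^+ 2 + 2 * Z) * (m^-1 - N^-1) * (N / 2) =
    (18 * Z ^+ 2 + Z) / m.
  by rewrite NE; field; rewrite -NE; apply/andP; split; rewrite gt_eqF //; rewrite ?NE; lra.
rewrite ler_pdivlMr; last by lra.
have h1 : N * d * (d * m) <= 2.
  have : N * d <= 2 by rewrite NE; nra.
  have : 0 <= d * m by rewrite mulr_ge0 //; lra.
  have : 0 <= N * d by rewrite mulr_ge0 //; lra.
  nra.
have h2 : (d * N - 1) * m <= 1 by rewrite NE; nra.
have -> : (N * (9 * (Z * d) ^+ 2) + Z * (d * N - 1)) * m =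
   9 * Z ^+ 2 * (N * d * (d * m)) + Z * ((d * N - 1) * m) by ring.
apply: lerD; last by rewrite ler_piMr.
have := sqr_ge0 Z; nra.
Qed.

Lemma Gamma_lim (z : C) : ~ nonpos_integer z ->
  seq_lim (gauss z) (Gamma z) /\ Gamma z != 0.
Proof.
move=> /gauss_limit[l l0 hl].
have -> : Gamma z = l by apply: seq_lim_limn; exact: hl.
by [].
Qed.

Lemma seq_limM (u v : nat -> C) (l m : C) :
  seq_lim u l -> seq_lim v m -> seq_lim (fun n => u n * v n) (l * m).
Proof.
move=> hu hv e e0; have [e' e'0 he'] := cmod_mul_close l m e0.
have [N hN] := hu _ e'0; have [M hM] := hv _ e'0.
exists (maxn N M) => n; rewrite geq_max => /andP[/hN a /hM b]; exact: he'.
Qed.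

Lemma Gamma_add1 (z : C) : ~ nonpos_integer z -> Gamma (z + 1) = z * Gamma z.
Proof.
move=> h; have [h1 _] := Gamma_lim h.
have [h2 _] := Gamma_lim (@nonpole_addn z 1 h).
have z0 : z != 0 by have := nonpole_neq0 0 h; rewrite addr0.
have hv : seq_lim (fun n => z * (n%:R / (z + n.+1%:R))) z.
  move=> e e0; pose K := cmod z * (cmod z + 1).
  have K0 : 0 <= K by rewrite /K; have := cmod_ge0 z; nra.
  have [J hJ] := @archimedean_mul R (K + e * cmod z) e e0.
  exists J => n Jn; have zn := nonpole_neq0 n.+1 h.
  have -> : z - z * (n%:R / (z + n.+1%:R)) = z * (z + 1) / (z + n.+1%:R).
    by rewrite -natr1 in zn *; field.
  rewrite !cmodM cmodV ltr_pdivrMr ?cmod_gt0 //.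
  have : n.+1%:R <= cmod (z + n.+1%:R) + cmod z.
    by have := cmodB (z + n.+1%:R) z; rewrite addrAC subrr add0r cmod_nat.
  have : cmod (z + 1) <= cmod z + 1 by have := cmodD z 1; rewrite cmod1.
  have := hJ n Jn; rewrite /K -natr1; have := cmod_ge0 z; nra.
rewrite mulrC; apply: seq_lim_unique h2 _ => e e0.
have [N hN] := seq_limM h1 hv e0; exists N.+1 => n Nn.
have -> : gauss (z + 1) n = gauss z n * (z * (n%:R / (z + n.+1%:R))).
  have n0 : (0 < n)%N by apply: leq_trans Nn.
  have rE m : rising z m.+1 = z * rising (z + 1) m.
    elim: m => [|m IH]; first by rewrite risingS !rising0 addr0; ring.
    by rewrite risingS IH (risingS (z + 1)) -natr1; ring.
  rewrite /gauss !cpow_nat // mulrDl mul1r cexpD.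
  have -> : cexp (ln n%:R)%:C = n%:R :> C.
    rewrite /cexp /= cos0 sin0 mulr0 mulr1 lnK ?posrE ?ltr0n //.
    by rewrite complexr0 rmorph_nat.
  have zn := nonpole_neq0 n.+1 h; have r0 := rising_neq0 n.+1 h.
  have r1 : rising (z + 1) n.+1 != 0.
    by apply: rising_neq0; exact: (@nonpole_addn z 1 h).
  have := rE n.+1; rewrite risingS => rr.
  have -> : (rising z n.+1)^-1 = (z + n.+1%:R) / (z * rising (z + 1) n.+1).
    by rewrite -rr invfM mulrCA divff // mulr1.
  move: (z + n.+1%:R) zn (rising (z + 1) n.+1) r1 => w w0 r' r'0.
  by field; rewrite ?z0 ?w0 ?r'0.
by apply: hN; exact: ltnW.
Qed.

Lemma Gamma_addn (z : C) (n : nat) : ~ nonpos_integer z ->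
  Gamma (z + n%:R) = rising z n * Gamma z.
Proof.
move=> h; elim: n => [|n IH]; first by rewrite addr0 rising0 mul1r.
rewrite -natr1 addrA Gamma_add1; last exact: nonpole_addn.
by rewrite IH risingS; ring.
Qed.

End GammaFunction.
(** * Convexity of the modulus of Gamma on horizontal lines *)

Section GammaGrowth.
Variable R : realType.
Local Notation C := R[i].

(** The logarithm lies below its tangent at the weighted mean. *)
Lemma weighted_amgm (X Y th : R) : 0 < X -> 0 < Y -> 0 <= th <= 1 ->
  X `^ th * Y `^ (1 - th) <= th * X + (1 - th) * Y.
Proof.
move=> X0 Y0 th01; pose m := th * X + (1 - th) * Y.
have m0 : 0 < m.
  rewrite /m; have [->|t0] := eqVneq th 0; first by rewrite mul0r add0r subr0 mul1r.
  have t0' : 0 < th by rewrite lt_def t0; lra.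
  by have := mulr_gt0 t0' X0; have : 0 <= (1 - th) * Y by [apply: mulr_ge0; lra]; lra.
have lnle (Z : R) : 0 < Z -> ln Z <= ln m + (Z - m) / m.
  move=> Z0; have -> : ln Z = ln m + ln (Z / m).
    by rewrite -lnM ?posrE ?divr_gt0 //; congr ln; field; rewrite gt_eqF.
  rewrite lerD2l; have -> : Z / m = 1 + (Z - m) / m by field; rewrite gt_eqF.
  apply: le_ln1Dx; rewrite mulrBl divff ?gt_eqF //.
  have : 0 < Z / m by rewrite divr_gt0.
  lra.
rewrite -/m /powR !gt_eqF // -expRD -[leRHS](lnK (x := m)) ?posrE // ler_expR.
have h1 := lnle X X0; have h2 := lnle Y Y0.
have E : th * ((X - m) / m) + (1 - th) * ((Y - m) / m) = 0.
  by rewrite !mulrA -mulrDl; apply/eqP; rewrite mulf_eq0; apply/orP; left;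
    apply/eqP; rewrite /m; ring.
have : th * ln X <= th * (ln m + (X - m) / m) by rewrite ler_wpM2l //; lra.
have : (1 - th) * ln Y <= (1 - th) * (ln m + (Y - m) / m) by rewrite ler_wpM2l //; lra.
rewrite !mulrDr; lra.
Qed.

(** For [1 <= Re z] and [y = Im z], this bounds the ratio of [|z + j|] to
[Re z + j].  The product over [j] converges, so that moving off the real axis
changes the modulus of Gamma by a bounded factor only. *)
Definition vertical_factor (y : R) (j : nat) : R := 1 + y ^+ 2 / j.+1%:R ^+ 2.

Lemma prod_vertical_factor_le (y : R) (n : nat) :
  \prod_(j < n) vertical_factor y j <= expR (2 * y ^+ 2).
Proof.
have y2 : 0 <= y ^+ 2 by exact: sqr_ge0.
case: n => [|n]; first by rewrite big_ord0 -[leLHS]expR0 ler_expR; lra.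
suff h : \prod_(j < n.+1) vertical_factor y j <= expR (y ^+ 2 * (2 - n.+1%:R^-1)).
  apply: le_trans h _; rewrite ler_expR.
  by rewrite mulrC ler_wpM2r // gerBl invr_ge0.
elim: n => [|n IH].
  rewrite big_ord1 /vertical_factor expr1n divr1 invr1; apply: le_trans (expR_ge1Dx _) _.
  by rewrite ler_expR; lra.
rewrite big_ord_recr /=.
have i0 m : 0 <= vertical_factor y m by rewrite /vertical_factor addr_ge0 // divr_ge0 // exprn_ge0.
have -> : y ^+ 2 * (2 - n.+2%:R^-1) =
    y ^+ 2 * (2 - n.+1%:R^-1) + y ^+ 2 * (n.+1%:R^-1 - n.+2%:R^-1) by ring.
rewrite expRD; apply: ler_pM => //; first by apply: prodr_ge0.
apply: le_trans (expR_ge1Dx _) _; rewrite ler_expR ler_wpM2l //.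
have p1 : 0 < n.+1%:R :> R by rewrite ltr0n.
rewrite -[n.+2%:R]natr1; move: (n.+1%:R : R) p1 => N N0.
have -> : N^-1 - (N + 1)^-1 = (N * (N + 1))^-1.
  by field; rewrite !gt_eqF //; lra.
have N1 : 0 < N + 1 by lra.
by rewrite expr2 lef_pV2 ?posrE ?mulr_gt0 // ler_wpM2r //; lra.
Qed.

Lemma Re_addR (z : C) (x : R) : Re (z + x%:C) = Re z + x.
Proof. by case: z. Qed.
Lemma Im_addR (z : C) (x : R) : Im (z + x%:C) = Im z.
Proof. by case: z => a b /=; rewrite addr0. Qed.

Lemma natC (n : nat) : (n%:R : C) = (n%:R)%:C.
Proof. by rewrite rmorph_nat. Qed.

Lemma Re_le_cmod (z : C) : Re z <= cmod z.
Proof. exact: le_trans (ler_norm _) (normRe_le_cmod z). Qed.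

Lemma cmod_vertical_factor (z : C) (j : nat) : 1 <= Re z ->
  cmod (z + j%:R) <= (Re z + j%:R) * vertical_factor (Im z) j.
Proof.
move=> z1; rewrite cmodE natC Re_addR Im_addR.
have j0 : 0 <= j%:R :> R by exact: ler0n.
have xj : j.+1%:R <= Re z + j%:R by rewrite -nat1r lerD2r.
have j1 : 0 < j.+1%:R :> R by rewrite ltr0n.
have x0 : 0 < Re z + j%:R by lra.
have p0 : 0 <= Im z ^+ 2 / j.+1%:R ^+ 2 by rewrite divr_ge0 ?sqr_ge0 // exprn_ge0 // ltW.
have k1 : 1 <= vertical_factor (Im z) j by rewrite lerDl.
have k0 : 0 <= vertical_factor (Im z) j by apply: le_trans k1.
have rhs0 : 0 <= (Re z + j%:R) * vertical_factor (Im z) j by rewrite mulr_ge0 ?(ltW x0).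
rewrite -[leRHS]ger0_norm // -sqrtr_sqr ler_wsqrtr // exprMn.
have h : Im z ^+ 2 <= (Re z + j%:R) ^+ 2 * (Im z ^+ 2 / j.+1%:R ^+ 2).
  rewrite mulrCA ler_peMr ?sqr_ge0 // -expr_div_n.
  by apply: exprn_ege1; rewrite ler_pdivlMr // mul1r.
have h2 : vertical_factor (Im z) j <= vertical_factor (Im z) j ^+ 2.
  by rewrite expr2 ler_peMr.
apply: (@le_trans _ _ ((Re z + j%:R) ^+ 2 * vertical_factor (Im z) j)).
  by rewrite /vertical_factor mulrDr mulr1 lerD2l.
by rewrite ler_wpM2l // sqr_ge0.
Qed.

(** On the real axis this is the concavity of the logarithm; the product of the
[vertical_factor] accounts for the imaginary part. *)
Lemma rising_convex (z : C) (d th : R) (n : nat) :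
  1 <= Re z -> 0 <= d -> 0 <= th <= 1 ->
  cmod (rising (z + d%:C) n) `^ th * cmod (rising z n) `^ (1 - th) <=
  (\prod_(j < n) vertical_factor (Im z) j) * cmod (rising (z + (th * d)%:C) n).
Proof.
move=> z1 d0 th01; elim: n => [|n IH].
  by rewrite !rising0 cmod1 !powR1 big_ord0 !mulr1.
rewrite !risingS !cmodM !powRM ?cmod_ge0 // mulrACA big_ord_recr /= [leRHS]mulrACA.
apply: ler_pM => //; try by rewrite mulr_ge0 ?powR_ge0.
have n0 : 0 <= n%:R :> R by exact: ler0n.
have zd1 : 1 <= Re (z + d%:C) by rewrite Re_addR; lra.
have c1 : 0 < cmod (z + d%:C + n%:R).
  by apply: lt_le_trans (Re_le_cmod _); rewrite (natC n) !Re_addR; lra.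
have c0 : 0 < cmod (z + n%:R).
  by apply: lt_le_trans (Re_le_cmod _); rewrite (natC n) Re_addR; lra.
apply: le_trans (weighted_amgm c1 c0 th01) _.
have h1 := cmod_vertical_factor n zd1; have h0 := cmod_vertical_factor n z1.
rewrite Re_addR Im_addR in h1.
have ht := Re_le_cmod (z + (th * d)%:C + n%:R).
rewrite (natC n) !Re_addR in ht.
have i0 : 0 <= vertical_factor (Im z) n.
  by rewrite /vertical_factor addr_ge0 // divr_ge0 ?sqr_ge0 // exprn_ge0.
apply: (@le_trans _ _ (vertical_factor (Im z) n * (Re z + th * d + n%:R))); last first.
  by rewrite ler_wpM2l // (natC n).
have e1 : th * cmod (z + d%:C + n%:R) <= th * ((Re z + d + n%:R) * vertical_factor (Im z) n).
  by rewrite ler_wpM2l //; lra.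
have e0 : (1 - th) * cmod (z + n%:R) <= (1 - th) * ((Re z + n%:R) * vertical_factor (Im z) n).
  by rewrite ler_wpM2l //; lra.
apply: le_trans (lerD e1 e0) _.
by rewrite le_eqVlt; apply/orP; left; apply/eqP; ring.
Qed.

Lemma Re_ge1_nonpole (z : C) : 1 <= Re z -> ~ nonpos_integer z.
Proof.
move=> z1 [n zn]; move: z1; rewrite zn natC -rmorphN /=.
by have : 0 <= n%:R :> R by [exact: ler0n]; lra.
Qed.

Lemma cmod_gauss (z : C) (n : nat) : (0 < n)%N ->
  cmod (gauss z n) = n`!%:R * expR (Re z * ln n%:R) / cmod (rising z n.+1).
Proof.
move=> n0; rewrite /gauss cpow_nat // !cmodM cmodV cmod_nat cmod_cexp.
by congr (_ * expR _ / _); case: z => a b /=; ring.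
Qed.

Lemma powR_split (a th : R) : 0 < a -> a `^ th * a `^ (1 - th) = a.
Proof.
move=> a0; rewrite -powRD ?(gt_eqF a0) ?implybT //.
by rewrite addrC subrK powRr1 // ltW.
Qed.

Lemma gauss_convex (z : C) (d th : R) (n : nat) : (0 < n)%N ->
  1 <= Re z -> 0 <= d -> 0 <= th <= 1 ->
  cmod (gauss (z + (th * d)%:C) n) <= expR (2 * Im z ^+ 2) *
    (cmod (gauss (z + d%:C) n) `^ th * cmod (gauss z n) `^ (1 - th)).
Proof.
move=> n0 z1 d0 th01; rewrite !cmod_gauss // !Re_addR.
have nonp (x : R) : 0 <= x -> 0 < cmod (rising (z + x%:C) n.+1).
  move=> x0; rewrite cmod_gt0 rising_neq0 //; apply: Re_ge1_nonpole.
  by rewrite Re_addR; lra.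
have thd : 0 <= th * d by apply: mulr_ge0; lra.
have At := nonp _ thd; have A1 := nonp _ d0.
have A0 : 0 < cmod (rising z n.+1) by have := nonp 0 (lexx _); rewrite rmorph0 addr0.
have := rising_convex n.+1 z1 d0 th01; move: At A1 A0.
set at_ := cmod (rising (z + _) _); set a1 := cmod (rising (z + d%:C) _).
set a0 := cmod (rising z _) => At A1 A0 hA.
have f0 := fact_gt0R R n.
have -> : n`!%:R * expR ((Re z + th * d) * ln n%:R) =
   (n`!%:R * expR ((Re z + d) * ln n%:R)) `^ th *
   (n`!%:R * expR (Re z * ln n%:R)) `^ (1 - th).
  rewrite !powRM ?expR_ge0 ?ler0n // mulrACA powR_split // -!expRM -expRD.
  by congr (_ * expR _); ring.
have pV (a p : R) : 0 < a -> (a^-1) `^ p = (a `^ p)^-1.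
  by move=> a00; rewrite -powR_inv1 ?ltW // -powRrM mulN1r powRN.
rewrite !(powRM _ (mulr_ge0 _ _)) ?expR_ge0 ?ler0n ?invr_ge0 ?(ltW A0) ?(ltW A1) //.
rewrite !pV // [X in _ <= _ * X]mulrACA.
set N := (_ `^ th * _ `^ (1 - th)).
have N0 : 0 <= N by rewrite mulr_ge0 ?powR_ge0.
rewrite [leRHS]mulrCA ler_wpM2l // -invfM ler_pdivlMr ?mulr_gt0 ?powR_gt0 //.
rewrite mulrC ler_pdivrMr //; apply: le_trans hA _.
by rewrite ler_wpM2r ?(ltW At) // prod_vertical_factor_le.
Qed.

(** Gauss's approximants satisfy the inequality without the factor 4, which pays
for replacing limits by approximants within a factor 2 of them. *)
Theorem Gamma_convex (z : C) (d th : R) :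
  1 <= Re z -> 0 <= d -> 0 <= th <= 1 ->
  cmod (Gamma (z + (th * d)%:C)) <= 4 * expR (2 * Im z ^+ 2) *
    (cmod (Gamma (z + d%:C)) `^ th * cmod (Gamma z) `^ (1 - th)).
Proof.
move=> z1 d0 th01; set K := expR _.
have nonp (x : R) : 0 <= x -> ~ nonpos_integer (z + x%:C).
  by move=> x0; apply: Re_ge1_nonpole; rewrite Re_addR; lra.
have thd : 0 <= th * d by apply: mulr_ge0; lra.
have [ht t0] := Gamma_lim (nonp _ thd); have [h1 g1] := Gamma_lim (nonp _ d0).
have [h0 g0] := Gamma_lim (Re_ge1_nonpole z1).
rewrite -cmod_gt0 in t0; rewrite -cmod_gt0 in g1; rewrite -cmod_gt0 in g0.
move: ht h1 h0 t0 g1 g0.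
move: (Gamma _) (Gamma (z + d%:C)) (Gamma z) => a b c ht h1 h0 t0 g1 g0.
have [|Nt hNt] := ht (cmod a / 2); first by lra.
have [N1 hN1] := h1 _ g1; have [N0 hN0] := h0 _ g0.
pose n := (Nt + N1 + N0).+1.
have {hNt}lt := hNt n (leq_trans (leq_addr _ _) (leq_trans (leq_addr _ _) (leqnSn _))).
have {hN1}l1 := hN1 n (leq_trans (leq_addl _ _) (leq_trans (leq_addr _ _) (leqnSn _))).
have {hN0}l0 := hN0 n (leq_trans (leq_addl _ _) (leqnSn _)).
have := gauss_convex (isT : (0 < n)%N) z1 d0 th01; rewrite -/K.
move: lt l1 l0; move: (gauss _ n) (gauss (z + d%:C) n) (gauss z n) => u v w lt l1 l0 hu.
have hA : cmod a / 2 <= cmod u.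
  by have := cmodD (a - u) u; rewrite subrK; lra.
have hB : cmod v <= 2 * cmod b.
  by have := cmodB b (b - v); rewrite opprB addrC subrK; lra.
have hC : cmod w <= 2 * cmod c.
  by have := cmodB c (c - w); rewrite opprB addrC subrK; lra.
have : cmod v `^ th * cmod w `^ (1 - th) <= 2 * (cmod b `^ th * cmod c `^ (1 - th)).
  have -> : 2 = 2 `^ th * 2 `^ (1 - th) :> R by rewrite powR_split.
  rewrite mulrACA -!powRM ?cmod_ge0 //.
  apply: ler_pM; rewrite ?powR_ge0 //; apply: ge0_ler_powR; rewrite ?nnegrE ?mulr_ge0 ?cmod_ge0 //; lra.
have K0 : 0 < K := expR_gt0 _.
move=> hvw; have := ler_wpM2l (ltW K0) hvw; lra.
Qed.
End GammaGrowth.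
(** * Growth of the Pochhammer symbol *)

Section PochhammerGrowth.
Variable R : realType.
Local Notation C := R[i].

Lemma pochhammer_Gamma (al : C) (nu : R) : ~ nonpos_integer al ->
  pochhammer al nu = Gamma (al + nu%:C) / Gamma al.
Proof.
move=> h; rewrite /pochhammer; case: ifPn => // nat_nu.
have [_ g0] := Gamma_lim h.
by rewrite -[in RHS](truncnK nat_nu) -natC Gamma_addn // mulfK.
Qed.

Lemma pochhammer_nat (al : C) (n : nat) : pochhammer al n%:R = rising al n.
Proof. by rewrite /pochhammer natr_nat natrK. Qed.

Lemma pochhammer_nonpole (al : C) (nu : R) : ~ nonpos_integer al ->
  pochhammer_defined al nu -> ~ nonpos_integer (al + nu%:C).
Proof.
move=> h [nat_nu|[_ //]].
by rewrite -(truncnK nat_nu) -natC; exact: nonpole_addn.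
Qed.

(** The bound is the inverse of a sum of inverses. *)
Lemma positive_min (f : nat -> nat -> R) (J : nat) :
  (forall a b, 0 < f a b) ->
  exists2 c : R, 0 < c <= 1 & forall a b, (a < J)%N -> (b < J)%N -> c <= f a b.
Proof.
move=> f0; pose S := \sum_(a < J) \sum_(b < J) (f a b)^-1.
have i0 a b : 0 <= (f a b)^-1 by rewrite invr_ge0 ltW.
have S0 : 0 <= S by apply: sumr_ge0 => a _; apply: sumr_ge0.
have S1 : 0 < 1 + S by lra.
exists (1 + S)^-1.
  by rewrite invr_gt0 S1 /= invf_le1 //; lra.
move=> a b aJ bJ; rewrite -[leRHS]invrK lef_pV2 ?posrE ?invr_gt0 //.
have : (f a b)^-1 <= S; last by lra.
rewrite /S (bigD1 (Ordinal aJ)) //= (bigD1 (Ordinal bJ)) //= -addrA lerDl.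
by apply: addr_ge0; apply: sumr_ge0 => // a' _; apply: sumr_ge0.
Qed.

Lemma rising_ge1 (z : C) (n : nat) : 1 <= Re z -> n`!%:R <= cmod (rising z n).
Proof.
move=> z1; elim: n => [|n IH]; first by rewrite rising0 cmod1.
rewrite risingS cmodM factS natrM mulrC; apply: ler_pM => //.
apply: le_trans (Re_le_cmod _); rewrite natC Re_addR -natr1; lra.
Qed.

(** All but finitely many factors have real part at least 1.  The predicate [P]
singles out the pairs of degrees that occur for some multi-index. *)
Lemma shift_lower_bound (al : C) (rho : R) (s : nat) (P : nat -> nat -> Prop) :
  0 < rho ->
  (forall a b, P a b -> ~ nonpos_integer (al + (rho * a%:R + b%:R)%:C)) ->
  exists2 c : R, 0 < c & forall a b, P a b ->
    c <= cmod (rising (al + (rho * a%:R + b%:R)%:C) s).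
Proof.
move=> rho0 h; pose r := Num.min rho 1.
have r0 : 0 < r by rewrite lt_min rho0 ltr01.
have rr : r <= rho by rewrite ge_min lexx.
have r1 : r <= 1 by rewrite ge_min lexx orbT.
have [J hJ] := @archimedean_mul R (1 - Re al) r r0.
pose f a b := if `[< P a b >] then
  cmod (rising (al + (rho * a%:R + b%:R)%:C) s) else 1.
have [|c /andP[c0 c1] hc] := @positive_min f J.
  move=> a b; rewrite /f; case: asboolP => Pab; last exact: ltr01.
  by rewrite cmod_gt0 rising_neq0 //; exact: h.
exists c => // a b Pab; have [/andP[aJ bJ]|] := boolP ((a < J) && (b < J))%N.
  by have := hc a b aJ bJ; rewrite /f; case: asboolP.
rewrite negb_and -!leqNgt => big; apply: le_trans c1 _.
have a0 : 0 <= a%:R :> R by exact: ler0n.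
have b0 : 0 <= b%:R :> R by exact: ler0n.
have z1 : 1 <= Re (al + (rho * a%:R + b%:R)%:C).
  rewrite Re_addR; case/orP: big => /hJ Jle.
    have : a%:R * r <= rho * a%:R by rewrite mulrC ler_wpM2r.
    lra.
  have : b%:R * r <= b%:R by rewrite ler_piMr.
  have : 0 <= rho * a%:R by rewrite mulr_ge0 // ltW.
  lra.
apply: le_trans (rising_ge1 s z1).
by rewrite ler1n fact_gt0.
Qed.

Lemma shift_Re (al : C) : exists s : nat, 1 <= Re (al + s%:R).
Proof.
have [J hJ] := @archimedean_mul R (1 - Re al) 1 ltr01.
exists J; rewrite natC Re_addR; have := hJ J (leqnn _); rewrite mulr1; lra.
Qed.

(** The index [2 th a + b] is the mean of [2 a + b] and [b] with weights [th] and
[1 - th], and at these integers the Pochhammer symbol is a rising factorial.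
Convexity holds on the half plane [1 <= Re], so [al] is shifted first. *)
Lemma pochhammer_le (al : C) (th K : R) (dom : nat -> nat -> Prop) :
  ~ nonpos_integer al -> 0 < th <= 1 -> 1 < K ->
  (forall a b, dom a b -> pochhammer_defined al (2 * th * a%:R + b%:R)) ->
  exists2 B : R, 0 < B & forall a b : nat, dom a b ->
    cmod (pochhammer al (2 * th * a%:R + b%:R)) <=
    B * (K ^+ (2 * a + b) * ((2 * a + b)`!%:R `^ th * b`!%:R `^ (1 - th))).
Proof.
move=> h th01 K1 def; have [s s1] := shift_Re al.
have [c c0 hc] := @shift_lower_bound al (2 * th) s dom ltac:(lra)
  (fun a b Pab => pochhammer_nonpole h (def a b Pab)).
have [_ G0] := Gamma_lim h; have nal := Re_ge1_nonpole s1.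
have [_ Gs0] := Gamma_lim nal.
rewrite -cmod_gt0 in G0; rewrite -cmod_gt0 in Gs0.
have [B B0 hB] := rising_le (al + s%:R) K1.
set L := 4 * expR (2 * Im (al + s%:R) ^+ 2).
have L0 : 0 < L by rewrite mulr_gt0 ?expR_gt0.
pose D := L * (cmod (Gamma (al + s%:R)) * B).
have D0 : 0 < D by rewrite mulr_gt0 // mulr_gt0.
exists (D / (c * cmod (Gamma al))); first by rewrite divr_gt0 // mulr_gt0.
move=> a b Pab; rewrite pochhammer_Gamma // cmodM cmodV.
set nu := _ + b%:R; have hn := pochhammer_nonpole h (def a b Pab); rewrite -/nu in hn.
have hcab := hc a b Pab; rewrite -/nu in hcab.
rewrite ler_pdivrMr // [leRHS]mulrAC.
have -> : D / (c * cmod (Gamma al)) * cmod (Gamma al) = D / c.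
  by field; rewrite !gt_eqF.
rewrite mulrAC ler_pdivlMr //.
apply: (@le_trans _ _ (cmod (Gamma (al + s%:R + nu%:C)))).
  rewrite addrAC Gamma_addn // cmodM mulrC ler_wpM2r // cmod_ge0 //.
have b0 : 0 <= b%:R :> R by exact: ler0n.
have a0 : 0 <= 2 * a%:R :> R by rewrite mulr_ge0 ?ler0n.
have zb1 : 1 <= Re (al + s%:R + b%:R) by rewrite (natC R b) Re_addR; lra.
have th01' : 0 <= th <= 1 by lra.
have := Gamma_convex zb1 a0 th01'.
have -> : al + s%:R + b%:R + (th * (2 * a%:R))%:C = al + s%:R + nu%:C.
  by rewrite -[in LHS]addrA (natC R b) -rmorphD; congr (_ + _%:C); rewrite /nu; ring.
have -> : al + s%:R + b%:R + (2 * a%:R)%:C = al + s%:R + (2 * a + b)%N%:R.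
  by rewrite (natC R b) (natC R (2 * a + b)) natrD natrM rmorphD; ring.
have -> : Im (al + s%:R + b%:R) = Im (al + s%:R) by rewrite (natC R b) Im_addR.
rewrite -/L !(Gamma_addn _ nal) => h1; apply: le_trans h1 _.
set G := cmod (Gamma _) in Gs0 D D0 *; set N := (2 * a + b)%N.
have K0 : 0 <= K by lra.
pose P := G * B * K ^+ N.
have up n : (n <= N)%N ->
    cmod (rising (al + s%:R) n * Gamma (al + s%:R)) <= P * n`!%:R.
  move=> nab; rewrite cmodM -/G /P mulrC -!mulrA ler_wpM2l ?(ltW Gs0) //.
  apply: le_trans (hB n) _; rewrite ler_wpM2l ?(ltW B0) // ler_wpM2r //.
  by apply: ler_weXn2l => //; exact: ltW.
have P0 : 0 < P by rewrite !mulr_gt0 // exprn_gt0 //; lra.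
have -> : D * (K ^+ N * (N`!%:R `^ th * b`!%:R `^ (1 - th))) =
    L * (P * (N`!%:R `^ th * b`!%:R `^ (1 - th))) by rewrite /D /P; ring.
rewrite ler_wpM2l ?(ltW L0) // -[X in _ <= X * _](powR_split th P0).
rewrite mulrACA -!powRM ?ler0n ?(ltW P0) //.
have hx := up _ (leqnn _); have hy := up b (leq_addl _ _).
have [t0 t1] : 0 <= th /\ 0 <= 1 - th by split; lra.
have Pf n : 0 <= P * n`!%:R by rewrite mulr_ge0 ?ler0n // ltW.
apply: ler_pM; rewrite ?powR_ge0 //; apply: ge0_ler_powR;
  by rewrite ?nnegrE ?cmod_ge0.
Qed.

(** Here the even integer [2 m] is a mean of [rho m] and 0, so convexity bounds the
value at [rho m] from below by a power of a rising factorial. *)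
Lemma pochhammer_ge (al : C) (rho : R) : ~ nonpos_integer al -> 2 < rho ->
  (forall m : nat, pochhammer_defined al (rho * m%:R)) ->
  exists m0 : nat, exists2 c : R, 0 < c & forall m : nat,
    c * m`!%:R `^ rho <= cmod (pochhammer al (rho * (m0 + m)%N%:R)).
Proof.
move=> h rho2 def; have rh0 : 0 <= rho / 2 by lra.
have [_ G0] := Gamma_lim h.
have [J hJ] := @archimedean_mul R (1 - Re al) rho ltac:(lra).
have rho0 : rho != 0 by rewrite gt_eqF //; lra.
exists J; pose z := al + (rho * J%:R)%:C.
have z1 : 1 <= Re z.
  by rewrite /z Re_addR; have := hJ J (leqnn _); rewrite mulrC; lra.
have nz := Re_ge1_nonpole z1; have [_ Gz0] := Gamma_lim nz.
rewrite -cmod_gt0 in G0; rewrite -cmod_gt0 in Gz0.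
(* 2 m = th * (rho * m). *)
pose th := 2 / rho; have th01 : 0 < th <= 1.
  by rewrite /th divr_gt0 ?ler_pdivrMr //=; lra.
set L := 4 * expR (2 * Im z ^+ 2); have L0 : 0 < L by rewrite mulr_gt0 ?expR_gt0.
pose G := cmod (Gamma z).
pose Q := G / (L * G `^ (1 - th)).
have Q0 : 0 < Q by rewrite divr_gt0 // mulr_gt0 // powR_gt0.
exists (Q `^ (rho / 2) / cmod (Gamma al)).
  by rewrite divr_gt0 // powR_gt0.
move=> m; rewrite pochhammer_Gamma // cmodM cmodV.
have -> : al + (rho * (J + m)%:R)%:C = z + (rho * m%:R)%:C.
  by rewrite /z natrD mulrDr rmorphD addrA.
rewrite mulrAC ler_wpM2r ?invr_ge0 ?(ltW G0) //.
have rm0 : 0 <= rho * m%:R by rewrite mulr_ge0 ?ler0n //; lra.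
have th01' : 0 <= th <= 1 by lra.
have := Gamma_convex z1 rm0 th01'.
have -> : (th * (rho * m%:R))%:C = (2 * m)%N%:R.
  by rewrite natC natrM; congr (_%:C); rewrite /th mulrA divfK.
rewrite Gamma_addn // cmodM -/G -/L.
set X := cmod (Gamma (z + _)) => hX.
have hf : m`!%:R ^+ 2 <= cmod (rising z (2 * m)).
  apply: le_trans (rising_ge1 _ z1).
  rewrite -natrX ler_nat mul2n -addnn; have := bin_fact (leq_addr m m).
  by rewrite addKn => <-; rewrite -mulnn leq_pmull // bin_gt0 leq_addr.
have hQ : Q * m`!%:R ^+ 2 <= X `^ th.
  have : m`!%:R ^+ 2 * G <= L * (X `^ th * G `^ (1 - th)).
    by apply: le_trans hX; rewrite ler_wpM2r // ltW.
  move=> hG; rewrite /Q [leLHS]mulrAC ler_pdivrMr; last by rewrite mulr_gt0 // powR_gt0.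
  by rewrite [G * _]mulrC [leRHS]mulrCA.
have := @ge0_ler_powR R (rho / 2) rh0 _ _ _ _ hQ.
rewrite !nnegrE powR_ge0 mulr_ge0 ?(ltW Q0) ?exprn_ge0 // => /(_ isT isT).
rewrite powRM ?(ltW Q0) ?exprn_ge0 // -powRrM.
have -> : th * (rho / 2) = 1 by rewrite /th mulrA divfK // divff ?pnatr_eq0.
rewrite powRr1 ?cmod_ge0 // -powR_mulrn // -powRrM.
by have -> : 2%:R * (rho / 2) = rho by field.
Qed.

End PochhammerGrowth.
(** * Multinomial bounds and sums over multi-indices *)

Section MultiIndex.
Variable R : realType.
Local Notation C := R[i].

Lemma binomial_term_two (a b : nat) (y z : R) : 0 <= y -> 0 <= z ->
  (a + b)`!%:R * (y ^+ a * z ^+ b) <= a`!%:R * b`!%:R * (y + z) ^+ (a + b).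
Proof.
move=> y0 z0; have E : (a + b)`!%:R = 'C(a + b, b)%:R * (a`!%:R * b`!%:R) :> R.
  by rewrite -!natrM -(bin_fact (leq_addl a b)) addnK [(b`! * _)%N]mulnC.
rewrite E -mulrA mulrCA ler_wpM2l ?mulr_ge0 ?ler0n //.
have hb : (b < (a + b).+1)%N by rewrite ltnS leq_addl.
rewrite mulr_natl exprDn (bigD1 (Ordinal hb)) //= addnK lerDl.
by apply: sumr_ge0 => i _; rewrite mulrn_wge0 // mulr_ge0 ?exprn_ge0.
Qed.

(** A single term of the multinomial theorem, by induction from the binomial
one. *)
Lemma multinomial_term (I : Type) (s : seq I) (d : I -> nat) (Y : I -> R) :
  (forall i, 0 <= Y i) ->
  (\sum_(i <- s) d i)`!%:R * \prod_(i <- s) Y i ^+ d i <=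
  \prod_(i <- s) (d i)`!%:R * (\sum_(i <- s) Y i) ^+ (\sum_(i <- s) d i).
Proof.
move=> Y0; elim: s => [|i s IH]; first by rewrite !big_nil expr0.
rewrite !big_cons; set D := \sum_(_ <- s) d _; set S := \sum_(_ <- s) Y _.
set P := \prod_(_ <- s) (_`!%:R); set T := \prod_(_ <- s) (_ ^+ _).
have S0 : 0 <= S by apply: sumr_ge0.
have D0 : 0 < D`!%:R :> R by exact: fact_gt0R.
have h := binomial_term_two (d i) D (Y0 i) S0.
rewrite -/D -/S -/P -/T in IH.
have F0 : 0 <= (d i + D)`!%:R * Y i ^+ d i by rewrite mulr_ge0 ?ler0n ?exprn_ge0.
have h1 := ler_wpM2l F0 IH.
rewrite -(ler_pM2l D0).
have -> : D`!%:R * ((d i + D)`!%:R * (Y i ^+ d i * T)) =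
  (d i + D)`!%:R * Y i ^+ d i * (D`!%:R * T) by ring.
apply: le_trans h1 _.
have P0 : 0 <= P by apply: prodr_ge0 => j _; exact: ler0n.
have -> : (d i + D)`!%:R * Y i ^+ d i * (P * S ^+ D) =
  P * ((d i + D)`!%:R * (Y i ^+ d i * S ^+ D)) by ring.
have -> : D`!%:R * ((d i)`!%:R * P * (Y i + S) ^+ (d i + D)) =
  P * ((d i)`!%:R * D`!%:R * (Y i + S) ^+ (d i + D)) by ring.
exact: ler_wpM2l.
Qed.

Lemma central_binomial_le (n : nat) : (2 * n)`!%:R <= 4 ^+ n * n`!%:R ^+ 2 :> R.
Proof.
have := @binomial_term_two n n 1 1 ler01 ler01; rewrite !expr1n !mulr1.
rewrite addnn -mul2n exprM -expr2 => h; apply: le_trans h _.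
rewrite mulrC le_eqVlt; apply/orP; left; apply/eqP; congr (_ ^+ _ * _); ring.
Qed.

Lemma fact_superexp (z : R) : 0 < z ->
  exists2 D : R, 0 < D & forall n, n`!%:R^-1 <= D * z ^+ n.
Proof.
move=> z0; have [J hJ] := @archimedean_mul R 1 z z0.
have [|n|n Jn|D D0 hD] := @ratio_bound R (fun=> 1) (fun n => z ^+ n * n`!%:R) J.
- by move=> n; exact: ler01.
- by rewrite mulr_gt0 ?exprn_gt0 ?fact_gt0R.
- rewrite !mul1r exprS factS natrM.
  have : 1 <= n.+1%:R * z by apply: hJ; exact: leqW.
  have := mulr_gt0 (exprn_gt0 n z0) (fact_gt0R R n); nra.
exists D => // n; rewrite -[leLHS]mul1r ler_pdivrMr ?fact_gt0R // -mulrA.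
exact: hD.
Qed.

(** A finite set of multi-indices lies in a cube, over which the sum of products
is a product of sums. *)
Lemma bounded_sum_ffun (r : nat) (w : nat -> R) (S : R) :
  (forall n, 0 <= w n) -> (forall N, \sum_(n < N) w n <= S) ->
  bounded_sum (fun m : {ffun 'I_r -> nat} => \prod_(i < r) w (m i)).
Proof.
move=> w0 hS; exists (S ^+ r) => A.
pose N := (\max_(m <- A) \max_(i < r) m i).+1.
have mN m i : m \in A -> (m i < N)%N.
  move=> mA; rewrite ltnS (big_rem m) //= leq_max; apply/orP; left.
  exact: leq_bigmax.
pose h (f : {ffun 'I_r -> 'I_N}) : {ffun 'I_r -> nat} := [ffun i => val (f i)].
have hi : injective h.
  move=> f g /ffunP fg; apply/ffunP => i; apply: val_inj.
  by have := fg i; rewrite !ffunE.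
pose T := [fset f in enum {: {ffun 'I_r -> 'I_N}}]%fset.
apply: (@le_trans _ _ (\sum_(m <- [fset h f | f in T]%fset) \prod_(i < r) w (m i))).
  apply: big_fset_subset => [m|]; first by apply: prodr_ge0.
  apply/fsubsetP => m mA; apply/imfsetP.
  exists [ffun i => Ordinal (mN m i mA)]; first by rewrite !inE /= mem_enum.
  by apply/ffunP => i; rewrite !ffunE.
rewrite (big_fset_inj _ _ hi).
have -> : \sum_(f <- T) \prod_(i < r) w (h f i) =
    \sum_(f : {ffun 'I_r -> 'I_N}) \prod_(i < r) w (f i).
  rewrite -big_enum /=.
  rewrite (perm_big (enum {: {ffun 'I_r -> 'I_N}})) /=.
    by apply: eq_bigr => f _; apply: eq_bigr => i _; rewrite ffunE.
  apply: uniq_perm; [exact: fset_uniq|exact: enum_uniq|].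
  by move=> f; rewrite !inE.
rewrite -(bigA_distr_bigA (fun (i : 'I_r) (j : 'I_N) => w j)).
rewrite prodr_const card_ord; apply: lerXn2r; rewrite ?nnegrE //.
- by apply: sumr_ge0.
- by apply: le_trans (hS 0%N); rewrite big_ord0.
Qed.

Lemma prod_expr_sum (I : Type) (s : seq I) (P : pred I) (c : R) (d : I -> nat) :
  \prod_(i <- s | P i) c ^+ d i = c ^+ (\sum_(i <- s | P i) d i).
Proof. by rewrite -expr_sum. Qed.

End MultiIndex.
(** * Interpolation between rho = 2 and rho = 0 *)

Section Growth.
Variables (R : realType) (r k : nat).
Local Notation C := R[i].
Local Notation mindex := {ffun 'I_r -> nat}.

Definition first_deg (m : mindex) : nat := \sum_(i < r | (i < k)%N) m i.
Definition last_deg (m : mindex) : nat := \sum_(i < r | (k <= i)%N) m i.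

(** In the first group the factorial of [m i] is joined by the rising factorial of
the gamma parameter, which grows in the same way; in the second group the beta
parameter compensates the latter. *)
Definition den (m : mindex) (i : 'I_r) : R :=
  if (i < k)%N then (m i)`!%:R ^+ 2 else (m i)`!%:R.

Lemma den_gt0 m i : 0 < den m i.
Proof. by rewrite /den; case: ifP => _; rewrite ?exprn_gt0 // fact_gt0R. Qed.

Definition monomial (X : 'I_r -> R) (m : mindex) : R :=
  \prod_(i < r) (X i ^+ m i / den m i).

Lemma monomial_ge0 X m : (forall i, 0 <= X i) -> 0 <= monomial X m.
Proof.
move=> X0; apply: prodr_ge0 => i _; rewrite divr_ge0 ?exprn_ge0 //.
exact/ltW/den_gt0.
Qed.

Lemma total_deg (m : mindex) : \sum_(i < r) m i = (first_deg m + last_deg m)%N.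
Proof.
rewrite /first_deg /last_deg (bigID (fun i : 'I_r => (i < k)%N)) /=.
by congr addn; apply: eq_bigl => i; rewrite -leqNgt.
Qed.

(** The case [rho = 2]: the square of [n!] dominates [(2 n)! / 4 ^ n], which turns
the product into a multinomial term in the square roots of the first group. *)
Lemma monomial_le_two (X : 'I_r -> R) (m : mindex) : (forall i, 0 <= X i) ->
  (2 * first_deg m + last_deg m)`!%:R * monomial X m <=
  (2 * (\sum_(i < r | (i < k)%N) Num.sqrt (X i)) + \sum_(i < r | (k <= i)%N) X i)
    ^+ (2 * first_deg m + last_deg m).
Proof.
move=> X0.
pose d (i : 'I_r) := if (i < k)%N then (2 * m i)%N else m i.
pose Y (i : 'I_r) := if (i < k)%N then 2 * Num.sqrt (X i) else X i.
have Y0 i : 0 <= Y i by rewrite /Y; case: ifP => // _; rewrite mulr_ge0 ?sqrtr_ge0.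
have dE : \sum_(i < r) d i = (2 * first_deg m + last_deg m)%N.
  rewrite (bigID (fun i : 'I_r => (i < k)%N)) /= /first_deg big_distrr /=.
  congr addn; first by apply: eq_bigr => i ik; rewrite /d ik.
  by apply: eq_big => [i|i]; rewrite -leqNgt // /d ltnNge => ->.
have YE : \sum_(i < r) Y i =
    2 * (\sum_(i < r | (i < k)%N) Num.sqrt (X i)) + \sum_(i < r | (k <= i)%N) X i.
  rewrite (bigID (fun i : 'I_r => (i < k)%N)) /= big_distrr /=.
  congr (_ + _); first by apply: eq_bigr => i ik; rewrite /Y ik.
  by apply: eq_big => [i|i]; rewrite -leqNgt // /Y ltnNge => ->.
have := multinomial_term (index_enum 'I_r) d Y0; rewrite dE YE => h.
have F0 : 0 < \prod_(i < r) (d i)`!%:R :> R by apply: prodr_gt0 => i _; exact: fact_gt0R.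
rewrite -(ler_pM2l F0); apply: le_trans h; rewrite mulrCA ler_wpM2l ?ler0n //.
rewrite -big_split /=; apply: ler_prod => i _; apply/andP; split.
  by rewrite mulr_ge0 ?ler0n // divr_ge0 ?exprn_ge0 //; exact/ltW/den_gt0.
rewrite mulrA ler_pdivrMr ?den_gt0 // /d /Y /den; case: ifP => _; last first.
  by rewrite mulrC.
have -> : (2 * Num.sqrt (X i)) ^+ (2 * m i) = 4 ^+ m i * X i ^+ m i.
  have E : (2 * Num.sqrt (X i)) ^+ 2 = 4 * X i.
    by rewrite -[in RHS](sqr_sqrtr (X0 i)); ring.
  by rewrite exprM E exprMn.
rewrite [leRHS]mulrAC ler_wpM2r ?exprn_ge0 //.
exact: central_binomial_le.
Qed.

(** The case [rho = 0]: the first group then has superexponential decay. *)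
Lemma monomial_le_zero (X : 'I_r -> R) (z : R) : (forall i, 0 <= X i) -> 0 < z ->
  exists2 D : R, 0 < D & forall m : mindex,
    (last_deg m)`!%:R * monomial X m <=
    D * (z ^+ first_deg m * (\sum_(i < r | (k <= i)%N) X i) ^+ last_deg m).
Proof.
move=> X0 z0.
have fac (i : 'I_r) : exists D : R, 0 < D /\
    forall n, X i ^+ n / n`!%:R ^+ 2 <= D * z ^+ n.
  have X1 : 0 < X i + 1 by have := X0 i; lra.
  have [D D0 hD] := @fact_superexp R (z / (X i + 1)) (divr_gt0 z0 X1).
  exists D; split=> // n; have f1 : 1 <= n`!%:R :> R by rewrite ler1n fact_gt0.
  apply: (@le_trans _ _ ((X i + 1) ^+ n / n`!%:R)).
    apply: ler_pM; rewrite ?exprn_ge0 ?invr_ge0 ?exprn_ge0 //.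
      by apply: lerXn2r; rewrite ?nnegrE ?(ltW X1) // lerDl.
    rewrite lef_pV2 ?posrE ?exprn_gt0 ?fact_gt0R // expr2 ler_peMl // ler0n.
  have := hD n; rewrite expr_div_n mulrA ler_pdivlMr ?exprn_gt0 //.
  by rewrite mulrC.
have [D hD] := choice fac.
exists (\prod_(i < r | (i < k)%N) D i).
  by apply: prodr_gt0 => i _; have [] := hD i.
move=> m; rewrite /monomial (bigID (fun i : 'I_r => (i < k)%N)) /= mulrCA.
have -> : (\prod_(i < r | (i < k)%N) D i) * (z ^+ first_deg m *
    (\sum_(i < r | (k <= i)%N) X i) ^+ last_deg m) =
  (\prod_(i < r | (i < k)%N) (D i * z ^+ m i)) *
    (\sum_(i < r | (k <= i)%N) X i) ^+ last_deg m.
  by rewrite big_split /= prod_expr_sum mulrA.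
apply: ler_pM.
- apply: prodr_ge0 => i _; rewrite divr_ge0 ?exprn_ge0 //; exact/ltW/den_gt0.
- rewrite mulr_ge0 ?ler0n //; apply: prodr_ge0 => i _.
  rewrite divr_ge0 ?exprn_ge0 //; exact/ltW/den_gt0.
- apply: ler_prod => i ik; rewrite divr_ge0 ?exprn_ge0 ?(ltW (den_gt0 _ _)) //=.
  by rewrite /den ik; have [_ ->] := hD i.
have := multinomial_term [seq i : 'I_r <- index_enum 'I_r | (k <= i)%N] m X0.
rewrite !big_filter -/(last_deg m) => h.
have F0 : 0 < \prod_(i < r | (k <= i)%N) (m i)`!%:R :> R.
  by apply: prodr_gt0 => i _; exact: fact_gt0R.
rewrite -(ler_pM2l F0); apply: le_trans h; rewrite mulrCA ler_wpM2l ?ler0n //.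
rewrite le_eqVlt; apply/orP; left; apply/eqP.
rewrite (eq_bigl (fun i : 'I_r => (k <= i)%N)) => [|i]; last by rewrite -leqNgt.
rewrite -big_split /=; apply: eq_bigr => i ki.
by rewrite /den ltnNge ki /= mulrC divfK // gt_eqF // fact_gt0R.
Qed.

Lemma powRX (c y : R) n : 0 < c -> (c ^+ n) `^ y = (c `^ y) ^+ n.
Proof.
move=> c0; rewrite -(powR_mulrn n (ltW c0)) powRAC.
by rewrite powR_mulrn // powR_ge0.
Qed.

(** For [th = 1] this is the case [rho = 2].  For [th < 1] the geometric mean
inherits from [rho = 0] an arbitrarily fast decay in the first group, which
beats the exponential growth allowed for [rho = 2]. *)
Lemma monomial_interpolated (X : 'I_r -> R) (th : R) : (forall i, 0 <= X i) ->
  0 <= th <= 1 ->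
  2 * th * (\sum_(i < r | (i < k)%N) Num.sqrt (X i)) +
    \sum_(i < r | (k <= i)%N) X i < 1 ->
  exists s D : R, [/\ 0 < s < 1, 0 < D & forall m : mindex,
    (2 * first_deg m + last_deg m)`!%:R `^ th *
    (last_deg m)`!%:R `^ (1 - th) * monomial X m <=
    D * s ^+ (first_deg m + last_deg m)].
Proof.
move=> X0 th01; set S1 := \sum_(i < r | (i < k)%N) _.
set S2 := \sum_(i < r | (k <= i)%N) _ => hS.
have S10 : 0 <= S1 by apply: sumr_ge0 => i _; exact: sqrtr_ge0.
have S20 : 0 <= S2 by apply: sumr_ge0.
have tS : 0 <= th * S1 by apply: mulr_ge0 => //; lra.
have [th1|th1] := eqVneq th 1.
  pose s := (1 + (2 * S1 + S2)) / 2.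
  rewrite th1 in hS *; have s01 : 0 < s < 1 by rewrite /s; lra.
  exists s, 1; split; [exact: s01|exact: ltr01|move=> m].
  rewrite subrr powRr0 mulr1 powRr1 ?ler0n // mul1r.
  apply: le_trans (monomial_le_two m X0) _; rewrite -/S1 -/S2.
  apply: (@le_trans _ _ (s ^+ (2 * first_deg m + last_deg m))).
    by apply: lerXn2r; rewrite ?nnegrE /s; lra.
  apply: ler_wiXn2l; [lra|lra|].
  by rewrite leq_add2r leq_pmull.
have th_lt1 : 0 < 1 - th by have : th < 1 by [rewrite lt_neqAle th1; lra]; lra.
pose s := (1 + S2) / 2; have s01 : 0 < s < 1 by rewrite /s; lra.
have S2s : S2 < s by rewrite /s; lra.
(* Scaling the first group by eta = e ^ 2 brings the case rho = 2 below s; z is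
   the rate for which the two powers combine to s. *)
pose e := (s - S2) / (2 * S1 + 1).
have e0 : 0 < e by rewrite divr_gt0; lra.
have eS : 2 * (e * S1) + S2 <= s.
  have : e * (2 * S1 + 1) = s - S2 by rewrite /e divfK // gt_eqF //; lra.
  lra.
pose eta := e ^+ 2; have eta0 : 0 < eta by rewrite exprn_gt0.
pose z := (s * eta `^ th) `^ (1 - th)^-1.
have seta : 0 < s * eta `^ th by rewrite mulr_gt0 ?powR_gt0 //; lra.
have z0 : 0 < z by rewrite powR_gt0.
have zE : z `^ (1 - th) = s * eta `^ th.
  by rewrite /z -powRrM mulVf ?gt_eqF // powRr1 // ltW.
have [D D0 hD] := monomial_le_zero X0 z0.
exists s, (D `^ (1 - th)); split; [exact: s01|by rewrite powR_gt0|move=> m].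
set a := first_deg m; set b := last_deg m; set p := monomial X m.
have p0 : 0 <= p by exact: monomial_ge0.
have [->|pn0] := eqVneq p 0.
  by rewrite mulr0 mulr_ge0 ?powR_ge0 // exprn_ge0 //; lra.
have pp : 0 < p by rewrite lt_def pn0.
have h2 : (2 * a + b)`!%:R * p <= eta ^- a * s ^+ b.
  pose X' (i : 'I_r) := if (i < k)%N then eta * X i else X i.
  have X'0 i : 0 <= X' i by rewrite /X'; case: ifP => // _; rewrite mulr_ge0 // ltW.
  have pE : monomial X' m = eta ^+ a * p.
    rewrite /p /monomial (bigID (fun i : 'I_r => (i < k)%N)) /=.
    rewrite [in RHS](bigID (fun i : 'I_r => (i < k)%N)) /= mulrA; congr (_ * _).
      rewrite /a /first_deg -prod_expr_sum -big_split /=; apply: eq_bigr => i ik.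
      by rewrite /X' ik exprMn mulrA.
    by apply: eq_bigr => i ik; rewrite /X' (negbTE ik).
  have := monomial_le_two m X'0; rewrite pE -/a -/b.
  have -> : \sum_(i < r | (i < k)%N) Num.sqrt (X' i) = e * S1.
    rewrite /S1 mulr_sumr; apply: eq_bigr => i ik.
    by rewrite /X' ik sqrtrM ?(ltW eta0) // sqrtr_sqr ger0_norm // ltW.
  have -> : \sum_(i < r | (k <= i)%N) X' i = S2.
    by apply: eq_bigr => i ki; rewrite /X' ltnNge ki.
  move=> h; rewrite ler_pdivlMl ?exprn_gt0 // mulrCA; apply: le_trans h _.
  apply: (@le_trans _ _ (s ^+ (2 * a + b))).
    by apply: lerXn2r => //; rewrite ?nnegrE; [have := mulr_ge0 (ltW e0) S10; lra|lra].
  by apply: ler_wiXn2l; [lra|lra|rewrite leq_addl].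
have h0 : b`!%:R * p <= D * (z ^+ a * s ^+ b).
  apply: le_trans (hD m) _; rewrite ler_wpM2l ?(ltW D0) // ler_wpM2l ?exprn_ge0 ?(ltW z0) //.
  by apply: lerXn2r; rewrite ?nnegrE -/S2 ?(ltW S2s) //; case/andP: s01 => /ltW.
have -> : (2 * a + b)`!%:R `^ th * b`!%:R `^ (1 - th) * p =
    ((2 * a + b)`!%:R * p) `^ th * (b`!%:R * p) `^ (1 - th).
  by rewrite !powRM ?ler0n // mulrACA powR_split.
apply: (@le_trans _ _ ((eta ^- a * s ^+ b) `^ th * (D * (z ^+ a * s ^+ b)) `^ (1 - th))).
  have s0 : 0 <= s by lra.
  have nn1 : 0 <= eta ^- a * s ^+ b by rewrite mulr_ge0 ?invr_ge0 ?exprn_ge0 // ltW.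
  have nn2 : 0 <= D * (z ^+ a * s ^+ b).
    by rewrite !mulr_ge0 ?exprn_ge0 // ltW.
  have t0 : 0 <= th by case/andP: th01.
  have t1 := ltW th_lt1.
  by apply: ler_pM; rewrite ?powR_ge0 //; apply: ge0_ler_powR;
    rewrite ?nnegrE // mulr_ge0 ?ler0n.
have s0 : 0 < s by case/andP: s01.
clear hD h2 h0 eS S2s e0.
clearbody z eta s.
have sb : 0 < s ^+ b by rewrite exprn_gt0.
rewrite !powRM ?invr_ge0 ?exprn_ge0 ?mulr_ge0 ?exprn_ge0 ?(ltW D0) ?(ltW z0) ?(ltW eta0) ?(ltW s0) //.
have -> : (eta ^- a) `^ th = ((eta `^ th) ^+ a)^-1.
  by rewrite -exprVn powRX ?invr_gt0 // -powR_inv1 ?(ltW eta0) // -powRrM mulN1r powRN exprVn.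
rewrite (powRX _ _ z0) zE exprMn.
have E0 : (eta `^ th) ^+ a != 0 by rewrite expf_neq0 // gt_eqF // powR_gt0.
rewrite exprD -[s ^+ b in leRHS](powR_split th sb).
move: (D `^ _) ((s ^+ b) `^ _) ((s ^+ b) `^ (1 - _)) => x y w.
by rewrite le_eqVlt; apply/orP; left; apply/eqP; field.
Qed.

End Growth.
(** * Summability of the terms of E beyond the given radius *)

Section EGrowth.
Variables (R : realType) (r k : nat) (rho : R) (alpha : R[i]).
Variables (beta gamma x : 'I_r -> R[i]).
Local Notation C := R[i].
Local Notation mindex := {ffun 'I_r -> nat}.
Local Notation term := (E_term k rho alpha beta gamma x).
Local Notation X := (fun i => cmod (x i)).

Lemma E_indexE (m : mindex) :
  E_index k rho m = rho * (first_deg k m)%:R + (last_deg k m)%:R.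
Proof. by []. Qed.

Lemma cmod_E_term (m : mindex) : cmod (term m) =
  cmod (pochhammer alpha (E_index k rho m)) *
  \prod_(i < r) ((if (k <= i)%N then cmod (rising (beta i) (m i)) else 1) /
    cmod (rising (gamma i) (m i)) * (X i ^+ m i / (m i)`!%:R)).
Proof.
rewrite /E_term !cmodM cmodV !cmod_prod -mulrA; congr (_ * _).
rewrite big_split /= big_split /= -big_mkcond /= -prodfV; congr (_ * _).
by apply: eq_bigr => i _; rewrite cmodM cmodV cmodX cmod_nat.
Qed.

(** Up to factors of exponential growth with a rate as close to 1 as desired,
rising factorials are at most [n!], and also at least [n!] when none of them
vanishes. *)
Lemma E_term_le (K : R) : 1 < K ->
  (forall i n, rising (gamma i) n != 0) ->
  exists2 D : R, 0 < D & forall m : mindex,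
    cmod (term m) <= cmod (pochhammer alpha (E_index k rho m)) *
      (D * (K ^+ (2 * (first_deg k m + last_deg k m)) * monomial k X m)).
Proof.
move=> K1 hg; have K0 : 0 < K by lra.
have fac (i : 'I_r) : exists D : R, 0 < D /\ forall n,
    (if (k <= i)%N then cmod (rising (beta i) n) else 1) / cmod (rising (gamma i) n) <=
    D * K ^+ (2 * n) / (if (i < k)%N then n`!%:R else 1).
  have [B B0 hB] := rising_le (beta i) K1; have [G G0 hG] := rising_ge K1 (hg i).
  exists ((B + 1) * G); split; first by rewrite mulr_gt0 //; lra.
  move=> n; have g0 : 0 < cmod (rising (gamma i) n) by rewrite cmod_gt0.
  have f0 := fact_gt0R R n; have Kn : 1 <= K ^+ n by rewrite exprn_ege1 // ltW.
  have Kn0 : 0 < K ^+ n by rewrite exprn_gt0.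
  rewrite mul2n -addnn exprD ltnNge ler_pdivrMr //.
  have hBn := hB n; have hGn := hG n.
  case: (k <= i)%N => /=.
    rewrite divr1; apply: le_trans hBn _.
    apply: (@le_trans _ _ (B * (K ^+ n * (G * (K ^+ n * cmod (rising (gamma i) n)))))).
      by rewrite ler_wpM2l ?(ltW B0) // ler_wpM2l // ltW.
    have P0 : 0 <= K ^+ n * (G * (K ^+ n * cmod (rising (gamma i) n))).
      by rewrite !mulr_ge0 // ltW.
    have -> : (B + 1) * G * (K ^+ n * K ^+ n) * cmod (rising (gamma i) n) =
      (B + 1) * (K ^+ n * (G * (K ^+ n * cmod (rising (gamma i) n)))) by ring.
    by rewrite ler_wpM2r // lerDl.
  rewrite mulrAC ler_pdivlMr // mul1r; apply: le_trans hGn _.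
  have P0 : 0 <= G * (K ^+ n * cmod (rising (gamma i) n)) by rewrite !mulr_ge0 // ltW.
  have -> : (B + 1) * G * (K ^+ n * K ^+ n) * cmod (rising (gamma i) n) =
      ((B + 1) * K ^+ n) * (G * (K ^+ n * cmod (rising (gamma i) n))) by ring.
  by rewrite ler_peMl // mulr_ege1 //; lra.
have [D hD] := choice fac.
exists (\prod_(i < r) D i); first by apply: prodr_gt0 => i _; have [] := hD i.
move=> m; rewrite cmod_E_term ler_wpM2l ?cmod_ge0 //.
have -> : (\prod_(i < r) D i) *
    (K ^+ (2 * (first_deg k m + last_deg k m)) * monomial k X m) =
    \prod_(i < r) ((D i * K ^+ (2 * m i) / (if (i < k)%N then (m i)`!%:R else 1)) *
       (X i ^+ m i / (m i)`!%:R)).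
  rewrite -total_deg big_distrr /= -prod_expr_sum /monomial -!big_split /=.
  apply: eq_bigr => i _; rewrite /den; have := fact_gt0R R (m i).
  case: ifP => _ f0; first by field; rewrite gt_eqF.
  by field; rewrite gt_eqF.
apply: ler_prod => i _; apply/andP; split.
  rewrite !mulr_ge0 ?invr_ge0 ?ler0n ?cmod_ge0 ?exprn_ge0 ?cmod_ge0 //.
  by case: ifP => // _; exact: cmod_ge0.
by rewrite ler_wpM2r ?divr_ge0 ?ler0n ?exprn_ge0 ?cmod_ge0 //; have [_ ->] := hD i.
Qed.

(** The geometric decay leaves room for a weight [q ^ m i1] with [q > 1]. *)
Lemma E_growth_interpolated (th : R) (i1 : 'I_r) :
  (forall i n, rising (gamma i) n != 0) -> 0 <= th <= 1 ->
  2 * th * (\sum_(i < r | (i < k)%N) Num.sqrt (X i)) +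
    \sum_(i < r | (k <= i)%N) X i < 1 ->
  (forall K : R, 1 < K -> exists2 B : R, 0 < B & forall m : mindex,
    cmod (pochhammer alpha (E_index k rho m)) <=
    B * (K ^+ (2 * first_deg k m + last_deg k m) *
      ((2 * first_deg k m + last_deg k m)`!%:R `^ th *
       (last_deg k m)`!%:R `^ (1 - th)))) ->
  exists2 q : R, 1 < q & bounded_sum (fun m => cmod (term m) * q ^+ m i1).
Proof.
move=> hg th01 hS hP.
have [s [D [s01 D0 hD]]] := monomial_interpolated (fun i => cmod_ge0 (x i)) th01 hS.
have s0 : 0 < s by case/andP: s01.
(* K ^ 6 = 1 / s: four factors K are spent on the estimates, one on the weight,
   and the last one makes the sum over multi-indices converge. *)
pose K := s^-1 `^ (1 / 6).
have is0 : 0 < s^-1 by rewrite invr_gt0.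
have K6 : K ^+ 6 = s^-1.
  rewrite /K -powR_mulrn ?powR_ge0 // -powRrM.
  by rewrite (_ : 1 / 6 * 6%:R = 1) ?powRr1 ?(ltW is0) //; field.
have K0 : 0 < K by rewrite powR_gt0.
have K1 : 1 < K.
  rewrite ltNge; apply/negP => Kle; have : K ^+ 6 <= 1 by rewrite exprn_ile1 // ltW.
  by rewrite K6 invf_le1 //; case/andP: s01 => _ s1; rewrite leNgt s1.
exists K => //; have [B B0 hB] := hP K K1; have [E E0 hE] := E_term_le K1 hg.
have iK : 0 <= K^-1 < 1 by rewrite invr_ge0 (ltW K0) invf_lt1.
apply: bounded_sum_le (bounded_sumZ (ltW (mulr_gt0 (mulr_gt0 B0 E0) D0))
  (@bounded_sum_ffun R r (fun n => K^-1 ^+ n) ((1 - K^-1)^-1) _ _)); first last.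
- by move=> N; exact: geometric_sum_le.
- by move=> n; rewrite exprn_ge0 // invr_ge0 ltW.
move=> m; rewrite prod_expr_sum (total_deg k).
set a := first_deg k m; set b := last_deg k m.
have KK j : 0 < K ^+ j by rewrite exprn_gt0.
have mi : K ^+ m i1 <= K ^+ (a + b).
  rewrite /a /b -total_deg; apply: ler_weXn2l; first exact: ltW.
  by rewrite (bigD1 i1) //= leq_addr.
have h1 : cmod (term m) <= (B * (K ^+ (2 * a + b) * ((2 * a + b)`!%:R `^ th *
       b`!%:R `^ (1 - th)))) * (E * (K ^+ (2 * (a + b)) * monomial k X m)).
  apply: le_trans (hE m) _; rewrite ler_wpM2r ?hB //.
  rewrite !mulr_ge0 ?(ltW E0) ?exprn_ge0 ?(ltW K0) //.
  by apply: monomial_ge0 => i; exact: cmod_ge0.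
have h2 : cmod (term m) <= B * E * (K ^+ (2 * a + b) * K ^+ (2 * (a + b))) *
    (D * s ^+ (a + b)).
  apply: le_trans h1 _.
  have -> : B * (K ^+ (2 * a + b) * ((2 * a + b)`!%:R `^ th * b`!%:R `^ (1 - th))) *
      (E * (K ^+ (2 * (a + b)) * monomial k X m)) =
    B * E * (K ^+ (2 * a + b) * K ^+ (2 * (a + b))) *
    ((2 * a + b)`!%:R `^ th * b`!%:R `^ (1 - th) * monomial k X m) by ring.
  by rewrite ler_wpM2l ?hD // !mulr_ge0 ?exprn_ge0 ?ltW.
apply: (@le_trans _ _ (B * E * (K ^+ (2 * (a + b)) * K ^+ (2 * (a + b))) *
    (D * s ^+ (a + b)) * K ^+ (a + b))).
  apply: ler_pM; rewrite ?cmod_ge0 ?exprn_ge0 ?(ltW K0) //.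
  apply: le_trans h2 _; rewrite ler_wpM2r ?mulr_ge0 ?exprn_ge0 ?(ltW D0) ?(ltW s0) //.
  rewrite ler_wpM2l ?mulr_ge0 ?(ltW B0) ?(ltW E0) // ler_wpM2r ?exprn_ge0 ?(ltW K0) //.
  by apply: ler_weXn2l; [exact: ltW|rewrite mulnDr leq_add2l mul2n -addnn leq_addr].
have -> : s ^+ (a + b) = (K ^+ (a + b)) ^- 6.
  by rewrite -exprM mulnC exprM K6 exprVn invrK.
rewrite mulnC exprM; set u := K ^+ (a + b).
have u0 : u != 0 by rewrite gt_eqF // exprn_gt0.
by rewrite exprVn -/u le_eqVlt; apply/orP; left; apply/eqP; field.
Qed.

Lemma E_domain_real : E_domain k rho x ->
  rho * (\sum_(i < r | (i < k)%N) Num.sqrt (X i)) + \sum_(i < r | (k <= i)%N) X i < 1.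
Proof.
rewrite /E_domain => h; rewrite -ltcR rmorphD rmorphM !rmorph_sum rmorph1 /=.
have -> : \sum_(i < r | (i < k)%N) (Num.sqrt (X i))%:C =
    \sum_(i < r | (i < k)%N) sqrtC `|x i|.
  apply: eq_bigr => i _; rewrite normc_cmod -{2}(sqr_sqrtr (cmod_ge0 (x i))).
  by rewrite rmorphXn /= sqrCK // lecR sqrtr_ge0.
by have -> : \sum_(i < r | (k <= i)%N) (X i)%:C = \sum_(i < r | (k <= i)%N) `|x i|
  by apply: eq_bigr => i _; rewrite normc_cmod.
Qed.

End EGrowth.
Section EGrowthTheorem.
Variables (R : realType) (r k : nat) (rho : R) (alpha : R[i]).
Variables (beta gamma x : 'I_r -> R[i]).
Local Notation C := R[i].
Local Notation mindex := {ffun 'I_r -> nat}.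
Local Notation term := (E_term k rho alpha beta gamma x).
Local Notation X := (fun i => cmod (x i)).

Lemma fact_powR_unbounded (p Q D : R) : 0 < p -> 0 < Q ->
  ~ (forall n, n`!%:R `^ p <= D * Q ^+ n).
Proof.
move=> p0 Q0 h; have Q2 : 0 < 2 * Q by rewrite mulr_gt0.
pose y := (2 * Q) `^ p^-1.
have yp : y `^ p = 2 * Q by rewrite /y -powRrM mulVf ?gt_eqF // powRr1 // ltW.
have [J hJ] := @archimedean_mul R y 1 ltr01.
have [n|n|n Jn|B B0 hB] :=
  @ratio_bound R (fun n => (2 * Q) ^+ n) (fun n => n`!%:R `^ p) J.
- by rewrite exprn_ge0 // ltW.
- by rewrite powR_gt0 // fact_gt0R.
- rewrite exprSr -mulrA ler_wpM2l ?exprn_ge0 ?(ltW Q2) //.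
  rewrite factS natrM powRM ?ler0n // ler_wpM2r ?powR_ge0 // -yp.
  apply: ge0_ler_powR; rewrite ?nnegrE ?powR_ge0 ?ler0n ?(ltW p0) //.
  by apply: le_trans (hJ n Jn) _; rewrite mulr1 ler_nat.
have hn n : 2 ^+ n <= B * D.
  have Qn : 0 < Q ^+ n by rewrite exprn_gt0.
  rewrite -(ler_pM2r Qn) -exprMn; apply: le_trans (hB n) _.
  by rewrite -mulrA ler_wpM2l // ltW.
have [N hN] := @archimedean_mul R (B * D + 1) 1 ltr01.
have := hN N (leqnn _); rewrite mulr1; have := hn N.
have : N%:R <= 2 ^+ N :> R by rewrite -natrX ler_nat ltnW // ltn_expl.
lra.
Qed.

Lemma E_growth_finite (i1 : 'I_r) (J : nat) : abs_summable term ->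
  (forall m : mindex, (J <= m i1)%N -> term m = 0) ->
  exists2 q : R, 1 < q & bounded_sum (fun m => cmod (term m) * q ^+ m i1).
Proof.
move=> hs h; exists 2; first by rewrite ltr1n.
apply: bounded_sum_le (bounded_sumZ (exprn_ge0 J (ler0n R 2)) hs) => m.
have [Jm|mJ] := leqP J (m i1); first by rewrite h // cmod0 mul0r mulr0.
rewrite mulrC ler_wpM2r ?cmod_ge0 // ler_weXn2l ?ler1n //; exact: ltnW.
Qed.

Definition single (i1 : 'I_r) (n : nat) : mindex :=
  [ffun i => if i == i1 then n else 0%N].

Lemma single_deg (i1 : 'I_r) (n : nat) : (i1 < k)%N ->
  first_deg k (single i1 n) = n /\ last_deg k (single i1 n) = 0%N.
Proof.
move=> ik; split.
  rewrite /first_deg (bigD1 i1) //= ffunE eqxx big1 ?addn0 // => i /andP[_ ne].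
  by rewrite ffunE (negbTE ne).
rewrite /last_deg big1 // => i ki; rewrite ffunE; case: eqP => // ii.
by move: ki; rewrite ii leqNgt ik.
Qed.

Lemma cmod_E_term_single (i1 : 'I_r) (n : nat) : (i1 < k)%N ->
  cmod (term (single i1 n)) = cmod (pochhammer alpha (rho * n%:R)) *
    (X i1 ^+ n / (cmod (rising (gamma i1) n) * n`!%:R)).
Proof.
move=> ik; rewrite cmod_E_term E_indexE.
have [-> ->] := single_deg n ik; rewrite addr0; congr (_ * _).
rewrite (bigD1 i1) //= big1 ?mulr1 => [|i ne].
  by rewrite ffunE eqxx leqNgt ik /= mul1r invfM mulrCA.
rewrite ffunE (negbTE ne) !rising0 cmod1 expr0 fact0 !divr1.
by case: ifP; rewrite mulr1.
Qed.

(** Along the multi-indices carried by [i1] the terms grow at least like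
[(m!) ^ (rho - 2)], up to an exponential factor. *)
Lemma E_divergent (i1 : 'I_r) : (i1 < k)%N -> ~ nonpos_integer alpha -> 2 < rho ->
  x i1 != 0 -> (forall n, rising (gamma i1) n != 0) ->
  (forall m : mindex, pochhammer_defined alpha (E_index k rho m)) -> ~ abs_summable term.
Proof.
move=> ik hal rho2 x0 hg hd /abs_summable_term[M [M0 hM]].
have [n|m0 [c c0 hc]] := pochhammer_ge hal rho2.
  have := hd (single i1 n); rewrite E_indexE.
  by have [-> ->] := single_deg n ik; rewrite addr0.
have [B B0 hB] := @rising_le R (gamma i1) 2 (ltr1n R 2).
have X0 : 0 < X i1 by rewrite cmod_gt0.
pose Q : R := 8 / X i1; have Q0 : 0 < Q by rewrite divr_gt0.
pose D := M * B * m0`!%:R ^+ 2 * Q ^+ m0 / c.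
apply: (@fact_powR_unbounded (rho - 2) Q D) => // [|m]; first by rewrite subr_gt0.
pose n := (m0 + m)%N; have fn := fact_gt0R R n; have fm := fact_gt0R R m.
have gn : 0 < cmod (rising (gamma i1) n) by rewrite cmod_gt0.
have Xn : 0 < X i1 ^+ n by rewrite exprn_gt0.
have h1 : cmod (pochhammer alpha (rho * n%:R)) * X i1 ^+ n <=
    M * (B * (2 ^+ n * n`!%:R) * n`!%:R).
  have := hM (single i1 n); rewrite cmod_E_term_single // mulrA.
  rewrite ler_pdivrMr ?mulr_gt0 // => h; apply: le_trans h _.
  by rewrite ler_wpM2l ?(ltW M0) // ler_wpM2r ?ler0n.
have h2 : n`!%:R <= 2 ^+ n * (m0`!%:R * m`!%:R) :> R.
  have := @binomial_term_two R m0 m 1 1 ler01 ler01.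
  by rewrite !expr1n !mulr1 mulrC.
have h3 : c * m`!%:R `^ rho * X i1 ^+ n <=
    M * B * 2 ^+ n * (2 ^+ n * (m0`!%:R * m`!%:R)) ^+ 2.
  apply: (@le_trans _ _ (cmod (pochhammer alpha (rho * n%:R)) * X i1 ^+ n)).
    by rewrite ler_wpM2r ?(ltW Xn) // hc.
  apply: le_trans h1 _.
  have -> : M * (B * (2 ^+ n * n`!%:R) * n`!%:R) = M * B * 2 ^+ n * n`!%:R ^+ 2 by ring.
  rewrite ler_wpM2l ?mulr_ge0 ?exprn_ge0 ?(ltW M0) ?(ltW B0) //.
  by apply: lerXn2r => //; rewrite nnegrE ?ler0n // (le_trans _ h2).
have E1 : m`!%:R `^ rho = m`!%:R `^ (rho - 2) * m`!%:R ^+ 2 :> R.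
  by rewrite -powR_mulrn ?ler0n // -powRD ?subrK // (gt_eqF fm) implybT.
have fm2 : 0 < m`!%:R ^+ 2 :> R by rewrite exprn_gt0.
rewrite -(ler_pM2r (mulr_gt0 (mulr_gt0 c0 fm2) Xn)).
have -> : m`!%:R `^ (rho - 2) * (c * m`!%:R ^+ 2 * X i1 ^+ n) =
   c * m`!%:R `^ rho * X i1 ^+ n by rewrite E1; ring.
apply: le_trans h3 _; rewrite le_eqVlt; apply/orP; left; apply/eqP.
have E2 : Q ^+ n * X i1 ^+ n = 2 ^+ n * (2 ^+ n) ^+ 2.
  rewrite -exprMn /Q divfK ?gt_eqF // -exprM mulnC exprM -exprMn.
  by congr (_ ^+ _); ring.
have -> : D * Q ^+ m * (c * m`!%:R ^+ 2 * X i1 ^+ n) =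
    M * B * m0`!%:R ^+ 2 * m`!%:R ^+ 2 * (Q ^+ n * X i1 ^+ n).
  rewrite (exprD Q m0 m) /D.
  move: (Q ^+ m0) (Q ^+ m) (X i1 ^+ n) => q0 qm xn.
  by field; rewrite gt_eqF.
by rewrite E2; ring.
Qed.

(** The weight depends on the domain condition, or on the termination of the
series in the first index when [x i1 = 0] or when [alpha] is a pole. *)
Theorem E_growth (i1 : 'I_r) : val i1 = 0%N -> 0 <= rho ->
  E_defined k rho alpha beta gamma x ->
  exists2 q : R, 1 < q & bounded_sum (fun m => cmod (term m) * q ^+ m i1).
Proof.
move=> i10 rho0 [hd hg /E_domain_real hS hcv].
have hs : abs_summable term := has_sum_abs_summable (has_sum_summability hcv).
have S1 : 0 <= \sum_(i < r | (i < k)%N) Num.sqrt (X i).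
  by apply: sumr_ge0 => i _; exact: sqrtr_ge0.
have rS1 := mulr_ge0 rho0 S1.
have nodep : (forall m : mindex, E_index k rho m = (last_deg k m)%:R) ->
    exists2 q : R, 1 < q & bounded_sum (fun m => cmod (term m) * q ^+ m i1).
  move=> hE; apply: (@E_growth_interpolated _ _ _ _ _ _ _ _ 0) => //.
  - by rewrite lexx ler01.
  - by rewrite mulr0 mul0r add0r; lra.
  move=> K K1; have [B B0 hB] := rising_le alpha K1; exists B => // m.
  rewrite hE pochhammer_nat powRr0 mul1r subr0 powRr1 ?ler0n //.
  apply: le_trans (hB _) _; rewrite ler_wpM2l ?(ltW B0) // ler_wpM2r ?ler0n //.
  by apply: ler_weXn2l; [exact: ltW|exact: leq_addl].
have [k0|k0] := posnP k.
  apply: nodep => m; rewrite E_indexE [first_deg _ _]big1 ?mulr0 ?add0r // => i.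
  by rewrite k0 ltn0.
have ik : (i1 < k)%N by rewrite i10.
have [rho00|rho_neq0] := eqVneq rho 0.
  by apply: nodep => m; rewrite E_indexE rho00 mul0r add0r.
have rho_gt0 : 0 < rho by rewrite lt_def rho_neq0.
have [x0|x0] := eqVneq (x i1) 0.
  apply: (@E_growth_finite i1 1 hs) => m m1.
  by rewrite /E_term [X in _ * X](bigD1 i1) //= x0 expr0n gtn_eqF // !mul0r mulr0.
have [hal|hal] := pselect (nonpos_integer alpha).
  have [n aln] := hal.
  have nat_index (m : mindex) : E_index k rho m \is a Num.nat by have [//|[/(_ hal)]] := hd m.
  have rho1 : 1 <= rho.
    have := nat_index (single i1 1); rewrite E_indexE.
    have [-> ->] := single_deg 1 ik; rewrite mulr1 addr0 => /natrP[j rj].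
    by move: rho_gt0; rewrite rj ltr0n ler1n.
  apply: (@E_growth_finite i1 n.+1 hs) => m nm.
  rewrite /E_term /pochhammer nat_index.
  have nN : (n < Num.truncn (E_index k rho m))%N.
    rewrite -(ltr_nat R) truncnK //; apply: (@lt_le_trans _ _ (m i1)%:R).
      by rewrite ltr_nat.
    rewrite E_indexE; apply: (@le_trans _ _ (rho * (first_deg k m)%:R)); last first.
      by rewrite lerDl ler0n.
    apply: (@le_trans _ _ (first_deg k m)%:R); last by rewrite ler_peMl ?ler0n.
    by rewrite ler_nat /first_deg (bigD1 i1) //= leq_addr.
  rewrite /rising (bigD1 (Ordinal nN)) //= aln addNr.
  by rewrite !mul0r.
have [rho2|rho2] := leP rho 2; last first.
  by case: (E_divergent ik hal rho2 x0 (hg i1) hd hs).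
apply: (@E_growth_interpolated _ _ _ _ _ _ _ _ (rho / 2)) => //.
- by apply/andP; split; lra.
- by rewrite mulrCA divff ?mulr1 // pnatr_eq0.
move=> K K1.
pose P a b := exists m : mindex, first_deg k m = a /\ last_deg k m = b.
have rE : 2 * (rho / 2) = rho by rewrite mulrCA divff ?mulr1 // pnatr_eq0.
have [||B B0 hB] := @pochhammer_le R alpha (rho / 2) K P hal _ K1.
- by apply/andP; split; lra.
- by move=> a b [m [<- <-]]; rewrite rE -E_indexE.
by exists B => // m; have := hB _ _ (ex_intro _ m (conj erefl erefl)); rewrite rE -E_indexE.
Qed.
End EGrowthTheorem.
(** * The generating function *)

Section Reflection.
Variable R : realType.
Local Notation C := R[i].

Lemma rising_add (a : C) (p q : nat) :
  rising a (p + q) = rising a p * rising (a + p%:R) q.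
Proof.
elim: q => [|q IH]; first by rewrite addn0 rising0 mulr1.
by rewrite addnS !risingS IH natrD -!mulrA addrA.
Qed.

Lemma rising_reflect (b : C) (N : nat) :
  rising (1 - b - N%:R) N = (-1) ^+ N * rising b N.
Proof.
rewrite /rising (reindex_inj rev_ord_inj) /= -[X in (-1) ^+ X](card_ord N).
rewrite -prodr_const -big_split /=; apply: eq_bigr => j _.
by rewrite natrB // -natr1; ring.
Qed.

(** Both sides are, up to the sign [(-1) ^ N], the product of the factors from
[l - N] to [l + n - 1], split at different places. *)
Lemma rising_shift (l : C) (n N : nat) :
  rising l n * rising (1 - l) N = rising (l - N%:R) n * rising (1 - l - n%:R) N.
Proof.
have h1 : rising (l - N%:R) N = (-1) ^+ N * rising (1 - l) N.
  by rewrite -rising_reflect; congr rising; ring.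
have h2 : rising (l - N%:R + n%:R) N = (-1) ^+ N * rising (1 - l - n%:R) N.
  by rewrite -rising_reflect; congr rising; ring.
have h3 : rising (l - N%:R) N * rising l n =
    rising (l - N%:R) n * rising (l - N%:R + n%:R) N.
  by rewrite -rising_add addnC rising_add subrK.
have s0 : (-1) ^+ N != 0 :> C by rewrite signr_eq0.
apply: (mulfI s0); rewrite mulrCA -h1 mulrC h3 h2; ring.
Qed.
End Reflection.

Theorem theorem4 (R : realType) (r k : nat) (hr : (0 < r)%N) (hk : (k <= r)%N)
  (rho : R) (hrho : 0 <= rho) (alpha : R[i]) (beta gamma x : 'I_r -> R[i])
  (lambda t : R[i]) (ht : `|t| < 1) :
  let i1 := Ordinal hr in
  let gamma_at c := [eta gamma with i1 |-> c] in
  let x' := [eta x with i1 |-> x i1 * (1 - t)] in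
  let u n : R[i] :=
    rising lambda n / n`!%:R
    * hyperE k rho alpha beta (gamma_at (1 - lambda - n%:R)) x * t ^+ n in
  (forall n : nat,
     E_defined k rho alpha beta (gamma_at (1 - lambda - n%:R)) x) ->
  E_defined k rho alpha beta (gamma_at (1 - lambda)) x' ->
  cvgn (series u) ->
  limn (series u) =
    cpow (1 - t) (- lambda)
    * hyperE k rho alpha beta (gamma_at (1 - lambda)) x'.
Proof.
move=> i1 gamma_at x' u hdef hdef' hu.
have t1 : cmod t < 1 by rewrite -ltcR -normc_cmod rmorph1.
have gneq (c : R[i]) i : i != i1 -> gamma_at c i = gamma i.
  by move=> /negbTE ii; rewrite /gamma_at /= ii.
have geq (c : R[i]) : gamma_at c i1 = c by [].
pose c (m : {ffun 'I_r -> nat}) := E_term k rho alpha beta (gamma_at (1 - lambda)) x m.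
have hdef0 : E_defined k rho alpha beta (gamma_at (1 - lambda)) x.
  by have := hdef 0%N; rewrite subr0.
have cE n m : rising lambda n / n`!%:R *
    E_term k rho alpha beta (gamma_at (1 - lambda - n%:R)) x m =
    c m * binom_coef (lambda - (m i1)%:R) n.
  have [_ /(_ i1 (m i1)) gn _ _] := hdef n; rewrite geq in gn.
  have [_ /(_ i1 (m i1)) g0 _ _] := hdef0; rewrite geq in g0.
  rewrite /c /E_term /binom_coef.
  have P d : \prod_(i < r) rising (gamma_at d i) (m i) =
      rising d (m i1) * \prod_(i < r | i != i1) rising (gamma i) (m i).
    rewrite (bigD1 i1) //; congr (_ * _).
    by apply: eq_bigr => i /gneq ->.
  rewrite !P; have S := rising_shift lambda n (m i1).
  have -> : rising lambda n = rising (lambda - (m i1)%:R) n *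
      rising (1 - lambda - n%:R) (m i1) / rising (1 - lambda) (m i1).
    by rewrite -S mulfK.
  rewrite !invfM.
  move: (rising (1 - lambda - n%:R) (m i1)) gn (rising (1 - lambda) (m i1)) g0 => a a0 b b0.
  move: (pochhammer _ _) (\prod_(i < r | (k <= i)%N) _) (\prod_(i < r | i != i1) _) => p v w.
  move: (\prod_(i < r) _) (rising _ n) (w^-1) => y z w'.
  by field; rewrite ?a0 ?b0 ?factC_neq0.
pose e n := rising lambda n / n`!%:R *
  hyperE k rho alpha beta (gamma_at (1 - lambda - n%:R)) x.
have he n : has_sum (fun m => c m * binom_coef (lambda - (m i1)%:R) n) (e n).
  have [_ _ _ cv] := hdef n; have := has_sumZ (rising lambda n / n`!%:R) (has_sum_summability cv).
  by apply: has_sum_ext => m; exact: cE.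
have hG : has_sum (fun m => c m * (1 - t) ^+ m i1)
    (hyperE k rho alpha beta (gamma_at (1 - lambda)) x').
  have [_ _ _ cv] := hdef'; have := has_sum_summability cv.
  apply: has_sum_ext => m.
  have P : \prod_(i < r) (x' i ^+ m i / (m i)`!%:R) =
      \prod_(i < r) (x i ^+ m i / (m i)`!%:R) * (1 - t) ^+ m i1.
    rewrite (bigD1 i1) // [in RHS](bigD1 i1) //=.
    rewrite (eq_bigr (fun i => x i ^+ m i / (m i)`!%:R)) => [|i /negbTE ii].
      by rewrite exprMn; ring.
    by rewrite ii.
  by rewrite /c /E_term P mulrA.
have [q0 q01 hq0] := @E_growth R r k rho alpha beta _ x i1 erefl hrho hdef0.
pose q := Num.max q0 (cmod (1 - t)).
have q1 : 1 < q by rewrite lt_max q01.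
have tq : cmod (1 - t) <= q by rewrite le_max lexx orbT.
have hc : bounded_sum (fun m => cmod (c m) * q ^+ m i1).
  rewrite /q; case: (leP q0 (cmod (1 - t))) => _ //.
  by apply: bounded_sum_le (has_sum_abs_summable hG) => m; rewrite cmodM cmodX.
apply: (@sum_binom_coef_family R _ c (fun m => m i1) lambda t q e) => //.
- have := cvgn_seq_lim hu; congr seq_lim; apply/funext => n.
  by rewrite /series /= big_mkord.
- exact: has_sum_binomial.
Qed.
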